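(* Let $u\in\mathbb{R}^n$ be a non-zero vector accessible through a quantum evaluation oracle, let $1<T<n$ be an integer, let $\Gamma>0$ be a real and $S\subseteq[n]$ a set (given explicitly) with $\Gamma\ge\|u_S\|_1$, and let $M=\|u_{[n]\setminus S}\|_\infty$ be given. There is a quantum algorithm that, on these inputs, outputs a sequence $(i_1,\dots,i_T)\in[n]^T$ consisting of $T$ independent samples from the distribution $\mathcal{D}_u(\Gamma,S)$. Moreover, if $|\Gamma - \|u\|_1| \leq \|u\|_1/\sqrt{T}$ and $S = \{i \in [n] : |u_i| \geq \Gamma/T\}$, then the expected run-time of the algorithm is $O(\sqrt{Tn} \cdot \mathrm{EO})$.
   Context: The quantum evaluation oracle to $u$ is a unitary $\mathcal{O}_u$ with $\mathcal{O}_u(|i\rangle|0\rangle)=|i\rangle|u_i\rangle$ for all $i\in[n]$; $\mathrm{EO}$ is its cost. For $S\subseteq[n]$, $u_S=(u_i)_{i\in S}$ is the subvector of $u$ on $S$, and $\|\cdot\|_1,\|\cdot\|_\infty$ are the usual norms. For $\Gamma>0$ and $S\subseteq[n]$ with $\Gamma\ge\|u_S\|_1$, $\mathcal{D}_u(\Gamma,S)$ is the distribution on $[n]$ that outputs $i$ with probability $|u_i|/\Gamma$ if $i\in S$, and with probability $\left(1-\frac{\|u_S\|_1}{\Gamma}\right)\frac{|u_i|}{\|u_{[n]\setminus S}\|_1}$ if $i\in[n]\setminus S$. *)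

(* Defs.v *)
From HB Require Import structures.
From mathcomp Require Import all_boot all_order all_algebra complex.
From mathcomp Require Import boolp classical_sets reals ereal topology.
From mathcomp Require Import normedtype sequences trigo.

Set Implicit Arguments.
Unset Strict Implicit.
Unset Printing Implicit Defensive.

Import Order.TTheory GRing.Theory Num.Theory numFieldNormedType.Exports.

Local Open Scope ring_scope.

(* The index set [n] of the mathematics is ['I_n.+1] (it is never empty). *)

Definition l1 (R : realType) (n : nat) (u : 'rV[R]_n.+1) (S : {set 'I_n.+1}) : R :=
  \sum_(i in S) `|u ord0 i|.

Definition linf (R : realType) (n : nat) (u : 'rV[R]_n.+1) (S : {set 'I_n.+1}) : R :=
  \big[Num.max/0]_(i in S) `|u ord0 i|.

Definition Dprob (R : realType) (n : nat) (u : 'rV[R]_n.+1) (G : R)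
    (S : {set 'I_n.+1}) (i : 'I_n.+1) : R :=
  if i \in S then `|u ord0 i| / G
  else (1 - l1 u S / G) * (`|u ord0 i| / l1 u (~: S)).

(* If Gamma > ||u_S||_1 while u vanishes outside S, the formula above has a
   positive mass to spread proportionally to the zero vector: there is no
   distribution D_u(Gamma,S) in that case. *)
Definition D_defined (R : realType) (n : nat) (u : 'rV[R]_n.+1) (G : R)
    (S : {set 'I_n.+1}) : Prop :=
  G = l1 u S \/ l1 u (~: S) != 0.

(* A classical real-RAM with random access memory, extended with [k] quantum
    registers of each of three kinds: index words (basis |i>, i in [n]), value
    words (basis |x>, x a representable real) and qubits.  The syntax mentions
    neither n, nor the reals, nor the input vector: one finite program handles
    all the inputs. *)

Inductive qreg (k : nat) : Type :=
  | Idx of 'I_k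
  | Val of 'I_k
  | Bit of 'I_k.

Inductive binop : Type := OAdd | OSub | OMul | ODiv | OLess.

(* [Q] is the type of the quantum registers an expression may refer to.
   [Cell a e] is the cell of address [e] of the array [a]; when [Q] is a type of
   quantum registers, this is a (read-only) quantum random access. *)
Inductive expr (Q : Type) : Type :=
  | Lit of nat
  | Reg of Q
  | Cell of nat & expr Q
  | Bin of binop & expr Q & expr Q.
Arguments Lit {Q}.

Notation cexpr := (expr void).
Notation qexpr k := (expr (qreg k)).

Inductive gate (k : nat) : Type :=
  | QFT of 'I_k                   (* Fourier transform modulo n *)
  | QFTinv of 'I_k
  | Shift of 'I_k & qexpr k       (* |j> |-> |j + e mod n> *)
  | Rot of 'I_k & qexpr k         (* |0> |-> sqrt(1-e)|0> + sqrt(e)|1>, and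
                                     |1> |-> sqrt(e)|0> - sqrt(1-e)|1> *)
  | Phase of qexpr k.             (* multiplication by exp(2 pi i e) *)

Inductive cmd (k : nat) : Type :=
  | Skip
  | Assign of nat & cexpr & cexpr           (* a[e1] := e2 *)
  | Rand of nat & cexpr & cexpr             (* a[e1] := uniform in {0,..,e2} *)
  | Apply of gate k
  | Query of 'I_k & 'I_k
  | QueryInv of 'I_k & 'I_k
  | Measure of qreg k & nat & cexpr         (* a[e] := outcome; reset to |0> *)
  | Seq of cmd k & cmd k
  | If of cexpr & cmd k & cmd k
  | While of cexpr & cmd k.

Record algorithm := Algorithm { nregs : nat; program : cmd nregs }.
Arguments program : clear implicits.

(* A finite-dimensional register whose basis states are labelled by reals. *)
Record valspace (R : realType) := Valspace {
  vtype : finType;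
  label : vtype -> R;
  label_inj : injective label;
  vzero : vtype;
  label_vzero : label vzero = 0 }.

Definition basis (R : realType) (V : valspace R) (k n : nat) : finType :=
  ({ffun 'I_k -> 'I_n.+1} * {ffun 'I_k -> vtype V} * {ffun 'I_k -> bool})%type.

(* Not necessarily normalised; see [config]. *)
Definition qstate (R : realType) (V : valspace R) (k n : nat) : Type :=
  {ffun basis V k n -> R[i]}.

Definition sqnorm (R : realType) (B : finType) (psi : {ffun B -> R[i]}) : R :=
  \sum_s (complex.Re (psi s) ^+ 2 + complex.Im (psi s) ^+ 2).

(* exp(2 pi i t) *)
Definition cis (R : realType) (t : R) : R[i] :=
  (cos (2 * pi * t) +i* sin (2 * pi * t))%C.

Definition ket0 (R : realType) (V : valspace R) (k n : nat) : basis V k n :=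
  ([ffun=> ord0], [ffun=> vzero V], [ffun=> false]).

Definition upd (I : eqType) (W : Type) (f : I -> W) (i : I) (w : W) : I -> W :=
  fun j => if j == i then w else f j.

Section Registers.
Context (R : realType) (V : valspace R) (k n : nat).
Implicit Types (s : basis V k n) (r : 'I_k).

Definition getI r s : 'I_n.+1 := s.1.1 r.
Definition setI r (w : 'I_n.+1) s : basis V k n :=
  (finfun (upd s.1.1 r w), s.1.2, s.2).
Definition getV r s : vtype V := s.1.2 r.
Definition setV r (w : vtype V) s : basis V k n :=
  (s.1.1, finfun (upd s.1.2 r w), s.2).
Definition getB r s : bool := s.2 r.
Definition setB r (w : bool) s : basis V k n :=
  (s.1.1, s.1.2, finfun (upd s.2 r w)).

(* The operator of matrix [U] on the register accessed by [get] and [set].  The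
   matrix may depend on the basis states of the other registers only, since this
   register is reset to [w0] in the first argument of [U]: if all the
   [U s] are unitary, so is the result. *)
Definition act (W : finType) (get : basis V k n -> W)
    (set : W -> basis V k n -> basis V k n) (w0 : W)
    (U : basis V k n -> W -> W -> R[i]) (psi : qstate V k n) : qstate V k n :=
  [ffun s => \sum_w U (set w0 s) (get s) w * psi (set w s)].

(* Projection on the outcome [w], followed by a reset of the register to [w0]. *)
Definition collapse (W : finType) (get : basis V k n -> W)
    (set : W -> basis V k n -> basis V k n) (w0 : W) (psi : qstate V k n)
    (w : W) : qstate V k n :=
  [ffun s => if get s == w0 then psi (set w s) else 0].

Definition read (q : qreg k) s : R :=
  match q with
  | Idx r => (getI r s)%:R
  | Val r => label (getV r s)
  | Bit r => (getB r s)%:R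
  end.

(* The possible outcomes with the corresponding unnormalised states. *)
Definition measure (q : qreg k) (psi : qstate V k n) : seq (R * qstate V k n) :=
  match q with
  | Idx r => [seq ((w : nat)%:R, collapse (getI r) (setI r) ord0 psi w)
             | w : 'I_n.+1 <- enum 'I_n.+1]
  | Val r => [seq (label w, collapse (getV r) (setV r) (vzero V) psi w)
             | w <- enum (vtype V)]
  | Bit r => [seq ((w : nat)%:R, collapse (getB r) (setB r) false psi w)
             | w : bool <- [:: false; true]]
  end.

End Registers.

(* [U y x] is the matrix entry <y|U|x>. *)
Definition operator (R : realType) (X : finType) : Type := X -> X -> R[i].

Definition adjoint (R : realType) (X : finType) (U : operator R X) : operator R X :=
  fun y x => conjc (U x y).

Definition unitary (R : realType) (X : finType) (U : operator R X) : Prop :=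
  forall x x', \sum_y adjoint U x y * U y x' = (x == x')%:R.

Definition eval_oracle (R : realType) (n : nat) (u : 'rV[R]_n.+1) (V : valspace R)
    (U : operator R ('I_n.+1 * vtype V)%type) : Prop :=
  unitary U /\
  forall i, exists2 v, label v = u ord0 i &
    forall y, U y (i, vzero V) = (y == (i, v))%:R.

Definition memory (R : realType) : Type := nat -> nat -> R.

Definition write (R : realType) (m : memory R) (a j : nat) (x : R) : memory R :=
  upd m a (upd (m a) j x).

Definition eval_bin (R : realType) (o : binop) (x y : R) : R :=
  match o with
  | OAdd => x + y
  | OSub => x - y
  | OMul => x * y
  | ODiv => x / y
  | OLess => (x < y)%R%:R
  end.

Fixpoint eval (R : realType) (Q : Type) (m : memory R) (rho : Q -> R)
    (e : expr Q) : R :=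
  match e with
  | Lit c => c%:R
  | Reg q => rho q
  | Cell a e1 => m a (Num.truncn (eval m rho e1))
  | Bin o e1 e2 => eval_bin o (eval m rho e1) (eval m rho e2)
  end.

Definition ceval (R : realType) (m : memory R) (e : cexpr) : R :=
  eval m (of_void R) e.

Definition clamp (R : realType) (x : R) : R := Num.max 0 (Num.min 1 x).

(* A branch of the computation.  The state [psi] is not normalised: [sqnorm psi]
   is the probability of the branch. *)
Record config (R : realType) (V : valspace R) (k n : nat) := Config {
  todo : seq (cmd k);
  store : memory R;
  psi : qstate V k n;
  time : R }.

Section Semantics.
Context (R : realType) (V : valspace R) (k n : nat).
Context (U : operator R ('I_n.+1 * vtype V)%type) (EO : R).

Definition qeval (m : memory R) (s : basis V k n) (e : qexpr k) : R :=
  eval m (fun q => read q s) e.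

Definition apply_gate (m : memory R) (g : gate k) (phi : qstate V k n) :
    qstate V k n :=
  match g with
  | QFT r => act (getI r) (setI r) ord0 (fun _ (y x : 'I_n.+1) =>
      (Num.sqrt n.+1%:R)^-1%:C%C * cis (y%:R * x%:R / n.+1%:R)) phi
  | QFTinv r => act (getI r) (setI r) ord0 (fun _ (y x : 'I_n.+1) =>
      (Num.sqrt n.+1%:R)^-1%:C%C * cis (- (y%:R * x%:R / n.+1%:R))) phi
  | Shift r e => act (getI r) (setI r) ord0 (fun s (y x : 'I_n.+1) =>
      ((y : nat) == (x + Num.truncn (qeval m s e)) %% n.+1)%N%:R) phi
  | Rot r e => act (getB r) (setB r) false (fun s (y x : bool) =>
      let p := clamp (qeval m s e) in
      (if y (+) x then Num.sqrt p
       else (-1) ^+ (y && x) * Num.sqrt (1 - p))%:C%C) phi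
  | Phase e => [ffun s => cis (qeval m s e) * phi s]
  end.

Definition apply_query (W : operator R ('I_n.+1 * vtype V)%type) (r v : 'I_k)
    (phi : qstate V k n) : qstate V k n :=
  act (fun s => (getI r s, getV v s))
      (fun w s => setI r w.1 (setV v w.2 s)) (ord0, vzero V)
      (fun _ => W) phi.

(* Every elementary operation costs 1, a query costs [EO]. *)
Definition step (c : config V k n) : seq (config V k n) :=
  let: Config ks m phi t := c in
  match ks with
  | [::] => [:: c]
  | i :: K =>
    match i with
    | Skip => [:: Config K m phi (t + 1)]
    | Assign a e1 e2 =>
        [:: Config K (write m a (Num.truncn (ceval m e1)) (ceval m e2)) phi (t + 1)]
    | Rand a e1 e2 =>
        let N := (Num.truncn (ceval m e2)).+1 in
        [seq Config K (write m a (Num.truncn (ceval m e1)) j%:R)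
               [ffun s => (Num.sqrt N%:R)^-1%:C%C * phi s] (t + 1)
        | j <- iota 0 N]
    | Apply g => [:: Config K m (apply_gate m g phi) (t + 1)]
    | Query r v => [:: Config K m (apply_query U r v phi) (t + EO)]
    | QueryInv r v => [:: Config K m (apply_query (adjoint U) r v phi) (t + EO)]
    | Measure q a e =>
        [seq Config K (write m a (Num.truncn (ceval m e)) o.1) o.2 (t + 1)
        | o <- measure q phi]
    | Seq c1 c2 => [:: Config [:: c1, c2 & K] m phi t]
    | If e c1 c2 =>
        [:: Config ((if ceval m e != 0 then c1 else c2) :: K) m phi (t + 1)]
    | While e b =>
        [:: Config (if ceval m e != 0 then [:: b, i & K] else K) m phi (t + 1)]
    end
  end.

Definition run (p : cmd k) (m : memory R) (j : nat) : seq (config V k n) :=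
  iter j (fun cs => flatten [seq step c | c <- cs])
    [:: Config [:: p] m [ffun s => (s == ket0 V k n)%:R] 0].

End Semantics.

Definition halted (R : realType) (V : valspace R) (k n : nat)
    (c : config V k n) : bool := nilp (todo c).

(* Array 0 contains the dimension, T, Gamma, M and |S|; array 1 contains the list
   of the elements of S; the rest of the memory is blank. *)
Definition inputs (R : realType) (n T : nat) (G : R) (S : {set 'I_n.+1}) (M : R) :
    memory R :=
  fun a j =>
    match a with
    | 0%N => nth 0 [:: n.+1%:R; T%:R; G; M; #|S|%:R] j
    | 1%N => nth 0 [seq (i : nat)%:R | i : 'I_n.+1 <- enum S] j
    | _ => 0
    end.

(* The output sequence is read in the first cells of array 2. *)
Definition outputs (R : realType) (V : valspace R) (k n T : nat)
    (c : config V k n) (o : T.-tuple 'I_n.+1) : bool :=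
  halted c && [forall j : 'I_T, store c 2%N j == (tnth o j)%:R].

(* Probability of having halted with output [o] after [j] steps. *)
Definition output_prob (R : realType) (V : valspace R) (k n T : nat)
    (cs : nat -> seq (config V k n)) (o : T.-tuple 'I_n.+1) (j : nat) : R :=
  \sum_(c <- cs j | outputs c o) sqnorm (psi c).

(* Supremum of the expected time elapsed after [j] steps; the branches that have
   not halted are counted, so that it is infinite if the algorithm fails to halt
   with positive probability. *)
Definition expected_runtime (R : realType) (V : valspace R) (k n : nat)
    (cs : nat -> seq (config V k n)) : \bar R :=
  ereal_sup (range (fun j => (\sum_(c <- cs j) sqnorm (psi c) * time c)%:E)).

(* Main.v *)
(* The samples are drawn one by one, by rejection. Every i in S is cut into cells of
   weight |u_i|T/G, |u_i|T/G - 1, and so on, and the remaining mass w = G - ||u_S||_1 is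
   cut likewise into cells of a dummy index n.  Choosing a cell uniformly, and accepting
   it with probability its weight (clamped to 1), hits i with probability proportional to
   |u_i|, at a constant expected cost since there are at most |S| + T + 1 cells of total
   clamped weight T.  When the dummy index comes out, an index outside S is obtained by
   amplitude amplification of the flag of |i>(sqrt(1-q_i)|0> + sqrt(q_i)|1>), where
   q_i = |u_i|/(2M): conditionally on the flag, i has probability |u_i|/||u_{S^c}||_1
   whatever the number of Grover iterations.  This number is uniform in {0,..,k}, and the
   flag is set with probability at least 1/4 as soon as k^2 >= nM/||u_{S^c}||_1 (Boyer,
   Brassard, Hoyer, Tapp).  In the regime of the time bound, either w is at least 7G/sqrt T
   and then is at most 2||u_{S^c}||_1, so that k^2 ~ 2nM/w is enough, or the search is
   needed for O(sqrt T) of the samples only, and k^2 ~ n will do.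

   Only upper bounds on expectations are ever proved about the runs of the program: the
   time, the probability of a given output, and the probability of its complement; the
   probability of not having halted after j steps is O(1/j), so that the last two bounds
   determine the limit of the output probabilities. *)
Require Import Defs.
From HB Require Import structures.
From mathcomp Require Import all_boot all_order all_algebra complex.
From mathcomp Require Import boolp classical_sets reals ereal topology.
From mathcomp Require Import normedtype sequences trigo.
From mathcomp Require Import ring lra.
From mathcomp Require Import zify.

Set Implicit Arguments.
Unset Strict Implicit.
Unset Printing Implicit Defensive.

Import Order.TTheory GRing.Theory Num.Theory numFieldNormedType.Exports.
(* [topology] and [classical_sets] shadow [basis], [eval], [getI] and [setI]. *)
Import Defs.

Local Open Scope classical_set_scope.
Local Open Scope ring_scope.

(** All the bounds come from one functional, [val], which pays E per step and Phi on halting. It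
    bounds the expected time for E = EO and Phi = 0, it is the probability of an output, or of its
    complement, for E = 0 and Phi an indicator, and it bounds the mass still running for E = 1 and
    Phi = 0. Charging EO even for classical steps is affordable: EO >= 1, and in the regime of the
    time bound the expected number of steps is itself O(sqrt(Tn)). The rules for [val] are
    inequalities valid at every fuel j, because cutting a run short can only lower a non-negative
    reward. A loop of unbounded length then needs no termination argument, only a bound that
    reproduces itself through one round, and an induction on the fuel. Correctness holds for any
    bound k on the number of Grover iterations, since an attempt without any iteration already
    succeeds with positive probability; only the cost depends on k. The factor 2 in q_i = |u_i|/(2M)
    keeps the probability p of the flag at most 1/2, where sin(2t) >= sqrt(2p) for sin(t)^2 = p. *)

(** * Complex numbers, unitary operators and roots of unity *)

Section ComplexPreliminaries.
Context {R : realType}.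
Implicit Types (x y t : R) (z w : R[i]).

Definition nsq z : R := complex.Re z ^+ 2 + complex.Im z ^+ 2.

Lemma conjcM z w : conjc (z * w) = conjc z * conjc w.
Proof. exact: (rmorphM (@conjc R)). Qed.

Lemma nsqE z : ((nsq z)%:C)%C = z * conjc z.
Proof.
case: z => a b; rewrite /nsq; apply/eqP; rewrite eq_complex /=.
by apply/andP; split; apply/eqP; ring.
Qed.

Lemma nsq_ge0 z : 0 <= nsq z.
Proof. by rewrite addr_ge0 ?sqr_ge0. Qed.

Lemma nsqM z w : nsq (z * w) = nsq z * nsq w.
Proof. by apply: complexI; rewrite rmorphM /= !nsqE rmorphM mulrACA. Qed.

Lemma nsq_real x : nsq (x%:C)%C = x ^+ 2.
Proof. by rewrite /nsq /= expr0n /= addr0. Qed.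

Lemma nsq0 : nsq 0 = 0.
Proof. by rewrite /nsq /= !expr0n addr0. Qed.

(** Stated for a bare function [g], so that it applies to one register while the contents of the
    others are frozen. *)
Lemma unitary_nsq (W : finType) (U : operator R W) (g : W -> R[i]) :
  unitary U -> \sum_y nsq (\sum_w U y w * g w) = \sum_w nsq (g w).
Proof.
move=> hU; apply: complexI; rewrite !rmorph_sum /=.
under eq_bigr => y _ do rewrite nsqE rmorph_sum big_distrlr /=.
rewrite exchange_big /=; apply: eq_bigr => w _; rewrite exchange_big /=.
rewrite (bigD1 w) //= [X in _ + X]big1 ?addr0 => [|w' ne].
  rewrite nsqE -[RHS]mulr1.
  have <- : \sum_y adjoint U w y * U y w = 1 by rewrite hU eqxx.
  rewrite mulr_sumr.
  by apply: eq_bigr => y _; rewrite /adjoint rmorphM; ring.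
transitivity (g w * conjc (g w') * \sum_y adjoint U w' y * U y w).
  by rewrite mulr_sumr; apply: eq_bigr => y _; rewrite /adjoint rmorphM; ring.
by rewrite hU (negbTE ne) mulr0.
Qed.

(** [unitary] only says U^* U = 1; in finite dimension a left inverse is a right inverse, whence the
    passage through square matrices. *)
Lemma adjoint_unitary (W : finType) (U : operator R W) :
  unitary U -> unitary (adjoint U).
Proof.
move=> hU.
pose A := \matrix_(i < #|W|, j < #|W|) U (enum_val i) (enum_val j).
pose B := \matrix_(i < #|W|, j < #|W|) adjoint U (enum_val i) (enum_val j).
have sumE (F : W -> R[i]) : \sum_(i < #|W|) F (enum_val i) = \sum_w F w.
  rewrite [RHS](reindex_onto (@enum_val W predT) enum_rank) /=.
    by apply: eq_bigl => i; rewrite enum_valK eqxx.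
  by move=> w _; rewrite enum_rankK.
have BA : B *m A = 1%:M.
  apply/matrixP => i j; rewrite !mxE -(inj_eq enum_val_inj) -hU -[RHS]sumE.
  by apply: eq_bigr => k _; rewrite !mxE.
have AB := mulmx1C BA.
move=> x x'; have /matrixP/(_ (enum_rank x) (enum_rank x')) := AB.
rewrite !mxE (inj_eq enum_rank_inj) => <-.
under [in RHS]eq_bigr => k _ do rewrite !mxE !enum_rankK.
rewrite (sumE (fun k : W => U x k * adjoint U k x')).
by apply: eq_bigr => y _; rewrite /adjoint conjcK.
Qed.

Lemma cisD x y : cis (x + y) = cis x * cis y.
Proof.
by rewrite /cis mulrDr sinD cosD; apply/eqP; rewrite eq_complex /= eqxx [_ + _]addrC eqxx.
Qed.

Lemma cis0 : cis 0 = 1 :> R[i].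
Proof. by rewrite /cis mulr0 sin0 cos0. Qed.

Lemma cisN x : cis (- x) = conjc (cis x).
Proof. by rewrite /cis mulrN sinN cosN. Qed.

Lemma cis_half : cis (1 / 2) = -1 :> R[i].
Proof.
rewrite /cis (_ : 2 * pi * (1 / 2) = pi); last by field.
by rewrite cospi sinpi; apply/eqP; rewrite eq_complex /= oppr0 !eqxx.
Qed.

Lemma cis_nat (k : nat) : cis k%:R = 1 :> R[i].
Proof.
elim: k => [|k IH]; first exact: cis0.
rewrite -natr1 cisD IH mul1r /cis mulr1 mulr_natl cos2pi sin2pi //.
Qed.

Lemma cisX x (k : nat) : cis (k%:R * x) = cis x ^+ k.
Proof.
elim: k => [|k IH]; first by rewrite mul0r cis0.
by rewrite -natr1 mulrDl mul1r cisD IH exprSr.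
Qed.

Lemma nsq_cis x : nsq (cis x) = 1.
Proof. exact: cos2Dsin2. Qed.

Lemma cis_neq1 x : 0 < x < 1 -> cis x != 1.
Proof.
move=> /andP[x0 x1]; rewrite /cis eq_complex /= negb_and; apply/orP; left.
rewrite (_ : 2 * pi * x = (pi * x) *+ 2) ?cos_mulr2n; last by rewrite mulr2n; ring.
have s0 : 0 < sin (pi * x).
  by apply: sin_gt0_pi; rewrite mulr_gt0 ?pi_gt0 //= gtr_pMr ?pi_gt0.
have := sin2cos2 (pi * x).
have : 0 < sin (pi * x) ^+ 2 by rewrite exprn_gt0.
by rewrite mulr2n => ? ?; apply/eqP; lra.
Qed.

(** Orthogonality of the characters of Z/N: off the diagonal this is the geometric sum of an N-th
    root of unity other than 1. *)
Lemma sum_cis (N x x' : nat) : (x < N)%N -> (x' < N)%N ->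
  \sum_(y < N) cis (y%:R * x%:R / N%:R) * conjc (cis (y%:R * x'%:R / N%:R)) =
  (N * (x == x'))%:R :> R[i].
Proof.
(* With this order x - x' is a natural number below N; the other order is the complex conjugate. *)
wlog le : x x' / (x' <= x)%N => [hw|] hx hx'.
  case/orP: (leq_total x' x) => le; first exact: hw.
  rewrite eq_sym -[RHS]conjc_nat -hw // rmorph_sum.
  apply: eq_bigr => y _; move: (cis _) (cis _) => a b.
  by rewrite /= conjcM conjcK mulrC.
have N0 : N%:R != 0 :> R by rewrite pnatr_eq0; case: N hx {hx'}.
have E (y : 'I_N) : cis (y%:R * x%:R / N%:R) * conjc (cis (y%:R * x'%:R / N%:R)) =
    cis ((x - x')%:R / N%:R : R) ^+ y.
  by rewrite -cisN -cisD -cisX natrB //; congr cis; field.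
rewrite (eq_bigr _ (fun i _ => E i)).
case: eqP => [->|/eqP ne].
  by rewrite subnn mul0r cis0 muln1 (eq_bigr (fun=> 1)) ?sumr_const ?card_ord // => i _;
     rewrite expr1n.
rewrite muln0; set w := cis _.
have w1 : w != 1.
  apply: cis_neq1; rewrite divr_gt0 ?ltr0n ?subn_gt0 ?ltn_neqAle 1?eq_sym ?ne //=.
    by rewrite ltr_pdivrMr ?mul1r ?ltr_nat ?ltr0n; lia.
  by lia.
have := subrX1 w N.
rewrite -cisX mulrCA divff // mulr1 cis_nat subrr => /esym/eqP.
by rewrite mulf_eq0 subr_eq0 (negbTE w1) /= => /eqP.
Qed.

End ComplexPreliminaries.

(** * States of one index, one value and one qubit register *)

Section OneRegister.
Context {R : realType} {V : valspace R} {n : nat}.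
Local Notation I := 'I_n.+1.
Local Notation B := (basis V 1 n).
Local Notation r0 := (ord0 : 'I_1).
Implicit Types (f : I -> vtype V -> bool -> R[i]) (m : memory R).

Definition bs (i : I) (v : vtype V) (b : bool) : B :=
  ([ffun=> i], [ffun=> v], [ffun=> b]).

Definition mk f : qstate V 1 n := [ffun s => f (getI r0 s) (getV r0 s) (getB r0 s)].

Lemma ffun1 (X : Type) (g : {ffun 'I_1 -> X}) : g = [ffun=> g r0].
Proof. by apply/ffunP => i; rewrite ffunE ord1. Qed.

Lemma bsE s : s = bs (getI r0 s) (getV r0 s) (getB r0 s).
Proof.
by case: s => [[a b] c]; rewrite /bs /getI /getV /getB /= -!ffun1.
Qed.

Lemma getI_bs i v b : getI r0 (bs i v b) = i.
Proof. by rewrite /getI /= ffunE. Qed.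
Lemma getV_bs i v b : getV r0 (bs i v b) = v.
Proof. by rewrite /getV /= ffunE. Qed.
Lemma getB_bs i v b : getB r0 (bs i v b) = b.
Proof. by rewrite /getB /= ffunE. Qed.
Definition get_bs := (getI_bs, getV_bs, getB_bs).

Lemma upd_ffun1 (X : Type) (g : {ffun 'I_1 -> X}) w : finfun (upd g r0 w) = [ffun=> w].
Proof. by apply/ffunP => i; rewrite !ffunE /upd ord1. Qed.

Lemma setI_bs w i v b : setI r0 w (bs i v b) = bs w v b.
Proof. by rewrite /setI /= upd_ffun1. Qed.
Lemma setV_bs w i v b : setV r0 w (bs i v b) = bs i w b.
Proof. by rewrite /setV /= upd_ffun1. Qed.
Lemma setB_bs w i v b : setB r0 w (bs i v b) = bs i v w.
Proof. by rewrite /setB /= upd_ffun1. Qed.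
Definition set_bs := (setI_bs, setV_bs, setB_bs).

Lemma mk_bs f i v b : mk f (bs i v b) = f i v b.
Proof. by rewrite ffunE !get_bs. Qed.

Lemma bs_ffunP (psi phi : qstate V 1 n) :
  (forall i v b, psi (bs i v b) = phi (bs i v b)) -> psi = phi.
Proof. by move=> h; apply/ffunP => s; rewrite (bsE s). Qed.

Lemma mkE (psi : qstate V 1 n) : psi = mk (fun i v b => psi (bs i v b)).
Proof. by apply: bs_ffunP => i v b; rewrite mk_bs. Qed.

Lemma eq_mk f g : (forall i v b, f i v b = g i v b) -> mk f = mk g.
Proof. by move=> h; apply: bs_ffunP => i v b; rewrite !mk_bs. Qed.

Lemma ket0_bs s : (s == ket0 V 1 n) =
  [&& getI r0 s == ord0, getV r0 s == vzero V & getB r0 s == false].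
Proof.
apply/eqP/and3P => [->|[/eqP h1 /eqP h2 /eqP h3]]; last by rewrite (bsE s) h1 h2 h3.
by rewrite (_ : ket0 V 1 n = bs ord0 (vzero V) false) // !get_bs.
Qed.

Lemma sum_basis (A : nmodType) (F : B -> A) :
  \sum_s F s = \sum_i \sum_v \sum_b F (bs i v b).
Proof.
under [RHS]eq_bigr => i _ do rewrite pair_big /=.
rewrite pair_big /= (reindex (fun p : I * (vtype V * bool) => bs p.1 p.2.1 p.2.2)) //.
exists (fun s => (getI r0 s, (getV r0 s, getB r0 s))) => [[i [v b]] _ /=|s _].
  by rewrite !get_bs.
by rewrite /= -bsE.
Qed.

Lemma sqnorm_mk f : sqnorm (mk f) = \sum_i \sum_v \sum_b nsq (f i v b).
Proof.
rewrite /sqnorm sum_basis; apply: eq_bigr => i _; apply: eq_bigr => v _.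
by apply: eq_bigr => b _; rewrite mk_bs.
Qed.

Lemma sqnorm_ge0 (phi : qstate V 1 n) : 0 <= sqnorm phi.
Proof. by apply: sumr_ge0 => s _; apply: nsq_ge0. Qed.

Lemma act_I U f : act (getI r0) (setI r0) ord0 U (mk f) =
  mk (fun i v b => \sum_w U (bs ord0 v b) i w * f w v b).
Proof.
apply: bs_ffunP => i v b; rewrite mk_bs ffunE get_bs set_bs.
by apply: eq_bigr => w _; rewrite set_bs mk_bs.
Qed.

Lemma act_B U f : act (getB r0) (setB r0) false U (mk f) =
  mk (fun i v b => \sum_w U (bs i v false) b w * f i v w).
Proof.
apply: bs_ffunP => i v b; rewrite mk_bs ffunE get_bs set_bs.
by apply: eq_bigr => w _; rewrite set_bs mk_bs.
Qed.

Lemma act_IV W f : apply_query W r0 r0 (mk f) =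
  mk (fun i v b => \sum_w W (i, v) w * f w.1 w.2 b).
Proof.
apply: bs_ffunP => i v b; rewrite mk_bs ffunE !get_bs.
by apply: eq_bigr => w _; rewrite /= !set_bs mk_bs.
Qed.

Lemma sqnorm_act_I U f : (forall s, unitary (U s)) ->
  sqnorm (act (getI r0) (setI r0) ord0 U (mk f)) = sqnorm (mk f).
Proof.
move=> hU; rewrite act_I !sqnorm_mk exchange_big [RHS]exchange_big /=.
apply: eq_bigr => v _; rewrite exchange_big [RHS]exchange_big /=.
by apply: eq_bigr => b _; rewrite unitary_nsq.
Qed.

Lemma sqnorm_act_B U f : (forall s, unitary (U s)) ->
  sqnorm (act (getB r0) (setB r0) false U (mk f)) = sqnorm (mk f).
Proof.
move=> hU; rewrite act_B !sqnorm_mk; apply: eq_bigr => i _; apply: eq_bigr => v _.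
by rewrite unitary_nsq.
Qed.

Lemma sqnorm_query W f : unitary W ->
  sqnorm (apply_query W r0 r0 (mk f)) = sqnorm (mk f).
Proof.
move=> hW; rewrite act_IV !sqnorm_mk.
under eq_bigr => i _ do rewrite exchange_big /=.
under [RHS]eq_bigr => i _ do rewrite exchange_big /=.
rewrite exchange_big [RHS]exchange_big /=; apply: eq_bigr => b _.
rewrite !pair_big /= -[RHS](unitary_nsq _ hW).
by apply: eq_bigr => -[i v] _.
Qed.

Lemma unitary_QFT : unitary (fun y x : I =>
  ((Num.sqrt n.+1%:R : R)^-1)%:C%C * cis (y%:R * x%:R / n.+1%:R)).
Proof.
move=> x x'; rewrite /adjoint.
have s2 : ((Num.sqrt n.+1%:R : R)^-1 * (Num.sqrt n.+1%:R : R)^-1) * n.+1%:R = 1.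
  by rewrite -invfM -expr2 sqr_sqrtr ?ler0n // mulVf.
transitivity (((Num.sqrt n.+1%:R : R)^-1 * (Num.sqrt n.+1%:R : R)^-1)%:C%C *
   \sum_(y < n.+1) cis (y%:R * x'%:R / n.+1%:R) * conjc (cis (y%:R * x%:R / n.+1%:R : R))).
  rewrite mulr_sumr; apply: eq_bigr => y _.
  move: (cis _) (cis _) => a b; rewrite conjcM conjc_real (rmorphM (real_complex R)).
  by ring.
rewrite sum_cis // natrM mulrA eq_sym.
rewrite (_ : n.+1%:R = (n.+1%:R : R)%:C%C); last by rewrite rmorph_nat.
by rewrite -rmorphM s2 mul1r.
Qed.

(** The Fourier matrix is symmetric, so this is its adjoint. *)
Lemma unitary_QFTinv : unitary (fun y x : I =>
  ((Num.sqrt n.+1%:R : R)^-1)%:C%C * cis (- (y%:R * x%:R / n.+1%:R))).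
Proof.
have := adjoint_unitary unitary_QFT; congr unitary.
apply/funext => y; apply/funext => x; rewrite /adjoint cisN (mulrC x%:R).
by move: (cis _) => a; rewrite conjcM conjc_real.
Qed.

Lemma unitary_shift (k : nat) :
  @unitary R _ (fun y x : I => ((y : nat) == (x + k) %% n.+1)%N%:R).
Proof.
move=> x x'; rewrite /adjoint.
have lt z : ((z + k) %% n.+1 < n.+1)%N by rewrite ltn_pmod.
rewrite (bigD1 (Ordinal (lt x))) //= big1 ?addr0 => [|y /negbTE ne]; last first.
  by rewrite -val_eqE /= in ne; rewrite ne conjc0 mul0r.
rewrite eqxx conjc1 mul1r eqn_modDr !modn_small ?ltn_ord //.
Qed.

Lemma clamp01 (x : R) : 0 <= clamp x <= 1.
Proof. by rewrite /clamp le_max lexx ge_max ler01 ge_min lexx. Qed.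

Lemma sum_bool (A : nmodType) (F : bool -> A) : \sum_b F b = F false + F true.
Proof. by rewrite big_bool addrC. Qed.

Definition rotc (p : R) (y x : bool) : R :=
  if y (+) x then Num.sqrt p else (-1) ^+ (y && x) * Num.sqrt (1 - p).

Lemma unitary_rot (p : R) : 0 <= p <= 1 ->
  @unitary R _ (fun y x : bool => (rotc p y x)%:C%C).
Proof.
move=> /andP[p0 p1] x x'; rewrite /adjoint sum_bool.
have a2 : Num.sqrt p * Num.sqrt p = p by rewrite -expr2 sqr_sqrtr.
have b2 : Num.sqrt (1 - p) * Num.sqrt (1 - p) = 1 - p.
  by rewrite -expr2 sqr_sqrtr ?subr_ge0.
rewrite !conjc_real -!rmorphM -rmorphD /= -(rmorph_nat (@real_complex R)).
congr (_%:C)%C; move: a2 b2; rewrite /rotc.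
move: (Num.sqrt p) (Num.sqrt (1 - p)) => a b a2 b2.
by case: x; case: x' => /=; rewrite ?expr0 ?expr1 ?mulr1n ?mulr0n; lra.
Qed.

End OneRegister.

(** * Norm, scaling and time along one step *)

Section StepNorm.
Context {R : realType} {V : valspace R} {n : nat}.
Context (U : operator R ('I_n.+1 * vtype V)%type) (EO : R).
Local Notation I := 'I_n.+1.
Local Notation r0 := (ord0 : 'I_1).
Local Notation cfg := (config V 1 n).
Local Notation qst := (qstate V 1 n).
Implicit Types (f : I -> vtype V -> bool -> R[i]) (m : memory R) (phi : qst) (c : cfg).

Lemma collapse_I f w : collapse (getI r0) (setI r0) ord0 (mk f) w =
  mk (fun i v b => if i == ord0 then f w v b else 0).
Proof. by apply: bs_ffunP => i v b; rewrite mk_bs ffunE get_bs set_bs mk_bs. Qed.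

Lemma collapse_V f w : collapse (getV r0) (setV r0) (vzero V) (mk f) w =
  mk (fun i v b => if v == vzero V then f i w b else 0).
Proof. by apply: bs_ffunP => i v b; rewrite mk_bs ffunE get_bs set_bs mk_bs. Qed.

Lemma collapse_B f w : collapse (getB r0) (setB r0) false (mk f) w =
  mk (fun i v b => if b == false then f i v w else 0).
Proof. by apply: bs_ffunP => i v b; rewrite mk_bs ffunE get_bs set_bs mk_bs. Qed.

Lemma sum_only (W : finType) (w0 : W) (A : nmodType) (F : W -> A) :
  (forall w, w != w0 -> F w = 0) -> \sum_w F w = F w0.
Proof. by move=> h; rewrite (bigD1 w0) //= big1 ?addr0. Qed.

Lemma sqnorm_collapse_I f w :
  sqnorm (collapse (getI r0) (setI r0) ord0 (mk f) w) = \sum_v \sum_b nsq (f w v b).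
Proof.
rewrite collapse_I sqnorm_mk (sum_only (w0 := ord0)) ?eqxx // => i /negbTE ne.
by rewrite big1 // => v _; rewrite big1 // => b _; rewrite ne nsq0.
Qed.

Lemma sqnorm_collapse_V f w :
  sqnorm (collapse (getV r0) (setV r0) (vzero V) (mk f) w) =
  \sum_i \sum_b nsq (f i w b).
Proof.
rewrite collapse_V sqnorm_mk; apply: eq_bigr => i _.
rewrite (sum_only (w0 := vzero V)) ?eqxx // => v /negbTE ne.
by rewrite big1 // => b _; rewrite ne nsq0.
Qed.

Lemma sqnorm_collapse_B f w :
  sqnorm (collapse (getB r0) (setB r0) false (mk f) w) = \sum_i \sum_v nsq (f i v w).
Proof.
rewrite collapse_B sqnorm_mk; apply: eq_bigr => i _; apply: eq_bigr => v _.
by rewrite sum_bool /= nsq0 addr0.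
Qed.

Lemma sqnorm_measure (q : qreg 1) phi :
  \sum_(o <- measure q phi) sqnorm o.2 = sqnorm phi.
Proof.
rewrite (mkE phi); set f := fun i v b => _.
case: q => r; rewrite (ord1 r) /= ?big_map.
- rewrite -enumT big_enum /= [LHS](eq_bigl xpredT) // sqnorm_mk; apply: eq_bigr => i _.
  by rewrite sqnorm_collapse_I.
- rewrite -enumT big_enum /= [LHS](eq_bigl xpredT) // sqnorm_mk [RHS]exchange_big /=.
  by apply: eq_bigr => v _; rewrite sqnorm_collapse_V.
- rewrite !big_cons big_nil addr0 !sqnorm_collapse_B sqnorm_mk -big_split /=.
  apply: eq_bigr => i _; rewrite -big_split /=; apply: eq_bigr => v _.
  by rewrite sum_bool.
Qed.

Lemma sqnorm_gate m (g : gate 1) phi : sqnorm (apply_gate m g phi) = sqnorm phi.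
Proof.
rewrite (mkE phi); set f := fun i v b => _; case: g => [r|r|r e|r e|e] /=; rewrite ?(ord1 r).
- by rewrite sqnorm_act_I // => _; apply: unitary_QFT.
- by rewrite sqnorm_act_I // => _; apply: unitary_QFTinv.
- by rewrite sqnorm_act_I // => s; apply: unitary_shift.
- by rewrite sqnorm_act_B // => s; apply/unitary_rot/clamp01.
- rewrite /sqnorm; apply: eq_bigr => s _; rewrite ffunE.
  by have := nsqM (cis (qeval m s e)) (mk f s); rewrite nsq_cis mul1r.
Qed.

(** Real factors suffice: random choices and the measurements of the program leave real multiples of
    [ket0]. *)
Definition scl (a : R) phi : qst := [ffun s => a%:C%C * phi s].

Lemma sqnorm_scl a phi : sqnorm (scl a phi) = a ^+ 2 * sqnorm phi.
Proof.
rewrite /sqnorm mulr_sumr; apply: eq_bigr => s _; rewrite ffunE -(nsq_real a).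
exact: nsqM.
Qed.

Lemma sqnorm_step c : unitary U ->
  \sum_(c' <- step U EO c) sqnorm (psi c') = sqnorm (psi c).
Proof.
move=> hU; case: c => [[|i K] m phi t]; first by rewrite /= big_seq1.
case: i => [|a e1 e2|a e1 e2|g|r v|r v|q a e|c1 c2|e c1 c2|e b];
  rewrite /step ?big_seq1 //.
- rewrite big_map.
  rewrite (eq_bigr (fun=> (Num.truncn (ceval m e2)).+1%:R^-1 * sqnorm phi)).
    by rewrite big_const_seq count_predT size_iota iter_addr_0 -mulrnAl
       -[X in X * _]mulr_natr mulVf ?mul1r // pnatr_eq0.
  by move=> j _; rewrite sqnorm_scl exprVn sqr_sqrtr ?ler0n.
- exact: sqnorm_gate.
- by rewrite (ord1 r) (ord1 v) (mkE phi) sqnorm_query.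
- by rewrite (ord1 r) (ord1 v) (mkE phi) sqnorm_query //; apply: adjoint_unitary.
- by rewrite big_map /= sqnorm_measure.
Qed.

Lemma act_scl (W : finType) get set (w0 : W) A a phi :
  act get set w0 A (scl a phi) = scl a (act get set w0 A phi).
Proof.
apply/ffunP => s; rewrite !ffunE mulr_sumr; apply: eq_bigr => w _.
by rewrite ffunE mulrCA.
Qed.

Lemma collapse_scl (W : finType) get set (w0 w : W) a phi :
  collapse get set w0 (scl a phi) w = scl a (collapse get set w0 phi w).
Proof. by apply/ffunP => s; rewrite !ffunE; case: ifP => _; rewrite ?ffunE ?mulr0. Qed.

Lemma gate_scl m (g : gate 1) a phi :
  apply_gate m g (scl a phi) = scl a (apply_gate m g phi).
Proof.
case: g => [r|r|r e|r e|e] /=; rewrite ?act_scl //.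
by apply/ffunP => s; rewrite !ffunE mulrCA.
Qed.

Lemma measure_scl q a phi :
  measure q (scl a phi) = [seq (o.1, scl a o.2) | o <- measure q phi].
Proof.
by case: q => r /=; rewrite ?collapse_scl // -map_comp; apply: eq_map => w; rewrite /= collapse_scl.
Qed.

Lemma sclC a b phi : scl a (scl b phi) = scl b (scl a phi).
Proof. by apply/ffunP => s; rewrite !ffunE mulrCA. Qed.

Lemma step_scl ks m a phi t : step U EO (Config ks m (scl a phi) t) =
  [seq Config (todo c) (store c) (scl a (psi c)) (time c)
  | c <- step U EO (Config ks m phi t)].
Proof.
case: ks => [|i K] //.
case: i => [|b e1 e2|b e1 e2|g|r v|r v|q b e|c1 c2|e c1 c2|e b] //; rewrite /step.
- by rewrite -map_comp; apply: eq_map => j /=; congr Config; apply: sclC.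
- by rewrite gate_scl.
- by rewrite /apply_query act_scl.
- by rewrite /apply_query act_scl.
- by rewrite measure_scl -!map_comp; apply: eq_map.
Qed.

Lemma step_time ks m phi t : step U EO (Config ks m phi t) =
  [seq Config (todo c) (store c) (psi c) (time c + t)
  | c <- step U EO (Config ks m phi 0)].
Proof.
case: ks => [|i K]; first by rewrite /= add0r.
case: i => [|b e1 e2|b e1 e2|g|r v|r v|q b e|c1 c2|e c1 c2|e b];
  rewrite /step -?map_comp;
  try (by apply: eq_map => o; rewrite /= add0r addrC);
  by rewrite /= ?add0r ?(addrC t).
Qed.

(** This is where EO >= 1 allows every step to be charged at the price of a query. *)
Lemma step_time_le ks m phi : 1 <= EO ->
  all (fun c => time c <= EO) (step U EO (Config ks m phi 0)).
Proof.
move=> hE; have E0 : 0 <= EO by lra.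
case: ks => [|i K]; first by rewrite /= E0.
case: i => [|b e1 e2|b e1 e2|g|r v|r v|q b e|c1 c2|e c1 c2|e b];
  rewrite /step; try (by rewrite all_map; elim: (X in all _ X) => //= o s ->; rewrite add0r hE);
  by rewrite /= ?add0r ?hE ?lexx ?E0.
Qed.

End StepNorm.

(** * The reward functional and the quantities that it bounds *)

Section Value.
Context {R : realType} {V : valspace R} {n : nat}.
Context (U : operator R ('I_n.+1 * vtype V)%type) (EO : R).
Local Notation cfg := (config V 1 n).
Local Notation qst := (qstate V 1 n).
Implicit Types (m : memory R) (phi : qst) (c : cfg) (F : cfg -> R).

Definition reach j c : seq cfg :=
  iter j (fun cs => flatten [seq step U EO c | c <- cs]) [:: c].

Lemma sum_reachS j c F :
  \sum_(c' <- reach j.+1 c) F c' =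
  \sum_(c1 <- step U EO c) \sum_(c' <- reach j c1) F c'.
Proof.
have gen cs : \sum_(c' <- iter j (fun cs => flatten [seq step U EO c | c <- cs]) cs) F c' =
    \sum_(c1 <- cs) \sum_(c' <- reach j c1) F c'.
  elim: j F cs => [|j IH] F cs /=; first by apply: eq_bigr => c1 _; rewrite big_seq1.
  rewrite big_flatten big_map IH; apply: eq_bigr => c1 _.
  by rewrite big_flatten big_map.
by rewrite /reach iterSr gen /= cats0.
Qed.

Lemma reach_halted j m phi t : reach j (Config [::] m phi t) = [:: Config [::] m phi t].
Proof. by elim: j => //= j ->. Qed.

(* Expected reward accumulated in [j] steps: each step pays [E], and halting
   pays [Phi]. All the bounds on the algorithm are upper bounds on it. *)
Fixpoint val (E : R) (Phi : memory R -> R) j ks m phi : R :=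
  if ks is _ :: _ then
    if j is j'.+1 then
      E * sqnorm phi + \sum_(c <- step U EO (Config ks m phi 0))
        val E Phi j' (todo c) (store c) (psi c)
    else 0
  else Phi m * sqnorm phi.

Lemma sum_step_time (G : seq (cmd 1) -> memory R -> qst -> R -> R) ks m phi t :
  \sum_(c <- step U EO (Config ks m phi t)) G (todo c) (store c) (psi c) (time c) =
  \sum_(c <- step U EO (Config ks m phi 0)) G (todo c) (store c) (psi c) (time c + t).
Proof. by rewrite step_time big_map. Qed.

Lemma sqnorm_reach j c : unitary U ->
  \sum_(c' <- reach j c) sqnorm (psi c') = sqnorm (psi c).
Proof.
move=> hU; elim: j c => [|j IH] c; first by rewrite /reach /= big_seq1.
by rewrite sum_reachS -(sqnorm_step EO c hU); apply: eq_bigr => c1 _; rewrite IH.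
Qed.

Lemma ler_sum_all (W : Type) (p : pred W) (s : seq W) (F G : W -> R) :
  all p s -> (forall w, p w -> F w <= G w) -> \sum_(w <- s) F w <= \sum_(w <- s) G w.
Proof.
move=> ps h; elim: s ps => [_|w s IH /= /andP[pw /IH les]]; first by rewrite !big_nil.
by rewrite !big_cons lerD // h.
Qed.

(** A step adds at most EO to the clock of each branch, while the time already elapsed is carried
    along weighted by a norm that the steps conserve. *)
Lemma time_reach j c : unitary U -> 1 <= EO ->
  \sum_(c' <- reach j c) sqnorm (psi c') * time c' <=
  time c * sqnorm (psi c) + val EO (fun=> 0) j (todo c) (store c) (psi c).
Proof.
move=> hU hE; elim: j c => [|j IH] [[|i K] m phi t].
- by rewrite /reach /= big_seq1 /= mul0r addr0 mulrC.
- by rewrite /reach /= big_seq1 /= addr0 mulrC.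
- by rewrite reach_halted /= big_seq1 /= mul0r addr0 mulrC.
rewrite sum_reachS.
have h : \sum_(c1 <- step U EO (Config (i :: K) m phi t)) \sum_(c' <- reach j c1)
   sqnorm (psi c') * time c' <= \sum_(c1 <- step U EO (Config (i :: K) m phi t))
   (time c1 * sqnorm (psi c1) + val EO (fun=> 0) j (todo c1) (store c1) (psi c1)).
  by apply: ler_sum => c1 _; apply: IH.
apply: (le_trans h); rewrite (sum_step_time (fun k m p t =>
  t * sqnorm p + val EO (fun=> 0) j k m p)).
have nE : sqnorm phi = \sum_(c1 <- step U EO (Config (i :: K) m phi 0)) sqnorm (psi c1).
  by symmetry; apply: (sqnorm_step EO (Config (i :: K) m phi 0)).
rewrite -/(val EO (fun=> 0) j.+1 (i :: K) m phi) [X in _ <= _ + X]/= big_split /= addrA lerD2r.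
rewrite -mulrDl [X in _ <= _ * X]nE mulr_sumr.
apply: (ler_sum_all (step_time_le U (i :: K) m phi hE)) => c1 hc1.
by rewrite addrC ler_wpM2r ?sqnorm_ge0 // lerD2l.
Qed.

Lemma out_reach (p : pred (memory R)) j c :
  \sum_(c' <- reach j c | halted c' && p (store c')) sqnorm (psi c') =
  val 0 (fun m => (p m)%:R) j (todo c) (store c) (psi c).
Proof.
rewrite big_mkcond /=; elim: j c => [|j IH] [[|i K] m phi t].
- by rewrite /reach /= big_seq1 /halted /=; case: (p m); rewrite ?mul1r ?mul0r.
- by rewrite /reach /= big_seq1.
- by rewrite reach_halted big_seq1 /halted /=; case: (p m); rewrite ?mul1r ?mul0r.
rewrite sum_reachS [RHS]/= mul0r add0r.
transitivity (\sum_(c1 <- step U EO (Config (i :: K) m phi t))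
    val 0 (fun m => (p m)%:R) j (todo c1) (store c1) (psi c1)).
  by apply: eq_bigr => c1 _; apply: IH.
exact: (sum_step_time (fun k m p0 _ => val 0 (fun m => (p m)%:R) j k m p0)).
Qed.

(** Markov's inequality: a branch still running after j steps has paid its norm at each of them. *)
Lemma unhalted_reach j c : unitary U ->
  j%:R * (\sum_(c' <- reach j c | ~~ halted c') sqnorm (psi c')) <=
  val 1 (fun=> 0) j (todo c) (store c) (psi c).
Proof.
move=> hU; have le j' c' : \sum_(c' <- reach j' c' | ~~ halted c') sqnorm (psi c') <=
    sqnorm (psi c').
  rewrite -(sqnorm_reach j' c' hU) big_mkcond; apply: ler_sum => c1 _.
  by case: ifP => // _; apply: sqnorm_ge0.
elim: j c => [|j IH] [[|i K] m phi t].
- by rewrite mul0r /= mul0r.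
- by rewrite mul0r.
- by rewrite reach_halted big_cons /halted /= big_nil mulr0 mul0r.
rewrite big_mkcond sum_reachS [X in _ <= X]/= mul1r -natr1 mulrDl mul1r addrC.
have -> := sum_step_time (fun k m p0 _ => val 1 (fun=> 0) j k m p0) (i :: K) m phi 0.
rewrite -(sum_step_time (fun k m p0 _ => val 1 (fun=> 0) j k m p0) _ _ _ t).
apply: lerD.
  rewrite -(sqnorm_step EO (Config (i :: K) m phi t) hU); apply: ler_sum => c1 _.
  by rewrite -big_mkcond; apply: le.
rewrite mulr_sumr; apply: ler_sum => c1 _; rewrite -big_mkcond; exact: IH.
Qed.

Context (E : R) (Phi : memory R -> R).
Hypothesis E0 : 0 <= E.
Hypothesis Phi0 : forall m, 0 <= Phi m.

Lemma valS j i K m phi : val E Phi j.+1 (i :: K) m phi = E * sqnorm phi +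
  \sum_(c <- step U EO (Config (i :: K) m phi 0)) val E Phi j (todo c) (store c) (psi c).
Proof. by []. Qed.

Lemma val_ge0 j ks m phi : 0 <= val E Phi j ks m phi.
Proof.
elim: j ks m phi => [|j IH] [|i K] m phi /=; rewrite ?mulr_ge0 ?sqnorm_ge0 //.
by rewrite addr_ge0 ?mulr_ge0 ?sqnorm_ge0 //; apply: sumr_ge0 => c _; apply: IH.
Qed.

Lemma val_mono j ks m phi : val E Phi j ks m phi <= val E Phi j.+1 ks m phi.
Proof.
elim: j ks m phi => [|j IH] [|i K] m phi //; first exact: (val_ge0 1).
rewrite [X in X <= _]/= [X in _ <= X]/= lerD2l.
by apply: ler_sum => c _; apply: (IH (todo c)).
Qed.

(** Keeps the same fuel on both sides, which monotonicity permits; the rules for straight-line code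
    then need no fuel bookkeeping. *)
Lemma val_step j ks m phi :
  val E Phi j ks m phi <= E * sqnorm phi +
    \sum_(c <- step U EO (Config ks m phi 0)) val E Phi j (todo c) (store c) (psi c).
Proof.
case: ks => [|i K].
  rewrite /= big_seq1 /= -[X in X <= _]add0r.
  by case: j => [|j] /=; rewrite lerD2r mulr_ge0 ?sqnorm_ge0.
apply: (le_trans (val_mono _ _ _ _)); exact: lexx.
Qed.

(** Amplitudes come out as their squares, which turns measurements and random choices into
    averages. *)
Lemma val_scl a j ks m phi :
  val E Phi j ks m (scl a phi) = a ^+ 2 * val E Phi j ks m phi.
Proof.
elim: j ks m phi => [|j IH] [|i K] m phi.
- by rewrite /= sqnorm_scl mulrCA.
- by rewrite /= mulr0.
- by rewrite /= sqnorm_scl mulrCA.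
rewrite !valS step_scl big_map sqnorm_scl mulrDr; congr (_ + _).
  by rewrite mulrCA.
rewrite mulr_sumr; by apply: eq_bigr => c _; apply: IH.
Qed.

(** Discards the branches that a measurement creates for impossible outcomes. *)
Lemma val0 j ks m : val E Phi j ks m [ffun=> 0] = 0.
Proof.
have -> : ([ffun=> 0] : qst) = scl 0 [ffun=> 0] by apply/ffunP => s; rewrite !ffunE mulr0.
by rewrite val_scl expr0n mul0r.
Qed.

End Value.

(** * Rules for bounding the reward of each command *)

Section Logic.
Context {R : realType} {V : valspace R} {n : nat}.
Context (U : operator R ('I_n.+1 * vtype V)%type) (EO : R).
Context (E : R) (Phi : memory R -> R).
Hypothesis (hU : unitary U) (E0 : 0 <= E) (Phi0 : forall m, 0 <= Phi m).
Local Notation I := 'I_n.+1.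
Local Notation r0 := (ord0 : 'I_1).
Local Notation qst := (qstate V 1 n).
Local Notation vl := (val U EO E Phi).
Local Notation K0 := ([ffun s => (s == ket0 V 1 n)%:R] : qst).
Implicit Types (m : memory R) (phi : qst) (K : seq (cmd 1)) (p : cmd 1).

Lemma sqnorm_ket0 : sqnorm K0 = 1.
Proof.
rewrite /sqnorm (sum_only (w0 := ket0 V 1 n)) => [|s /negbTE ne]; rewrite ffunE ?eqxx ?ne /=.
  by rewrite expr1n expr0n addr0.
by rewrite !expr0n addr0.
Qed.

(* For all that [val] can see, [p] turns the store [m] and the state [phi] into [m'] and
   [phi'] in at most [c] steps.  The program may also go through branches of norm zero,
   since every measurement creates one branch per label. *)
Definition det p m phi m' phi' (c : R) :=
  sqnorm phi' = 1 /\ forall j K, vl j (p :: K) m phi <= c * E + vl j K m' phi'.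

Lemma val_seq j p1 p2 K m phi : sqnorm phi = 1 ->
  vl j (Seq p1 p2 :: K) m phi <= E + vl j (p1 :: p2 :: K) m phi.
Proof.
move=> h; apply: (le_trans (val_step U EO E0 Phi0 _ _ _ _)).
by rewrite h mulr1 /= big_seq1.
Qed.

Lemma val_if j e p1 p2 K m phi : sqnorm phi = 1 ->
  vl j (If e p1 p2 :: K) m phi <=
  E + vl j ((if ceval m e != 0 then p1 else p2) :: K) m phi.
Proof.
move=> h; apply: (le_trans (val_step U EO E0 Phi0 _ _ _ _)).
by rewrite h mulr1 /= big_seq1.
Qed.

(** The exact form, which consumes one unit of fuel: inductions on the fuel use it for the loops
    without a bound on their length. *)
Lemma val_whileS j e p K m phi : sqnorm phi = 1 ->
  vl j.+1 (While e p :: K) m phi =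
  E + vl j (if ceval m e != 0 then [:: p, While e p & K] else K) m phi.
Proof. by move=> h; rewrite valS h mulr1 /= big_seq1. Qed.

Lemma val_while j e p K m phi : sqnorm phi = 1 ->
  vl j (While e p :: K) m phi <=
  E + vl j (if ceval m e != 0 then [:: p, While e p & K] else K) m phi.
Proof.
move=> h; apply: (le_trans (val_step U EO E0 Phi0 _ _ _ _)).
by rewrite h mulr1 /= big_seq1.
Qed.

Lemma det_skip m phi : sqnorm phi = 1 -> det (Skip 1) m phi m phi 1.
Proof.
move=> h; split=> // j K; apply: (le_trans (val_step U EO E0 Phi0 _ _ _ _)).
by rewrite h mulr1 mul1r /= big_seq1.
Qed.

Lemma det_assign a e1 e2 m phi : sqnorm phi = 1 ->
  det (Assign 1 a e1 e2) m phi
    (write m a (Num.truncn (ceval m e1)) (ceval m e2)) phi 1.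
Proof.
move=> h; split=> // j K; apply: (le_trans (val_step U EO E0 Phi0 _ _ _ _)).
by rewrite h mulr1 mul1r /= big_seq1.
Qed.

Lemma det_gate g m phi phi' : sqnorm phi = 1 -> apply_gate m g phi = phi' ->
  det (Apply g) m phi m phi' 1.
Proof.
move=> h <-; split=> [|j K]; first by rewrite sqnorm_gate.
apply: (le_trans (val_step U EO E0 Phi0 _ _ _ _)).
by rewrite h mulr1 mul1r /= big_seq1.
Qed.

Lemma det_query m phi phi' : sqnorm phi = 1 -> apply_query U r0 r0 phi = phi' ->
  det (Query r0 r0) m phi m phi' 1.
Proof.
move=> h <-; split=> [|j K]; first by rewrite (mkE phi) sqnorm_query // -mkE.
apply: (le_trans (val_step U EO E0 Phi0 _ _ _ _)).
by rewrite h mulr1 mul1r /= big_seq1.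
Qed.

Lemma det_queryinv m phi phi' : sqnorm phi = 1 -> apply_query (adjoint U) r0 r0 phi = phi' ->
  det (QueryInv r0 r0) m phi m phi' 1.
Proof.
move=> h <-; split=> [|j K].
  by rewrite (mkE phi) sqnorm_query -?mkE //; apply: adjoint_unitary.
apply: (le_trans (val_step U EO E0 Phi0 _ _ _ _)).
by rewrite h mulr1 mul1r /= big_seq1.
Qed.

Lemma det_seq p1 p2 m phi m1 phi1 m2 phi2 c1 c2 : sqnorm phi = 1 ->
  det p1 m phi m1 phi1 c1 -> det p2 m1 phi1 m2 phi2 c2 ->
  det (Seq p1 p2) m phi m2 phi2 (1 + c1 + c2).
Proof.
move=> h [n1 d1] [n2 d2]; split=> // j K.
apply: (le_trans (val_seq _ _ _ _ _ h)); have := d1 j (p2 :: K); have := d2 j K; nra.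
Qed.

Lemma det_le p m phi m' phi' c c' : c <= c' ->
  det p m phi m' phi' c -> det p m phi m' phi' c'.
Proof.
move=> le [h d]; split=> // j K; apply: (le_trans (d j K)).
by rewrite lerD2r ler_wpM2r.
Qed.

Lemma det_if e p1 p2 m phi m' phi' c : sqnorm phi = 1 ->
  det (if ceval m e != 0 then p1 else p2) m phi m' phi' c ->
  det (If e p1 p2) m phi m' phi' (1 + c).
Proof.
move=> h [h1 d]; split=> // j K; apply: (le_trans (val_if _ _ _ _ _ _ h)).
by rewrite mulrDl mul1r -addrA lerD2l.
Qed.

Lemma det_while0 e p m phi : sqnorm phi = 1 -> ceval m e = 0 ->
  det (While e p) m phi m phi 1.
Proof.
move=> h e0; split=> // j K; apply: (le_trans (val_while _ _ _ _ _ h)).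
by rewrite e0 eqxx mul1r.
Qed.

Lemma det_whileS e p m phi m1 phi1 m2 phi2 c1 c2 : sqnorm phi = 1 -> ceval m e != 0 ->
  det p m phi m1 phi1 c1 -> det (While e p) m1 phi1 m2 phi2 c2 ->
  det (While e p) m phi m2 phi2 (1 + c1 + c2).
Proof.
move=> h e0 [n1 d1] [n2 d2]; split=> // j K; apply: (le_trans (val_while _ _ _ _ _ h)).
rewrite e0; have := d1 j (While e p :: K); have := d2 j K; nra.
Qed.

Lemma val_measure j q a e K m phi :
  vl j (Measure q a e :: K) m phi <=
  E * sqnorm phi + \sum_(o <- measure q phi)
        vl j K (write m a (Num.truncn (ceval m e)) o.1) o.2.
Proof.
apply: (le_trans (val_step U EO E0 Phi0 _ _ _ _)).
by rewrite lerD2l /step big_map.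
Qed.

Lemma val_rand j a e1 e2 K m (k : nat) : Num.truncn (ceval m e2) = k ->
  vl j (Rand 1 a e1 e2 :: K) m K0 <=
  E + (k.+1%:R)^-1 * \sum_(i < k.+1)
        vl j K (write m a (Num.truncn (ceval m e1)) i%:R) K0.
Proof.
move=> hk; apply: (le_trans (val_step U EO E0 Phi0 _ _ _ _)).
rewrite sqnorm_ket0 mulr1 lerD2l /step hk big_map -[iota _ _]/(index_iota 0 k.+1).
rewrite big_mkord mulr_sumr; apply: ler_sum => i _.
rewrite [todo _]/= [store _]/= [psi (Config _ _ _ _)]/=.
rewrite -[X in vl _ _ _ X]/(scl (Num.sqrt k.+1%:R)^-1 K0) val_scl //.
by rewrite exprVn sqr_sqrtr ?ler0n.
Qed.

(** A coin of bias [clamp p]: both collapsed states are real multiples of [ket0], whose squared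
    factors are the two probabilities. *)
Lemma val_flip j e a K m (p : R) : qeval m (bs ord0 (vzero V) false : basis V 1 n) e = p ->
  vl j (Seq (Apply (Rot r0 e)) (Measure (Bit r0) a (Lit 0)) :: K) m K0 <=
  3 * E + (clamp p * vl j K (write m a 0 1) K0 + (1 - clamp p) * vl j K (write m a 0 0) K0).
Proof.
move=> he; set cp := clamp p; have /andP[c0 c1] := clamp01 p.
have K0E : K0 = mk (fun i v b => ((i == ord0) && (v == vzero V) && (b == false))%:R).
  by apply: bs_ffunP => i v b; rewrite mk_bs ffunE ket0_bs !get_bs andbA.
have gE : apply_gate m (Rot r0 e) K0 = mk (fun i v b =>
    ((i == ord0) && (v == vzero V))%:R * (if b then Num.sqrt cp else Num.sqrt (1 - cp))%:C%C).
  rewrite /= [X in act _ _ _ _ X]K0E act_B; apply: eq_mk => i v b.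
  rewrite sum_bool eqxx !andbT (_ : (true == false) = false) // !andbF mulr0 addr0 addbF.
  have [/andP[/eqP -> /eqP ->]|_] := boolP (_ && _); last by rewrite mulr0 mul0r.
  by rewrite mulr1 mul1r he -/cp; case: b => //=; rewrite mul1r.
apply: (le_trans (val_seq _ _ _ _ _ sqnorm_ket0)).
have [h1 d] := det_gate sqnorm_ket0 gE.
have := d j (Measure (Bit r0) a (Lit 0) :: K).
have := val_measure j (Bit r0) a (Lit 0) K m (apply_gate m (Rot r0 e) K0).
rewrite {}gE in h1 d *; rewrite h1 mulr1.
have cB (b : bool) : collapse (getB r0) (setB r0) false (mk (fun (i : I) (v : vtype V) b =>
    ((i == ord0) && (v == vzero V))%:R * (if b then Num.sqrt cp else Num.sqrt (1 - cp))%:C%C)) b =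
    scl (if b then Num.sqrt cp else Num.sqrt (1 - cp)) K0.
  rewrite collapse_B; apply: bs_ffunP => i v b'; rewrite mk_bs !ffunE ket0_bs !get_bs.
  by case: b' => /=; rewrite ?andbF ?andbT ?mulr0 // mulrC.
rewrite /measure !big_map !big_cons big_nil addr0 !cB !val_scl // /ceval /= natrK.
rewrite !sqr_sqrtr ?subr_ge0 //; move: (vl _ _ _ _) => A; lra.
Qed.

End Logic.

(** * Programs for one attempt of the search and for reading one entry *)

Section Programs.
(* Memory layout: 0 inputs, 1 list of S, 2 output, 3 indicator of S, 4 and 5 index and
   weight of each cell, 6 number of cells, 7 items of S treated so far, 8 current index,
   9 current value, 10 remaining mass, 11 bound on the number of Grover iterations,
   12 samples produced so far, 13 measured flag, 14 chosen cell, 15 Grover iterations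
   left, 16 scratch.  All but 0-5 are variables, stored in cell 0 of their array. *)
Local Notation r0 := (ord0 : 'I_1).

Definition var {Q : Type} (a : nat) : expr Q := Cell a (Lit 0).
Definition input {Q : Type} (j : nat) : expr Q := Cell 0 (Lit j).
Definition set_var (a : nat) (e : cexpr) : cmd 1 := Assign 1 a (Lit 0) e.
Definition abs_expr {Q : Type} (e : expr Q) : expr Q :=
  Bin OMul (Bin OSub (Lit 1) (Bin OMul (Lit 2) (Bin OLess e (Lit 0)))) e.

Definition incr (a : nat) : cmd 1 := set_var a (Bin OAdd (var a) (Lit 1)).
Definition decr (a : nat) : cmd 1 := set_var a (Bin OSub (var a) (Lit 1)).

(** Array 3 holds the indicator of S, so the flag can only be raised outside S. *)
Definition rot_expr : qexpr 1 :=
  Bin ODiv (Bin OMul (Bin OSub (Lit 1) (Cell 3 (Reg (Idx r0))))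
                     (abs_expr (Reg (Val r0))))
           (Bin OMul (Lit 2) (input 3)).

(** The inverse query erases the value register; otherwise the indices would stay entangled with
    their entries and would not interfere. *)
Definition query_rot : cmd 1 :=
  Seq (Query r0 r0) (Seq (Apply (Rot r0 rot_expr)) (QueryInv r0 r0)).

Definition flip_good : cmd 1 := Apply (Phase (Bin ODiv (Reg (Bit r0)) (Lit 2))).

(** The condition index + flag < 1 singles out |0>|0>, the state from which [QFT] and [query_rot]
    build the initial state of the search. *)
Definition flip_zero : cmd 1 := Apply (Phase (Bin ODiv
  (Bin OLess (Bin OAdd (Reg (Idx r0)) (Reg (Bit r0))) (Lit 1)) (Lit 2))).

(** The Grover iterate A S_0 A^-1 S_good up to a global sign, where A is [QFT] followed by
    [query_rot]; the latter serves as its own inverse. *)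
Definition grover_step : cmd 1 :=
  Seq flip_good (Seq query_rot (Seq (Apply (QFTinv r0)) (Seq flip_zero
    (Seq (Apply (QFT r0)) query_rot)))).

(** The index is measured even if the flag is down, so that a failure leaves the registers blank for
    the next attempt. *)
Definition attempt : cmd 1 :=
  Seq (Rand 1 15 (Lit 0) (var 11))
  (Seq (Apply (QFT r0)) (Seq query_rot
  (Seq (While (var 15) (Seq grover_step (decr 15)))
  (Seq (Measure (Bit r0) 13 (Lit 0)) (Measure (Idx r0) 8 (Lit 0)))))).

(** The content of the index register is known: measuring it into the scratch array is a way of
    resetting it. *)
Definition lookup : cmd 1 :=
  Seq (Apply (Shift r0 (var 8))) (Seq (Query r0 r0)
    (Seq (Measure (Val r0) 9 (Lit 0)) (Measure (Idx r0) 16 (Lit 0)))).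

End Programs.

(** * Amplitude amplification in a real plane *)

Section Amplification.
Context {R : realType} {V : valspace R} {n : nat}.
Context (U : operator R ('I_n.+1 * vtype V)%type) (EO : R).
Context (E : R) (Phi : memory R -> R).
Hypothesis (hU : unitary U) (E0 : 0 <= E) (Phi0 : forall m, 0 <= Phi m).
Local Notation I := 'I_n.+1.
Local Notation r0 := (ord0 : 'I_1).
Local Notation qst := (qstate V 1 n).
Local Notation det := (det U EO E Phi).
Context (u : 'rV[R]_n.+1) (uv : I -> vtype V).
Hypothesis label_uv : forall i, label (uv i) = u ord0 i.
Hypothesis oracle_uv : forall i y, U y (i, vzero V) = (y == (i, uv i))%:R.
Implicit Types (f : I -> bool -> R[i]) (m : memory R) (K : seq (cmd 1)).

(** The hypotheses determine the oracle on a blank value register only, and its inverse on the image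
    of such states. The search keeps to these two shapes of state. *)
Definition mk0 f : qst := mk (fun i v b => if v == vzero V then f i b else 0).
Definition mkv f : qst := mk (fun i v b => if v == uv i then f i b else 0).

Lemma sum_pair (A B : finType) (M : nmodType) (F : A * B -> M) :
  \sum_p F p = \sum_a \sum_b F (a, b).
Proof. by rewrite pair_big /=; apply: eq_bigr => -[a b] _. Qed.

Lemma eq_mk0 f g : (forall i b, f i b = g i b) -> mk0 f = mk0 g.
Proof. by move=> h; apply: eq_mk => i v b; rewrite h. Qed.

Lemma query_mk0 f : apply_query U r0 r0 (mk0 f) = mkv f.
Proof.
rewrite act_IV; apply: eq_mk => i v b.
rewrite sum_pair /=.
rewrite (sum_only (w0 := i)) => [|i' ne]; last first.
  rewrite big1 // => v' _; case: eqP => [->|]; last by rewrite mulr0.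
  by rewrite oracle_uv xpair_eqE eq_sym (negbTE ne) mul0r.
rewrite (sum_only (w0 := vzero V)) => [|v' /negbTE ->]; last by rewrite mulr0.
by rewrite eqxx oracle_uv xpair_eqE eqxx /=; case: eqP => _; rewrite ?mul1r ?mul0r.
Qed.

(** The column of U at |i>|0> is the basis vector |i>|u_i>, so U^* U = 1 gives the column of the
    adjoint at |i>|u_i>. *)
Lemma queryinv_mkv f : apply_query (adjoint U) r0 r0 (mkv f) = mk0 f.
Proof.
have aU x i : adjoint U x (i, uv i) = (x == (i, vzero V))%:R.
  rewrite -(hU x); rewrite (sum_only (w0 := (i, uv i))) => [|y ne].
    by rewrite oracle_uv eqxx mulr1.
  by rewrite oracle_uv (negbTE ne) mulr0.
rewrite act_IV; apply: eq_mk => i v b.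
rewrite sum_pair /=.
rewrite (sum_only (w0 := i)) => [|i' ne]; last first.
  rewrite big1 // => v' _; case: eqP => [->|]; last by rewrite mulr0.
  by rewrite aU xpair_eqE eq_sym (negbTE ne) mul0r.
rewrite (sum_only (w0 := uv i)) => [|v' /negbTE ->]; last by rewrite mulr0.
by rewrite eqxx aU xpair_eqE eqxx /=; case: eqP => _; rewrite ?mul1r ?mul0r.
Qed.

Context (q : I -> R).
Hypothesis q01 : forall i, 0 <= q i <= 1.

Definition marks m := forall i : I,
  (1 - m 3%N i) * `|u ord0 i| / (2 * m 0%N 3%N) = q i.

Lemma eval_abs (Q : Type) m (rho : Q -> R) e : eval m rho (abs_expr e) = `|eval m rho e|.
Proof.
rewrite /=; have [h|h] := ltP (eval m rho e) 0; first by rewrite ltr0_norm //=; ring.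
by rewrite ger0_norm //=; ring.
Qed.

Lemma clamp_id (x : R) : 0 <= x <= 1 -> clamp x = x.
Proof. by case/andP => x0 x1; rewrite /clamp (min_idPr x1) (max_idPr x0). Qed.

Definition rotf f (i : I) (b : bool) : R[i] := \sum_b' (rotc (q i) b b')%:C%C * f i b'.

Lemma rot_mkv m f : marks m -> apply_gate m (Rot r0 rot_expr) (mkv f) = mkv (rotf f).
Proof.
move=> hm; rewrite [LHS]/= act_B; apply: eq_mk => i v b.
case: eqP => [->|_]; last by rewrite big1 // => b' _; rewrite mulr0.
suff -> : qeval m (bs i (uv i) false : basis V 1 n) rot_expr = q i.
  by rewrite clamp_id.
rewrite -hm /qeval /rot_expr; cbn -[abs_expr].
by rewrite eval_abs /= !get_bs !natrK label_uv.
Qed.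

(** The sign convention of [Rot] makes its matrix symmetric, so that unitarity makes it an
    involution. *)
Lemma rotfK f i b : rotf (rotf f) i b = f i b.
Proof.
rewrite /rotf; under eq_bigr do rewrite mulr_sumr; rewrite exchange_big /=.
rewrite (sum_only (w0 := b)) => [|b' ne].
  have := unitary_rot (q01 i) b b; rewrite /adjoint eqxx => h.
  under eq_bigr do rewrite mulrA.
  rewrite -mulr_suml -[RHS]mul1r; congr (_ * _); rewrite -[RHS]h; apply: eq_bigr => b' _.
  rewrite conjc_real; congr (_ * _); rewrite /rotc; congr (_%:C)%C.
  by rewrite addbC andbC.
have := unitary_rot (q01 i) b b'; rewrite eq_sym (negbTE ne) /adjoint => h.
under eq_bigr do rewrite mulrA.
rewrite -mulr_suml -[RHS](mul0r (f i b')); congr (_ * _).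
rewrite -[RHS]h; apply: eq_bigr => c _.
by rewrite conjc_real /rotc addbC andbC.
Qed.

Lemma det_query_rot m f g : marks m -> sqnorm (mk0 f) = 1 ->
  (forall i b, rotf f i b = g i b) -> det query_rot m (mk0 f) m (mk0 g) 5.
Proof.
move=> hm h1 hg.
have d1 : det (Query r0 r0) m (mk0 f) m (mkv f) 1 by apply: det_query => //; apply: query_mk0.
have d2 : det (Apply (Rot r0 rot_expr)) m (mkv f) m (mkv (rotf f)) 1.
  by apply: det_gate => //; [exact: d1.1|exact: rot_mkv].
have d3 : det (QueryInv r0 r0) m (mkv (rotf f)) m (mk0 g) 1.
  apply: det_queryinv => //; first exact: d2.1.
  by rewrite queryinv_mkv; apply: eq_mk0.
(* The nested sum mirrors the [Seq] tree, each node of which takes a step of its own. *)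
rewrite (_ : 5 = 1 + 1 + (1 + 1 + 1)); last by ring.
apply: (det_seq _ _ h1 d1) => //; apply: (det_seq _ _ _ d2) => //; exact: d1.1.
Qed.

Local Notation s := ((Num.sqrt n.+1%:R : R)^-1).

Definition qft f (i : I) (b : bool) : R[i] :=
  \sum_(w < n.+1) s%:C%C * cis (i%:R * w%:R / n.+1%:R) * f w b.
Definition qfti f (i : I) (b : bool) : R[i] :=
  \sum_(w < n.+1) s%:C%C * cis (- (i%:R * w%:R / n.+1%:R)) * f w b.

Lemma qft_mk0 m f : apply_gate m (QFT r0) (mk0 f) = mk0 (qft f).
Proof.
rewrite [LHS]/= act_I; apply: eq_mk => i v b.
by case: eqP => // _; rewrite big1 // => w _; rewrite mulr0.
Qed.

Lemma qfti_mk0 m f : apply_gate m (QFTinv r0) (mk0 f) = mk0 (qfti f).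
Proof.
rewrite [LHS]/= act_I; apply: eq_mk => i v b.
by case: eqP => // _; rewrite big1 // => w _; rewrite mulr0.
Qed.

Lemma qftK f i b : qft (qfti f) i b = f i b.
Proof.
rewrite /qft /qfti; under eq_bigr do rewrite mulr_sumr; rewrite exchange_big /=.
have C (j : I) : \sum_(w < n.+1) (s%:C%C * cis (i%:R * w%:R / n.+1%:R)) *
    (s%:C%C * cis (- (w%:R * j%:R / n.+1%:R))) = (i == j)%:R.
  rewrite -(@unitary_QFTinv R n i j); apply: eq_bigr => w _; congr (_ * _).
  by rewrite /adjoint conjcM conjc_real -cisN opprK mulrC [_ * w%:R]mulrC mulrC.
rewrite (sum_only (w0 := i)) => [|j ne].
  by under eq_bigr do rewrite mulrA; rewrite -mulr_suml C eqxx mul1r.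
by under eq_bigr do rewrite mulrA; rewrite -mulr_suml C eq_sym (negbTE ne) mul0r.
Qed.

Lemma flip_good_mk0 m f : apply_gate m (Phase (Bin ODiv (Reg (Bit r0)) (Lit 2))) (mk0 f) =
  mk0 (fun i b => if b then - f i b else f i b).
Proof.
apply: bs_ffunP => i v b; rewrite ffunE !mk_bs /qeval /= get_bs.
case: b => /=; last by rewrite mul0r cis0 mul1r.
by rewrite cis_half mulN1r; case: ifP; rewrite ?oppr0.
Qed.

Lemma flip_zero_mk0 m f : apply_gate m (Phase (Bin ODiv
  (Bin OLess (Bin OAdd (Reg (Idx r0)) (Reg (Bit r0))) (Lit 1)) (Lit 2))) (mk0 f) =
  mk0 (fun i b => if (i == ord0) && ~~ b then - f i b else f i b).
Proof.
apply: bs_ffunP => i v b; rewrite ffunE !mk_bs /qeval /= !get_bs.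
rewrite -natrD ltr_nat -(inj_eq val_inj) /=.
case: b => /=; first by rewrite addn1 ltnS ltn0 mul0r cis0 mul1r andbF.
rewrite addn0 ltnS leqn0 andbT; case: eqP => /= _; last by rewrite mul0r cis0 mul1r.
by rewrite cis_half mulN1r; case: ifP; rewrite ?oppr0.
Qed.

Definition agree (l : seq nat) m m' := forall a, a \notin l -> m' a = m a.

Lemma agree_trans l m1 m2 m3 : agree l m1 m2 -> agree l m2 m3 -> agree l m1 m3.
Proof. by move=> h1 h2 a ha; rewrite h2 ?h1. Qed.

Lemma agree_write l m m' a j x : a \in l -> agree l m m' -> agree l m (write m' a j x).
Proof.
move=> al h b bl; rewrite /write /upd; case: eqP => [ba|_]; last exact: h.
by rewrite ba al in bl.
Qed.

Lemma agree_sub l l' m m' : {subset l <= l'} -> agree l m m' -> agree l' m m'.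
Proof. by move=> sub h a ha; apply: h; apply: contraNN ha => /sub. Qed.

Lemma write_same m a j x : write m a j x a j = x.
Proof. by rewrite /write /upd !eqxx. Qed.

(** Amplitudes of |i>|0> and |i>|1> in the initial state; [good] is the probability that its flag is
    set. *)
Definition amp0 (i : I) : R := s * Num.sqrt (1 - q i).
Definition amp1 (i : I) : R := s * Num.sqrt (q i).
Definition good : R := \sum_i amp1 i ^+ 2.

Lemma amp0_sqr i : amp0 i ^+ 2 = (1 - q i) / n.+1%:R.
Proof.
have /andP[q0 q1] := q01 i.
by rewrite exprMn exprVn !sqr_sqrtr ?subr_ge0 ?ler0n // mulrC.
Qed.

Lemma amp1_sqr i : amp1 i ^+ 2 = q i / n.+1%:R.
Proof.
have /andP[q0 q1] := q01 i.
by rewrite exprMn exprVn !sqr_sqrtr ?ler0n // mulrC.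
Qed.

Lemma sum_amp0 : \sum_i amp0 i ^+ 2 = 1 - good.
Proof.
have n0 : n.+1%:R != 0 :> R by [].
apply/eqP; rewrite eq_sym subr_eq -big_split /=; apply/eqP.
rewrite (eq_bigr (fun=> (n.+1%:R)^-1)) => [|i _].
  by rewrite sumr_const card_ord -[RHS]mulr_natr mulVf.
by rewrite amp0_sqr amp1_sqr; field.
Qed.

Lemma good01 : 0 <= good <= 1.
Proof.
apply/andP; split; first by apply: sumr_ge0 => i _; rewrite sqr_ge0.
by rewrite -subr_ge0 -sum_amp0; apply: sumr_ge0 => i _; rewrite sqr_ge0.
Qed.

(** The plane invariant under the iteration: [al] rescales the whole good part of the initial state
    and [be] the whole bad part. *)
Definition gampl (al be : R) (i : I) (b : bool) : R[i] :=
  (if b then al * amp1 i else be * amp0 i)%:C%C.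
Definition gst (al be : R) : qst := mk0 (gampl al be).

(* Reflection about the initial state [gst 1 1], after a sign change of the good part. *)
Definition grover (x : R * R) : R * R :=
  let ip := x.2 * (1 - good) - x.1 * good in (- x.1 - 2 * ip, x.2 - 2 * ip).

Lemma grover_norm x : (grover x).1 ^+ 2 * good + (grover x).2 ^+ 2 * (1 - good) =
  x.1 ^+ 2 * good + x.2 ^+ 2 * (1 - good).
Proof. by rewrite /grover /=; ring. Qed.

Lemma rotf_unif i b :
  rotf (fun _ b => if b then 0 else s%:C%C) i b = gampl 1 1 i b.
Proof.
rewrite /rotf sum_bool mulr0 addr0 /gampl -rmorphM /=; congr (_%:C)%C.
by rewrite /rotc /amp0 /amp1; case: b => /=; ring.
Qed.

(** Linearity, here and for [qft], in the form in which a reflection I - 2|v><v| uses it. *)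
Lemma rotf_lin f g (z : R[i]) i b :
  rotf (fun i b => f i b - z * g i b) i b = rotf f i b - z * rotf g i b.
Proof.
rewrite /rotf mulr_sumr -sumrB; apply: eq_bigr => b' _; ring.
Qed.

Lemma qft_lin f g (z : R[i]) i b :
  qft (fun i b => f i b - z * g i b) i b = qft f i b - z * qft g i b.
Proof.
rewrite /qft mulr_sumr -sumrB; apply: eq_bigr => b' _; ring.
Qed.

Lemma qft_delta i b :
  qft (fun i b => ((i == ord0) && ~~ b)%:R) i b = if b then 0 else s%:C%C.
Proof.
rewrite /qft (sum_only (w0 := ord0)) => [|w /negbTE ->]; last by rewrite mulr0.
rewrite eqxx /= mulr0 mul0r cis0 mulr1; case: b => /=; by rewrite ?mulr0 ?mulr1.
Qed.

(** The overlap with the initial state, read as the amplitude of |0>|0> once the preparation of that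
    state is undone. *)
Lemma qfti_rotf al be :
  qfti (rotf (gampl al be)) ord0 false = (be * (1 - good) + al * good)%:C%C.
Proof.
rewrite /qfti -sum_amp0 /good !mulr_sumr -big_split rmorph_sum /=; apply: eq_bigr => w _.
rewrite mul0r mul0r oppr0 cis0 mulr1 /rotf sum_bool /gampl /rotc /= expr0 mul1r.
rewrite -!rmorphM -rmorphD -rmorphM /=; congr (_%:C)%C.
rewrite /amp0 /amp1; ring.
Qed.

Lemma det_flip_good m al be : sqnorm (gst al be) = 1 ->
  det flip_good m (gst al be) m (gst (- al) be) 1.
Proof.
move=> h; apply: det_gate => //; rewrite flip_good_mk0; apply: eq_mk0 => i b.
by rewrite /gampl; case: b => //; rewrite -rmorphN /= mulNr.
Qed.

Lemma det_grover m x : marks m -> sqnorm (gst x.1 x.2) = 1 ->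
  det grover_step m (gst x.1 x.2) m (gst (grover x).1 (grover x).2) 19.
Proof.
move=> hm h1; set f := gampl (- x.1) x.2.
set ip : R[i] := (2 * (x.2 * (1 - good) - x.1 * good))%:C%C.
(* [flip_zero] subtracts [ip], twice the overlap, at |0>|0>; the Fourier transform spreads this into
   a multiple of the uniform state, which the last [query_rot] turns into a multiple of the initial
   state. *)
set g := fun (i : I) (b : bool) => rotf f i b - ip * (if b then 0 else s%:C%C).
have d1 := det_flip_good m h1.
have d2 : det query_rot m (mk0 f) m (mk0 (rotf f)) 5.
  by apply: det_query_rot => //; exact: d1.1.
have d3 : det (Apply (QFTinv r0)) m (mk0 (rotf f)) m (mk0 (qfti (rotf f))) 1.
  by apply: det_gate => //; [exact: d2.1|exact: qfti_mk0].
have d4 : det flip_zero m (mk0 (qfti (rotf f))) m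
    (mk0 (fun i b => qfti (rotf f) i b - ip * ((i == ord0) && ~~ b)%:R)) 1.
  apply: det_gate => //; first exact: d3.1.
  rewrite flip_zero_mk0; apply: eq_mk0 => i b.
  case: eqP => [->|_]; last by rewrite mulr0 subr0.
  case: b => /=; first by rewrite mulr0 subr0.
  rewrite /f qfti_rotf /ip mulr1 -rmorphN -rmorphB /=; congr (_%:C)%C; ring.
have d5 : det (Apply (QFT r0)) m
    (mk0 (fun i b => qfti (rotf f) i b - ip * ((i == ord0) && ~~ b)%:R)) m (mk0 g) 1.
  apply: det_gate => //; first exact: d4.1.
  by rewrite qft_mk0; apply: eq_mk0 => i b; rewrite qft_lin qftK qft_delta.
have d6 : det query_rot m (mk0 g) m (gst (grover x).1 (grover x).2) 5.
  apply: det_query_rot => //; first exact: d5.1.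
  move=> i b; rewrite rotf_lin rotfK rotf_unif /f /gampl /ip -rmorphM -rmorphB /=.
  by congr (_%:C)%C; case: b; rewrite /=; ring.
rewrite (_ : 19 = 1 + 1 + (1 + 5 + (1 + 1 + (1 + 1 + (1 + 1 + 5))))); last by ring.
apply: (det_seq _ _ h1 d1) => //; apply: (det_seq _ _ d1.1 d2) => //.
apply: (det_seq _ _ d2.1 d3) => //; apply: (det_seq _ _ d3.1 d4) => //.
exact: (det_seq _ _ d4.1 d5).
Qed.

Lemma marks_agree l m m' : agree l m m' -> 0%N \notin l -> 3%N \notin l ->
  marks m -> marks m'.
Proof. by move=> h l0 l3 hm i; rewrite !h. Qed.

Lemma eval_var m a : ceval m (var a) = m a 0%N.
Proof. by rewrite /ceval /= natrK. Qed.

Lemma det_decr m phi a : sqnorm phi = 1 ->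
  det (decr a) m phi (write m a 0 (m a 0%N - 1)) phi 1.
Proof.
move=> h; have := det_assign U EO E0 Phi0 a (Lit 0) (Bin OSub (var a) (Lit 1)) m h.
by rewrite /ceval /= !natrK.
Qed.

Lemma det_grover_loop r m x : marks m -> m 15%N 0%N = r%:R -> sqnorm (gst x.1 x.2) = 1 ->
  exists m', agree [:: 15%N] m m' /\
  det (While (var 15) (Seq grover_step (decr 15))) m (gst x.1 x.2)
    m' (gst (iter r grover x).1 (iter r grover x).2) (22 * r%:R + 1).
Proof.
elim: r m x => [|r IH] m x hm mr h1.
  exists m; split=> //; rewrite mulr0 add0r; apply: det_while0 => //.
  by rewrite eval_var.
have d1 := det_grover hm h1.
have d2 := det_decr m 15 d1.1.
set m1 := write m 15 0 _ in d2.
have ag : agree [:: 15%N] m m1 by apply: agree_write; rewrite ?inE.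
have m1r : m1 15%N 0%N = r%:R by rewrite /m1 write_same mr -natr1 addrK.
have [m' [ag' d3]] := IH m1 _ (marks_agree ag isT isT hm) m1r d1.1.
exists m'; split; first exact: agree_trans ag ag'.
(* A round takes 22 steps: the guard, the [Seq], 19 for the iterate and one for the decrement. *)
rewrite iterSr (_ : _ + 1 = 1 + (1 + 19 + 1) + (22 * r%:R + 1)); last by rewrite -natr1; ring.
apply: det_whileS => //; last exact: d3.
  by rewrite eval_var mr pnatr_eq0.
exact: (det_seq _ _ h1 d1 d2).
Qed.

End Amplification.

(** * Outcome and cost of one attempt *)

Section Attempt.
Context {R : realType} {V : valspace R} {n : nat}.
Context (U : operator R ('I_n.+1 * vtype V)%type) (EO : R).
Context (E : R) (Phi : memory R -> R).
Hypothesis (hU : unitary U) (E0 : 0 <= E) (Phi0 : forall m, 0 <= Phi m).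
Local Notation I := 'I_n.+1.
Local Notation r0 := (ord0 : 'I_1).
Local Notation qst := (qstate V 1 n).
Local Notation vl := (val U EO E Phi).
Local Notation K0 := ([ffun s => (s == ket0 V 1 n)%:R] : qst).
Local Notation det := (det U EO E Phi).
Context (u : 'rV[R]_n.+1) (uv : I -> vtype V).
Hypothesis label_uv : forall i, label (uv i) = u ord0 i.
Hypothesis oracle_uv : forall i y, U y (i, vzero V) = (y == (i, uv i))%:R.
Implicit Types (m : memory R) (K : seq (cmd 1)).

Lemma ket0_mk (f : I -> vtype V -> bool -> R[i]) (a : R) :
  (forall i v b, f i v b =
    if [&& i == ord0, v == vzero V & b == false] then a%:C%C else 0) ->
  mk f = scl a K0.
Proof.
move=> h; apply: bs_ffunP => i v b; rewrite mk_bs h !ffunE ket0_bs !get_bs.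
by case: ifP => _; rewrite ?mulr1 ?mulr0.
Qed.

Lemma sum_measure_I (f : I -> vtype V -> bool -> R[i]) (G : R -> qst -> R) :
  \sum_(o <- measure (Idx r0) (mk f)) G o.1 o.2 =
  \sum_(i : I) G i%:R (mk (fun j v b => if j == ord0 then f i v b else 0)).
Proof.
rewrite /measure big_map big_enum /= [LHS](eq_bigl xpredT) //.
by apply: eq_bigr => i _; rewrite collapse_I.
Qed.

Lemma sum_measure_V (f : I -> vtype V -> bool -> R[i]) (G : R -> qst -> R) :
  \sum_(o <- measure (Val r0) (mk f)) G o.1 o.2 =
  \sum_(w : vtype V) G (label w) (mk (fun i v b => if v == vzero V then f i w b else 0)).
Proof.
rewrite /measure big_map big_enum /= [LHS](eq_bigl xpredT) //.
by apply: eq_bigr => i _; rewrite collapse_V.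
Qed.

Lemma sum_measure_B (f : I -> vtype V -> bool -> R[i]) (G : R -> qst -> R) :
  \sum_(o <- measure (Bit r0) (mk f)) G o.1 o.2 =
  G 0 (mk (fun i v b => if b == false then f i v false else 0)) +
  G 1 (mk (fun i v b => if b == false then f i v true else 0)).
Proof. by rewrite /measure !big_map !big_cons big_nil addr0 !collapse_B. Qed.

(** Both measurements have a certain outcome; every other label yields the zero state, which [val0]
    removes. *)
Lemma det_lookup m (i : I) : m 8%N 0%N = i%:R ->
  exists m', [/\ agree [:: 9; 16]%N m m', m' 9%N 0%N = u ord0 i & det lookup m K0 m' K0 7].
Proof.
move=> m8; pose m1 := write m 9 0 (u ord0 i); exists (write m1 16 0 i%:R); split.
- by do 2!(apply: agree_write; first by rewrite !inE).
- by rewrite /write /upd /=.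
split; first exact: sqnorm_ket0.
move=> j K.
pose st1 : qst := mk (fun i' v b => ((i' == i) && (v == vzero V) && (b == false))%:R).
pose st2 : qst := mk (fun i' v b => ((i' == i) && (v == uv i) && (b == false))%:R).
have g1 m0 : m0 8%N 0%N = i%:R -> apply_gate m0 (Shift r0 (var 8)) K0 = st1.
  move=> m08; rewrite (mkE K0) [LHS]/= act_I; apply: eq_mk => i' v b.
  rewrite (sum_only (w0 := ord0)) => [|w /negbTE ne].
    rewrite ffunE ket0_bs !get_bs eqxx /qeval /= !natrK m08 natrK add0n.
    rewrite modn_small ?ltn_ord // (inj_eq val_inj) -andbA.
    by case: (i' == i); rewrite ?mul1r ?mul0r.
  by rewrite ffunE ket0_bs !get_bs ne mulr0.
have d1 : det (Apply (Shift r0 (var 8))) m K0 m st1 1.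
  by apply: det_gate => //; [exact: sqnorm_ket0|exact: g1].
have q2 : apply_query U r0 r0 st1 = st2.
  rewrite act_IV; apply: eq_mk => i' v b; rewrite (sum_only (w0 := (i, vzero V))).
    rewrite /= !eqxx /= oracle_uv xpair_eqE /=.
    by case: (i' == i); case: (v == _); case: (b == false); rewrite ?mul1r ?mul0r.
  by move=> [i2 v2]; rewrite xpair_eqE /= => /negbTE ->; rewrite mulr0.
have d2 : det (Query r0 r0) m st1 m st2 1 by apply: det_query => //; exact: d1.1.
rewrite (_ : 7 = 1 + 1 + (1 + 1) + 3); last by ring.
apply: (le_trans (val_seq U EO E0 Phi0 _ _ _ _ _ sqnorm_ket0)).
set p1 := Seq (Measure (Val r0) 9 (Lit 0)) (Measure (Idx r0) 16 (Lit 0)).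
have := d1.2 j (Seq (Query r0 r0) p1 :: K).
have := val_seq U EO E0 Phi0 j (Query r0 r0) p1 K m d1.1.
have := d2.2 j (p1 :: K).
have := val_seq U EO E0 Phi0 j (Measure (Val r0) 9 (Lit 0)) (Measure (Idx r0) 16 (Lit 0)) K m d2.1.
have := val_measure U EO E0 Phi0 j (Val r0) 9 (Lit 0) (Measure (Idx r0) 16 (Lit 0) :: K) m st2.
rewrite d2.1 (sum_measure_V _ (fun o p => vl j (Measure (Idx r0) 16 (Lit 0) :: K)
  (write m 9 (Num.truncn (ceval m (Lit 0))) o) p)).
have mk00 : mk (fun _ _ _ => 0) = [ffun=> 0] :> qst.
  by apply/ffunP => t; rewrite !ffunE.
rewrite (sum_only (w0 := uv i)) => [|w /negbTE ne]; last first.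
  rewrite -[RHS](val0 U EO E Phi j (Measure (Idx r0) 16 (Lit 0) :: K)
     (write m 9 (Num.truncn (ceval m (Lit 0))) (label w))) -mk00.
  by congr (vl _ _ _ _); apply: eq_mk => i' v b; rewrite ne andbF if_same.
rewrite label_uv [Num.truncn _]natrK.
rewrite (_ : mk _ = st1); last first.
  by apply: eq_mk => i' v b; rewrite eqxx andbT; case: (v == _); rewrite ?andbT ?andbF.
have := val_measure U EO E0 Phi0 j (Idx r0) 16 (Lit 0) K m1 st1.
rewrite d1.1 (sum_measure_I _ (fun o p =>
  vl j K (write m1 16 (Num.truncn (ceval m1 (Lit 0))) o) p)).
rewrite (sum_only (w0 := i)) => [|w /negbTE ne]; last first.
  rewrite -[RHS](val0 U EO E Phi j K (write m1 16 (Num.truncn (ceval m1 (Lit 0))) w%:R)) -mk00.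
  by congr (vl _ _ _ _); apply: eq_mk => i' v b; rewrite ne if_same.
rewrite [Num.truncn _]natrK (_ : mk _ = K0); last first.
  rewrite [LHS](ket0_mk (a := 1)); first by apply/ffunP => s; rewrite !ffunE mul1r.
  by move=> i' v b; rewrite eqxx /=; case: (i' == _); case: (v == _); case: (b == _).
rewrite -/m1; lra.
Qed.

Context (q : I -> R).
Hypothesis q01 : forall i, 0 <= q i <= 1.

Lemma val_measure2 j K m al be : sqnorm (gst q al be : qst) = 1 ->
  vl j (Seq (Measure (Bit r0) 13 (Lit 0)) (Measure (Idx r0) 8 (Lit 0)) :: K) m (gst q al be) <=
  3 * E +
  ((\sum_i (be * amp0 q i) ^+ 2 * vl j K (write (write m 13 0 0) 8 0 i%:R) K0) +
   (\sum_i (al * amp1 q i) ^+ 2 * vl j K (write (write m 13 0 1) 8 0 i%:R) K0)).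
Proof.
move=> h1.
have := val_seq U EO E0 Phi0 j (Measure (Bit r0) 13 (Lit 0)) (Measure (Idx r0) 8 (Lit 0)) K m h1.
set K' := Measure (Idx r0) 8 (Lit 0) :: K.
have := val_measure U EO E0 Phi0 j (Bit r0) 13 (Lit 0) K' m (gst q al be).
have := sqnorm_measure (Bit r0) (gst q al be : qst); rewrite h1.
rewrite (sum_measure_B _ (fun _ p => sqnorm p)).
rewrite (sum_measure_B _ (fun o p => vl j K' (write m 13 (Num.truncn (ceval m (Lit 0))) o) p)).
rewrite [Num.truncn _]natrK.
set st0 := mk _; set st1 := mk _ => n1.
have := val_measure U EO E0 Phi0 j (Idx r0) 8 (Lit 0) K (write m 13 0 0) st0.
have := val_measure U EO E0 Phi0 j (Idx r0) 8 (Lit 0) K (write m 13 0 1) st1.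
rewrite (sum_measure_I _ (fun o p => vl j K
  (write (write m 13 0 0) 8 (Num.truncn (ceval (write m 13 0 0) (Lit 0))) o) p)).
rewrite (sum_measure_I _ (fun o p => vl j K
  (write (write m 13 0 1) 8 (Num.truncn (ceval (write m 13 0 1) (Lit 0))) o) p)).
rewrite ![Num.truncn _]natrK -/K' => b1 b0.
move: n1 b0 b1.
rewrite [X in _ -> _ <= _ + X -> _](_ : _ =
  \sum_i (be * amp0 q i) ^+ 2 * vl j K (write (write m 13 0 0) 8 0 i%:R) K0); last first.
  apply: eq_bigr => i _; rewrite -val_scl //; congr (vl _ _ _ _).
  by apply: ket0_mk => k v b; case: (k == _); case: (v == _); case: (b == _).
rewrite [X in _ -> _ -> _ <= _ + X -> _](_ : _ =
  \sum_i (al * amp1 q i) ^+ 2 * vl j K (write (write m 13 0 1) 8 0 i%:R) K0); last first.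
  apply: eq_bigr => i _; rewrite -val_scl //; congr (vl _ _ _ _).
  by apply: ket0_mk => k v b; case: (k == _); case: (v == _); case: (b == _).
(* The second measurement is paid in both branches, whose norms add up to one. *)
move=> n1 b0 b1 b2 b3; have : E * sqnorm st0 + E * sqnorm st1 = E by rewrite -mulrDr n1 mulr1.
by lra.
Qed.

(** Probability that an attempt raises the flag, averaged over the number of iterations. *)
Definition hit (k : nat) : R :=
  k.+1%:R^-1 * \sum_(r < k.+1) (iter r (grover q) (1, 1)).1 ^+ 2 * good q.

Lemma iter_grover_norm r : let x := iter r (grover q) (1, 1) in
  x.1 ^+ 2 * good q + x.2 ^+ 2 * (1 - good q) = 1.
Proof.
by elim: r => [|r IH] /=; [ring|rewrite grover_norm].
Qed.

(** [X] and [Y] bound what follows a failure and a success. The law of the index after a success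
    factors out of the average over r, because the iterations multiply all the good amplitudes by
    the same number. *)
Lemma val_attempt j K m k X (Y : I -> R) : marks u q m -> m 11%N 0%N = k%:R -> 0 < good q ->
  (forall m', agree [:: 8; 13; 15]%N m m' -> m' 13%N 0%N = 0 -> vl j K m' K0 <= X) ->
  (forall m' (i : I), agree [:: 8; 13; 15]%N m m' -> m' 13%N 0%N = 1 -> m' 8%N 0%N = i%:R ->
     vl j K m' K0 <= Y i) ->
  vl j (attempt :: K) m K0 <=
  (22 * k%:R + 15) * E + ((1 - hit k) * X +
     hit k * \sum_i amp1 q i ^+ 2 / good q * Y i).
Proof.
move=> hm mk11 g0 hX hY.
set A := \sum_i _.
apply: (le_trans (val_seq U EO E0 Phi0 _ _ _ _ _ sqnorm_ket0)).
set K1 := _ :: K.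
have he2 : Num.truncn (ceval m (var 11)) = k by rewrite eval_var mk11 natrK.
have := val_rand U EO E0 Phi0 j 15 (Lit 0) K1 he2.
rewrite [Num.truncn _]natrK => h15.
(* Two of the 15 steps are already spent, on the outer [Seq] and on the random choice. *)
suff main (r : 'I_k.+1) : vl j K1 (write m 15 0 r%:R) K0 <=
    (22 * k%:R + 13) * E +
    (1 - (iter r (grover q) (1, 1)).1 ^+ 2 * good q) * X +
    (iter r (grover q) (1, 1)).1 ^+ 2 * good q * A.
  have [F FE] : exists F : nat -> R,
      forall r, (iter r (grover q) (1, 1)).1 ^+ 2 * good q = F r by eexists.
  have {}main : \sum_(r < k.+1) vl j K1 (write m 15 0 r%:R) K0 <= \sum_(r < k.+1)
    ((22 * k%:R + 13) * E + (1 - F r) * X + F r * A).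
    by apply: ler_sum => r _; rewrite -FE; apply: main.
  have hitE : \sum_(r < k.+1) F r = k.+1%:R * hit k.
    by rewrite /hit mulVKf ?pnatr_eq0 //; apply: eq_bigr => r _; rewrite FE.
  rewrite !big_split /= -!mulr_suml sumrB !sumr_const card_ord hitE in main.
  rewrite -[(22 * _ + 13) *+ _]mulr_natl in main.
  have : k.+1%:R^-1 * \sum_(r < k.+1) vl j K1 (write m 15 0 r%:R) K0 <=
      (22 * k%:R + 13) * E + (1 - hit k) * X + hit k * A.
    by rewrite ler_pdivrMl ?ltr0n //; apply: (le_trans main); rewrite le_eqVlt; apply/orP; left;
       apply/eqP; ring.
  move=> hS; have := le_trans h15 (lerD (lexx E) hS).
  by move: (vl _ _ _ _) => v hv; lra.
set m1 := write m 15 0 r%:R.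
have ag1 : agree [:: 8; 13; 15]%N m m1 by apply: agree_write; rewrite ?inE.
have hm1 : marks u q m1 := marks_agree ag1 isT isT hm.
pose st1 : qst := mk0 (fun _ b => if b then 0 else (Num.sqrt n.+1%:R)^-1%:C%C).
have d1 : det (Apply (QFT r0)) m1 K0 m1 st1 1.
  apply: det_gate => //; first exact: sqnorm_ket0.
  rewrite (_ : K0 = mk0 (fun i b => ((i == ord0) && ~~ b)%:R)).
    by rewrite qft_mk0; apply: eq_mk0 => i b; rewrite qft_delta.
  apply: bs_ffunP => i v b; rewrite mk_bs ffunE ket0_bs !get_bs.
  by case: (i == _); case: (v == _); case: b.
have d2 : det query_rot m1 st1 m1 (gst q 1 1) 5.
  by apply: (det_query_rot EO hU E0 Phi0 label_uv oracle_uv q01 hm1 d1.1) => i b;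
     exact: rotf_unif.
have m1r : m1 15%N 0%N = r%:R by rewrite /m1 write_same.
have [m2 [ag2 d3]] :=
  det_grover_loop EO hU E0 Phi0 label_uv oracle_uv q01 (x := (1, 1)) hm1 m1r d2.1.
have {}ag2 : agree [:: 8; 13; 15]%N m1 m2.
  by apply: agree_sub ag2 => a; rewrite !inE => ->; rewrite !orbT.
have ag := agree_trans ag1 ag2.
have := iter_grover_norm r; rewrite /=; move: d3; set x := iter r _ _ => d3 nx.
have agw (i : I) t : agree [:: 8; 13; 15]%N m (write (write m2 13 0 t) 8 0 i%:R).
  by do 2!(apply: agree_write; first by rewrite !inE).
have b4 := val_measure2 j K m2 d3.1.
have c0 : \sum_i (x.2 * amp0 q i) ^+ 2 * vl j K (write (write m2 13 0 0) 8 0 i%:R) K0 <=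
    (1 - x.1 ^+ 2 * good q) * X.
  rewrite (_ : 1 - _ = x.2 ^+ 2 * (1 - good q)); last by lra.
  rewrite -(sum_amp0 q01) mulr_sumr mulr_suml; apply: ler_sum => i _.
  rewrite exprMn; apply: ler_wpM2l; first by rewrite mulr_ge0 ?sqr_ge0.
  by apply: hX; [exact: agw|rewrite /write /upd /=].
have c1 : \sum_i (x.1 * amp1 q i) ^+ 2 * vl j K (write (write m2 13 0 1) 8 0 i%:R) K0 <=
    x.1 ^+ 2 * good q * A.
  rewrite mulr_sumr; apply: ler_sum => i _.
  rewrite exprMn (_ : _ * (_ / _ * _) = x.1 ^+ 2 * amp1 q i ^+ 2 * Y i).
    apply: ler_wpM2l; first by rewrite mulr_ge0 ?sqr_ge0.
    by apply: hY; [exact: agw|rewrite /write /upd /=..].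
  by field; rewrite gt_eqF.
have rk : (r : nat)%:R * E <= k%:R * E by rewrite ler_wpM2r // ler_nat -ltnS.
have e1 := val_seq U EO E0 Phi0 j _ _ K m1 sqnorm_ket0.
have e2 := val_seq U EO E0 Phi0 j _ _ K m1 d1.1.
have e3 := val_seq U EO E0 Phi0 j _ _ K m1 d2.1.
apply: (le_trans (e1 _ _)); have := d1.2 j; move=> f1; have := f1 _ => {}f1.
have := d2.2 j; move=> f2; have := d3.2 j => f3.
apply: (le_trans (lerD (lexx _) (f1 _))).
apply: (le_trans (lerD (lexx _) (lerD (lexx _) (e2 _ _)))).
apply: (le_trans (lerD (lexx _) (lerD (lexx _) (lerD (lexx _) (f2 _))))).
apply: (le_trans (lerD (lexx _) (lerD (lexx _) (lerD (lexx _) (lerD (lexx _) (e3 _ _)))))).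
apply: (le_trans (lerD (lexx _) (lerD (lexx _) (lerD (lexx _) (lerD (lexx _) (lerD (lexx _)
  (f3 _))))))).
apply: (le_trans (lerD (lexx _) (lerD (lexx _) (lerD (lexx _) (lerD (lexx _) (lerD (lexx _)
  (lerD (lexx _) b4))))))).
have := lerD c0 c1; lra.
Qed.

End Attempt.

(** * Success probability of an attempt *)

Section Hitting.
Context {R : realType} {n : nat} (q : 'I_n.+1 -> R).
Hypothesis q01 : forall i, 0 <= q i <= 1.
Local Notation p := (good q).

(** The term without iteration contributes the probability of the flag in the initial state, so the
    search works with any k. *)
Lemma hit_gt0 k : 0 < p -> 0 < hit q k.
Proof.
move=> p0; rewrite /hit mulr_gt0 ?invr_gt0 ?ltr0n // big_ord_recl /= expr1n mul1r.
by rewrite ltr_wpDr // sumr_ge0 // => i _; rewrite mulr_ge0 ?sqr_ge0 // ltW.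
Qed.

(** In the orthonormal frame of the plane the iterate is minus the rotation by 2t; the factors sin t
    and cos t convert rescalings into coordinates of that frame. *)
Lemma iter_grover (t : R) r : sin t ^+ 2 = p ->
  (iter r (grover q) (1, 1)).1 * sin t = (-1) ^+ r * sin ((2 * r%:R + 1) * t) /\
  (iter r (grover q) (1, 1)).2 * cos t = (-1) ^+ r * cos ((2 * r%:R + 1) * t).
Proof.
move=> hs; elim: r => [|r [IH1 IH2]]; first by rewrite /= mulr0 add0r !mul1r.
have -> : (2 * r.+1%:R + 1) * t = (2 * r%:R + 1) * t + t *+ 2.
  by rewrite -natr1 mulr2n; ring.
have [s2t c2t] := (sin_mulr2n t, cos_mulr2n t).
move: (t *+ 2) s2t c2t => d s2t c2t; rewrite sinD cosD s2t c2t exprS iterS.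
move: IH1 IH2; set x := iter r _ _; set ph := (_ + 1) * t; move: ((-1) ^+ r) => e IH1 IH2.
have c2 := cos2Dsin2 t.
have hc : 1 - p = cos t ^+ 2 by rewrite -hs; lra.
rewrite /grover /= hc -hs; split.
  rewrite (_ : _ * sin t = - (x.1 * sin t) -
     2 * (x.2 * cos t * cos t * sin t - x.1 * sin t * sin t ^+ 2)); last by ring.
  rewrite IH1 IH2 (_ : sin t ^+ 2 = 1 - cos t ^+ 2); last by lra.
  by rewrite !mulr2n; ring.
rewrite (_ : _ * cos t = x.2 * cos t -
   2 * (x.2 * cos t * cos t - x.1 * sin t * sin t) * cos t); last by ring.
by rewrite IH1 IH2 !mulr2n; ring.
Qed.

(** With 2 sin(a)^2 = 1 - cos(2a), the products 2 sin(2t) cos(2a) = sin(2a + 2t) - sin(2a - 2t)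
    telescope over a = (2r + 1)t. *)
Lemma sum_sin_odd (t : R) k :
  4 * sin (2 * t) * (\sum_(r < k) sin ((2 * r%:R + 1) * t) ^+ 2) =
  2 * k%:R * sin (2 * t) - sin (4 * k%:R * t).
Proof.
elim: k => [|k IH]; first by rewrite big_ord0 !mulr0 !mul0r sin0 subr0.
rewrite big_ord_recr /= mulrDr IH -[k.+1%:R]natr1.
set ph := (2 * k%:R + 1) * t.
have -> : 4 * k%:R * t = 2 * ph - 2 * t by rewrite /ph; ring.
have -> : 4 * (k%:R + 1) * t = 2 * ph + 2 * t by rewrite /ph; ring.
rewrite sinB sinD; have -> : cos (2 * ph) = 1 - 2 * sin ph ^+ 2.
  by rewrite mulr_natl cos_mulr2n; have := cos2Dsin2 ph; rewrite mulr2n; lra.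
by ring.
Qed.

(* Boyer, Brassard, Hoyer and Tapp: averaging over the number of iterations. *)
Lemma hit_ge (k : nat) : 0 < p -> p <= 1 / 2 -> 1 <= 2 * p * k.+1%:R ^+ 2 ->
  1 / 4 <= hit q k.
Proof.
move=> p0 p1 hk.
have sp01 : 0 <= Num.sqrt p <= 1.
  rewrite sqrtr_ge0 /= -[X in _ <= X]sqrtr1 ler_sqrt; lra.
pose t := asin (Num.sqrt p).
have st : sin t = Num.sqrt p by rewrite asinK // in_itv /=; lra.
have st2 : sin t ^+ 2 = p by rewrite st sqr_sqrtr // ltW.
have ct : cos t = Num.sqrt (1 - p) by rewrite cos_asin ?sqr_sqrtr ?(ltW p0) //; lra.
have hitE : hit q k = k.+1%:R^-1 * \sum_(r < k.+1) sin ((2 * r%:R + 1) * t) ^+ 2.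
  rewrite /hit; congr (_ * _); apply: eq_bigr => r _.
  have [h _] := iter_grover r st2; rewrite -{1}st2 -exprMn h exprMn.
  by rewrite sqrr_sign mul1r.
have s2t : sin (2 * t) = 2 * (Num.sqrt p * Num.sqrt (1 - p)).
  by rewrite mulr_natl sin_mulr2n st ct mulr2n; ring.
have s2t0 : 0 < sin (2 * t) by rewrite s2t !mulr_gt0 ?sqrtr_gt0 //; lra.
have k0 : 0 < k.+1%:R :> R by rewrite ltr0n.
(* Since p <= 1/2, sin(2t)^2 = 4p(1 - p) >= 2p. *)
have big : 1 <= k.+1%:R * sin (2 * t).
  rewrite -(@ler_pXn2r _ 2) ?nnegrE ?ler01 ?mulr_ge0 ?(ltW s2t0) ?ler0n // expr1n exprMn.
  rewrite s2t exprMn exprMn !sqr_sqrtr ?(ltW p0) //; last by lra.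
  have : 0 <= k.+1%:R ^+ 2 * p * (1 - 2 * p) by rewrite !mulr_ge0 ?sqr_ge0 ?(ltW p0) //; lra.
  by move: hk; move: (k.+1%:R ^+ 2) => K hk; lra.
rewrite hitE ler_pdivlMl //.
(* The average is 1/2 minus sin(4(k+1)t) / (4(k+1) sin(2t)), and [big] bounds the subtracted term by
   1/4. *)
have := sum_sin_odd t k.+1; have := sin_le1 (4 * k.+1%:R * t).
move: (\sum_(r < k.+1) _) big => S big s1 hS.
rewrite -(ler_pM2l s2t0); lra.
Qed.

End Hitting.

(** * Table of cells and bound on the number of iterations *)

Section Preparation.

Definition add_cells : cmd 1 :=
  While (Bin OLess (Lit 0) (var 9))
    (Seq (Assign 1 4 (var 6) (var 8)) (Seq (Assign 1 5 (var 6) (var 9))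
    (Seq (incr 6) (decr 9)))).

Definition weigh : cmd 1 := set_var 9 (Bin ODiv (Bin OMul (var 9) (input 1)) (input 2)).

Definition add_item : cmd 1 :=
  Seq (set_var 8 (Cell 1 (var 7)))
  (Seq (Assign 1 3 (var 8) (Lit 1))
  (Seq lookup
  (Seq (set_var 9 (abs_expr (var 9)))
  (Seq (set_var 10 (Bin OSub (var 10) (var 9)))
  (Seq weigh
  (Seq add_cells (incr 7))))))).

Definition add_items : cmd 1 := While (Bin OLess (var 7) (input 4)) add_item.

(** The test is w < 7G/sqrt T, squared so as to avoid roots. *)
Definition target : cmd 1 :=
  If (Bin OLess (Bin OMul (Bin OMul (var 10) (var 10)) (input 1))
                (Bin OMul (Lit 49) (Bin OMul (input 2) (input 2))))
     (set_var 16 (input 0))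
     (set_var 16 (Bin ODiv (Bin OMul (Bin OMul (Lit 2) (input 0)) (input 3)) (var 10))).

(** A linear search for the rounded-up square root is cheap enough, the result being O(sqrt n) in
    the regime of the time bound. *)
Definition root : cmd 1 :=
  While (Bin OLess (Bin OMul (var 11) (var 11)) (var 16)) (incr 11).

Definition prepare : cmd 1 :=
  Seq (set_var 10 (input 2))
  (Seq add_items
  (Seq (set_var 8 (input 0))
  (Seq (set_var 9 (var 10))
  (Seq weigh
  (Seq add_cells
  (Seq target root)))))).

Context {R : realType} {V : valspace R} {n : nat}.
Context (U : operator R ('I_n.+1 * vtype V)%type) (EO : R).
Context (E : R) (Phi : memory R -> R).
Hypothesis (hU : unitary U) (E0 : 0 <= E) (Phi0 : forall m, 0 <= Phi m).
Local Notation I := 'I_n.+1.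
Local Notation qst := (qstate V 1 n).
Local Notation K0 := ([ffun s => (s == ket0 V 1 n)%:R] : qst).
Local Notation dt p m m' c := (det U EO E Phi p m K0 m' K0 c).
Context (u : 'rV[R]_n.+1) (uv : I -> vtype V).
Hypothesis label_uv : forall i, label (uv i) = u ord0 i.
Hypothesis oracle_uv : forall i y, U y (i, vzero V) = (y == (i, uv i))%:R.
Implicit Types (m : memory R).

Lemma dt_assign a e1 e2 m j x : Num.truncn (ceval m e1) = j -> ceval m e2 = x ->
  dt (Assign 1 a e1 e2) m (write m a j x) 1.
Proof. by move=> <- <-; apply: det_assign => //; apply: sqnorm_ket0. Qed.

Lemma dt_set a e m x : ceval m e = x -> dt (set_var a e) m (write m a 0 x) 1.
Proof. by apply: dt_assign; rewrite /ceval /= natrK. Qed.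

Lemma dt_incr a m x : m a 0%N + 1 = x -> dt (incr a) m (write m a 0 x) 1.
Proof. by move=> h; apply: dt_set; rewrite /ceval /= !natrK. Qed.

Lemma dt_seq p1 p2 m m1 m2 c1 c2 : dt p1 m m1 c1 -> dt p2 m1 m2 c2 ->
  dt (Seq p1 p2) m m2 (1 + c1 + c2).
Proof. by apply: det_seq => //; apply: sqnorm_ket0. Qed.

Lemma dt_le p m m' c c' : dt p m m' c -> c <= c' -> dt p m m' c'.
Proof. by move=> h le; apply: (det_le E0 le h). Qed.

(** Up to the factor 1/l, the expectation of [h] at the label of a uniform cell, on acceptance.
    Quantifying over [h] describes the table without tracking where each item lies. *)
Definition cell_sum m (l : nat) (h : R -> R) : R :=
  \sum_(c < l) clamp (m 5%N c) * h (m 4%N c).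

(** One round of [add_cells]: a cell takes the clamped part and leaves the excess to the next
    one. *)
Lemma clamp_split (x : R) : 0 < x -> clamp x + Num.max 0 (x - 1) = x.
Proof.
move=> x0; rewrite /clamp; have [x1|x1] := leP 1 x.
  by rewrite !max_r; lra.
by rewrite (max_r (ltW x0)) max_l; lra.
Qed.

(** A round takes 8 steps, there are fewer than x + 1 rounds, and the last guard takes one step. [P]
    transports any property of the labels. *)
Lemma dt_add_cells_pos m (l : nat) (x y : R) : m 6%N 0%N = l%:R -> m 9%N 0%N = x ->
  m 8%N 0%N = y -> 0 < x ->
  exists m' (l' : nat), [/\ agree [:: 4; 5; 6; 9]%N m m', m' 6%N 0%N = l'%:R /\
    l'%:R <= l%:R + x + 1,
    forall h, cell_sum m' l' h = cell_sum m l h + x * h y,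
    forall P : R -> Prop, (forall c, (c < l)%N -> P (m 4%N c)) -> P y ->
      forall c, (c < l')%N -> P (m' 4%N c) &
    dt add_cells m m' (8 * x + 9)].
Proof.
(* The loop lowers a real by one at each round, so the induction is on an integer above it. *)
have [N hN] : exists N : nat, x <= N%:R.
  by exists (Num.truncn x).+1; rewrite ltW // truncnS_gt.
elim: N m l x hN => [|N IH] m l x hN m6 m9 m8 x0; first by move: hN x0; lra.
pose m1 := write (write (write (write m 4 l y) 5 l x) 6 0 l.+1%:R) 9 0 (x - 1).
have ag : agree [:: 4; 5; 6; 9]%N m m1.
  by do 4!(apply: agree_write; first by rewrite !inE).
have d1 : dt (Seq (Assign 1 4 (var 6) (var 8)) (Seq (Assign 1 5 (var 6) (var 9))
    (Seq (incr 6) (decr 9)))) m m1 (1 + 1 + (1 + 1 + (1 + 1 + 1))).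
  apply: dt_seq; first by apply: dt_assign; rewrite eval_var ?m6 ?natrK ?m8.
  apply: dt_seq; first by apply: dt_assign; rewrite eval_var /write /upd /= ?m6 ?natrK ?m9.
  apply: dt_seq; first by apply: dt_incr; rewrite /write /upd /= m6 natr1.
  by apply: dt_set; rewrite /ceval /= !natrK /write /upd /= m9.
have guard m0 : ceval m0 (Bin OLess (Lit 0) (var 9)) = (0 < m0 9%N 0%N)%R%:R.
  by rewrite /ceval /= natrK.
have g1 : ceval m (Bin OLess (Lit 0) (var 9)) != 0 by rewrite guard m9 x0 pnatr_eq0.
have m16 : m1 6%N 0%N = l.+1%:R by rewrite /m1 /write /upd /=.
have m19 : m1 9%N 0%N = x - 1 by rewrite /m1 /write /upd /=.
have m18 : m1 8%N 0%N = y by rewrite /m1 /write /upd /=.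
have s1 h : cell_sum m1 l.+1 h = cell_sum m l h + clamp x * h y.
  rewrite /cell_sum big_ord_recr /=; congr (_ + _); last by rewrite /m1 /write /upd /= eqxx.
  by apply: eq_bigr => c _; rewrite /m1 /write /upd /= (ltn_eqF (ltn_ord c)).
have P1 (P : R -> Prop) : (forall c, (c < l)%N -> P (m 4%N c)) -> P y ->
    forall c, (c < l.+1)%N -> P (m1 4%N c).
  move=> hP Py c; rewrite ltnS leq_eqVlt /m1 /write /upd /= => /predU1P[->|cl].
    by rewrite eqxx.
  by rewrite ltn_eqF //; apply: hP.
have := clamp_split x0; have [x1|x1] := leP (x - 1) 0.
  rewrite addr0 => cx; exists m1, l.+1; split=> //.
  - by split=> //; rewrite -natr1; lra.
  - by move=> h; rewrite s1 cx.
  have d2 : dt add_cells m1 m1 1.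
    by apply: det_while0; rewrite ?sqnorm_ket0 // guard m19 ltNge x1.
  apply: (dt_le (c := 1 + (1 + 1 + (1 + 1 + (1 + 1 + 1))) + 1)); last by lra.
  exact: (det_whileS E0 Phi0 sqnorm_ket0 g1 d1 d2).
move=> cx.
have hN1 : x - 1 <= N%:R by move: hN; rewrite -natr1; lra.
have [m' [l' [ag' [m6' le'] s' P' d']]] := IH m1 l.+1 (x - 1) hN1 m16 m19 m18 x1.
exists m', l'; split=> //.
- exact: agree_trans ag ag'.
- by split=> //; move: le'; rewrite -natr1; lra.
- by move=> h; rewrite s' s1 -addrA -mulrDl cx.
- by move=> P hP Py; apply: P' => //; apply: P1.
apply: (dt_le (c := 1 + (1 + 1 + (1 + 1 + (1 + 1 + 1))) + (8 * (x - 1) + 9))); last by lra.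
exact: (det_whileS E0 Phi0 sqnorm_ket0 g1 d1 d').
Qed.

Lemma dt_add_cells m (l : nat) (x y : R) : m 6%N 0%N = l%:R -> m 9%N 0%N = x ->
  m 8%N 0%N = y -> 0 <= x ->
  exists m' (l' : nat), [/\ agree [:: 4; 5; 6; 9]%N m m', m' 6%N 0%N = l'%:R /\
    l'%:R <= l%:R + x + 1,
    forall h, cell_sum m' l' h = cell_sum m l h + x * h y,
    forall P : R -> Prop, (forall c, (c < l)%N -> P (m 4%N c)) -> P y ->
      forall c, (c < l')%N -> P (m' 4%N c) &
    dt add_cells m m' (8 * x + 9)].
Proof.
move=> m6 m9 m8; rewrite le_eqVlt => /predU1P[x0|x0]; last exact: dt_add_cells_pos.
exists m, l; rewrite -x0; split=> //.
- by split=> //; lra.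
- by move=> h; rewrite mul0r addr0.
apply: (dt_le (c := 1)); last by lra.
by apply: det_while0; rewrite ?sqnorm_ket0 // /ceval /= natrK m9 -x0 ltxx.
Qed.

Lemma dt_root m (X : R) : m 11%N 0%N = 0 -> m 16%N 0%N = X ->
  exists k : nat, [/\ X <= k%:R ^+ 2, (0 < k)%N -> k.-1%:R ^+ 2 < X &
    dt root m (write m 11 0 k%:R) (2 * k%:R + 1)].
Proof.
move=> m11 m16.
have ex : exists k : nat, X <= k%:R ^+ 2.
  exists (Num.truncn X).+1; apply: (@le_trans _ _ (Num.truncn X).+1%:R).
    by rewrite ltW // truncnS_gt.
  by rewrite expr2 -natrM ler_nat; nia.
have [k hk mink] := find_ex_minn ex.
exists k; split=> // [k0|].
  by rewrite ltNge; apply/negP => /mink; lia.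
have guard m0 : ceval m0 (Bin OLess (Bin OMul (var 11) (var 11)) (var 16)) =
    (m0 11%N 0%N ^+ 2 < m0 16%N 0%N)%R%:R by rewrite /ceval /= !natrK expr2.
(* [d] counts the rounds left. The invariant is pointwise so that the final memory is
   [write m 11 0 k%:R] itself, by extensionality. *)
have gen d i m1 : (i + d = k)%N -> m1 11%N 0%N = i%:R -> m1 16%N 0%N = X ->
    (forall a j, a != 11%N -> m1 a j = m a j) -> (forall j, j != 0%N -> m1 11%N j = m 11%N j) ->
    dt root m1 (write m 11 0 k%:R) (2 * d%:R + 1).
  elim: d i m1 => [|d IH] i m1 hi h11 h16 ha h0.
    have -> : write m 11 0 k%:R = m1.
      apply/funext => a; apply/funext => j; rewrite /write /upd.
      case: eqP => [->|/eqP ne]; last by rewrite ha.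
      by case: eqP => [->|/eqP ne]; [rewrite h11 -hi addn0|rewrite h0].
    rewrite mulr0 add0r; apply: det_while0; rewrite ?sqnorm_ket0 // guard h11 h16.
    by rewrite ltNge (_ : i = k) ?hk // -hi addn0.
  have d1 : dt (incr 11) m1 (write m1 11 0 i.+1%:R) 1 by apply: dt_incr; rewrite h11 natr1.
  have d2 := IH i.+1 (write m1 11 0 i.+1%:R).
  apply: (dt_le (c := 1 + 1 + (2 * d%:R + 1))); last by rewrite -[d.+1%:R]natr1; lra.
  apply: (det_whileS E0 Phi0 sqnorm_ket0 _ d1); last apply: d2.
  - rewrite guard h11 h16 pnatr_eq0 eqb0 negbK ltNge; apply/negP => /mink; lia.
  - by lia.
  - by rewrite write_same.
  - by rewrite /write /upd /=.
  - by move=> a j ne; rewrite /write /upd (negbTE ne) ha.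
  - by move=> j ne; rewrite /write /upd /= (negbTE ne) h0.
by apply: (gen k 0%N) => //; rewrite m11.
Qed.

End Preparation.

(** * The memory after the preparation *)

Section PreparedMemory.
Context {R : realType} {V : valspace R} {n : nat}.
Context (U : operator R ('I_n.+1 * vtype V)%type) (EO : R).
Context (E : R) (Phi : memory R -> R).
Hypothesis (hU : unitary U) (E0 : 0 <= E) (Phi0 : forall m, 0 <= Phi m).
Local Notation I := 'I_n.+1.
Local Notation qst := (qstate V 1 n).
Local Notation K0 := ([ffun s => (s == ket0 V 1 n)%:R] : qst).
Local Notation dt p m m' c := (det U EO E Phi p m K0 m' K0 c).
Context (u : 'rV[R]_n.+1) (uv : I -> vtype V).
Hypothesis label_uv : forall i, label (uv i) = u ord0 i.
Hypothesis oracle_uv : forall i y, U y (i, vzero V) = (y == (i, uv i))%:R.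
Context (T : nat) (G : R) (S : {set I}).
Hypotheses (G0 : 0 < G) (lSG : l1 u S <= G).
Implicit Types (m : memory R).

Let M := linf u (~: S)%SET.
Let m0 := inputs T G S M.
Let w := G - l1 u S.

Definition cells (i : I) : R := `|u ord0 i| * T%:R / G.

(** The value [n.+1] is the dummy index; smaller ones are genuine indices. *)
Definition is_item (y : R) := exists2 k : nat, (k <= n.+1)%N & y = k%:R.

(** Invariant of [add_items], [d] being the prefix of [enum S] already treated. The number of cells
    is rounded up for each item, whence the term [size d]. *)
Record items_done (d : seq I) m : Prop := ItemsDone {
  done_agree : agree [:: 3; 4; 5; 6; 7; 8; 9; 10; 16]%N m0 m;
  done_count : m 7%N 0%N = (size d)%:R;
  done_weight : m 10%N 0%N = G - \sum_(i <- d) `|u ord0 i|;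
  done_marks : forall i : I, m 3%N i = (i \in d)%:R;
  done_cells : exists l : nat, [/\ m 6%N 0%N = l%:R,
    l%:R <= (size d)%:R + \sum_(i <- d) cells i,
    forall h, cell_sum m l h = \sum_(i <- d) cells i * h i%:R &
    forall c, (c < l)%N -> is_item (m 4%N c)] }.

Lemma cells_ge0 i : 0 <= cells i.
Proof. by rewrite /cells !mulr_ge0 ?invr_ge0 ?ler0n // ltW. Qed.

Lemma dt_add_item d (i : I) m : items_done d m -> m0 1%N (size d) = i%:R ->
  exists2 m', items_done (rcons d i) m' & dt add_item m m' (8 * cells i + 30).
Proof.
case=> ag d7 d10 d3 [l [d6 dl ds dP]] hi.
pose m1 := write m 8 0 i%:R.
have e1 : dt (set_var 8 (Cell 1 (var 7))) m m1 1.
  apply: dt_set => //; rewrite /ceval /= natrK d7 natrK.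
  by rewrite (ag 1%N isT) hi.
pose m2 := write m1 3 i 1.
have e2 : dt (Assign 1 3 (var 8) (Lit 1)) m1 m2 1.
  by apply: dt_assign => //; rewrite eval_var /m1 write_same natrK.
have [m3 [ag3 m39 e3]] := det_lookup EO hU E0 Phi0 label_uv oracle_uv (m := m2) (i := i) (erefl _).
pose m4 := write m3 9 0 `|u ord0 i|.
have e4 : dt (set_var 9 (abs_expr (var 9))) m3 m4 1.
  by apply: dt_set => //; rewrite /ceval eval_abs -[eval _ _ _]/(ceval m3 (var 9)) eval_var m39.
pose m5 := write m4 10 0 (G - \sum_(i <- rcons d i) `|u ord0 i|).
have e5 : dt (set_var 10 (Bin OSub (var 10) (var 9))) m4 m5 1.
  apply: dt_set => //; rewrite /ceval /= !natrK /m4 /write /upd /= (ag3 10%N isT).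
  by rewrite /m2 /m1 /write /upd /= d10 -cats1 big_cat big_seq1 /=; ring.
pose m6 := write m5 9 0 (cells i).
have e6 : dt weigh m5 m6 1.
  apply: dt_set => //; rewrite /ceval /= !natrK /m5 /m4 /write /upd /= (ag3 0%N isT).
  by rewrite /m2 /m1 /write /upd /= (ag 0%N isT).
have m66 : m6 6%N 0%N = l%:R by rewrite /m6 /m5 /m4 /write /upd /= (ag3 6%N isT) -d6.
have m68 : m6 8%N 0%N = i%:R by rewrite /m6 /m5 /m4 /write /upd /= (ag3 8%N isT).
have [m7 [l' [ag7 [m76 l'le] s7 P7 e7]]] :=
  dt_add_cells U EO E0 Phi0 m66 (write_same m5 9 0 (cells i)) m68 (cells_ge0 i).
have m73 a : a \notin [:: 3; 4; 5; 6; 8; 9; 10; 16]%N -> m7 a = m a.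
  rewrite !inE !negb_or.
  case/andP=> h3 /andP[h4 /andP[h5 /andP[h6 /andP[h8 /andP[h9 /andP[h10 h16]]]]]].
  rewrite ag7 ?inE ?negb_or ?h4 ?h5 ?h6 ?h9 //.
  rewrite /m6 /m5 /m4 /write /upd (negbTE h9) (negbTE h10) ag3 ?inE ?negb_or ?h9 //.
  by rewrite /m2 /m1 /write /upd (negbTE h3) (negbTE h8).
exists (write m7 7 0 (size (rcons d i))%:R); last first.
  have e8 : dt (incr 7) m7 (write m7 7 0 (size (rcons d i))%:R) 1.
    by apply: dt_incr => //; rewrite m73 // d7 size_rcons natr1.
  apply: (dt_le E0 (c := 1 + 1 + (1 + 1 + (1 + 7 + (1 + 1 + (1 + 1 + (1 + 1 +
    (1 + (8 * cells i + 9) + 1))))))));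
    last by lra.
  by do 7!(apply: dt_seq => //; first by eassumption).
split.
- move=> a ha; have a7 : a != 7%N by apply: contraNneq ha => ->.
  rewrite /write /upd (negbTE a7) m73 ?ag //.
  by apply: contra ha; rewrite !inE => /or4P[->|->|->|/or4P[->|->|->|/orP[->|->]]]; rewrite ?orbT.
- by rewrite write_same.
- by rewrite /write /upd /= (ag7 10%N isT).
- move=> j; rewrite /write /upd /= (ag7 3%N isT) /m6 /m5 /m4 /write /upd /= (ag3 3%N isT).
  rewrite /m2 /m1 /write /upd /= mem_rcons inE -(inj_eq val_inj) /=.
  by case: eqP => _ //=; rewrite d3.
have c4 : m6 4%N = m 4%N by rewrite /m6 /m5 /m4 /write /upd /= (ag3 4%N isT).
have c5 : m6 5%N = m 5%N by rewrite /m6 /m5 /m4 /write /upd /= (ag3 5%N isT).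
exists l'; split.
- by rewrite /write /upd /= m76.
- rewrite size_rcons -cats1 big_cat big_seq1 /= -natr1; move: l'le dl; lra.
- move=> h; rewrite (_ : cell_sum (write _ _ _ _) l' h = cell_sum m7 l' h) // s7.
  rewrite -cats1 big_cat big_seq1 /= -ds; congr (_ + _).
  by apply: eq_bigr => c _; rewrite c4 c5.
- move=> c cl; rewrite /write /upd /=; apply: P7 => // [c' c'l|].
    by rewrite c4; apply: dP.
  by exists i => //; rewrite ltnW.
Qed.

Lemma dt_add_items_from (d r : seq I) m : items_done d m -> enum S = d ++ r ->
  exists2 m', items_done (enum S) m' &
    dt add_items m m' (8 * (\sum_(i <- r) cells i) + 31 * (size r)%:R + 1).
Proof.
have guard d' m' : items_done d' m' -> ceval m' (Bin OLess (var 7) (input 4)) =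
    (size d' < #|S|)%N%:R.
  case=> ag d7 _ _ _; rewrite /ceval /= !natrK d7 (ag 0%N isT) /m0 /= ltr_nat //.
elim: r d m => [|i r IH] d m hd hS.
  exists m; first by rewrite hS cats0.
  rewrite big_nil !mulr0 !add0r; apply: det_while0; rewrite ?sqnorm_ket0 //.
  by rewrite (guard d) // cardE hS cats0 ltnn.
have hi : m0 1%N (size d) = i%:R.
  by rewrite /m0 /inputs /= hS map_cat nth_cat size_map ltnn subnn.
have [m1 hd1 e1] := dt_add_item hd hi.
have [m2 hd2 e2] := IH _ _ hd1 (etrans hS (esym (cat_rcons i d r))).
exists m2 => //; apply: (dt_le E0 (c := 1 + (8 * cells i + 30) +
  (8 * (\sum_(i <- r) cells i) + 31 * (size r)%:R + 1))).
  apply: (det_whileS E0 Phi0 sqnorm_ket0 _ e1 e2).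
  by rewrite (guard d) // cardE hS size_cat /= -addSnnS leq_addr pnatr_eq0.
by rewrite big_cons /= -[(size r).+1%:R]natr1; lra.
Qed.

(** The division is safe: w = 0 passes the test, as G > 0. *)
Definition goal_sqr : R :=
  if w * w * T%:R < 49 * (G * G) then n.+1%:R else 2 * n.+1%:R * M / w.

Record prepared (k l : nat) m : Prop := Prepared {
  prep_agree : agree [:: 3; 4; 5; 6; 7; 8; 9; 10; 11; 16]%N m0 m;
  prep_marks : forall i : I, m 3%N i = (i \in S)%:R;
  prep_root : m 11%N 0%N = k%:R;
  prep_count : m 6%N 0%N = l%:R;
  prep_bound : l%:R <= #|S|%:R + T%:R + 1 :> R;
  prep_sum : forall h, cell_sum m l h =
    \sum_(i in S) cells i * h i%:R + w * T%:R / G * h n.+1%:R;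
  prep_item : forall c, (c < l)%N -> is_item (m 4%N c) }.

Lemma sum_cells : \sum_(i in S) cells i + w * T%:R / G = T%:R.
Proof.
rewrite /cells -!mulr_suml -/(l1 u S) -mulrDl -mulrDl /w addrC subrK mulrAC divff ?mul1r //.
by rewrite gt_eqF.
Qed.

Lemma dt_prepare : exists m (k l : nat), [/\ prepared k l m, goal_sqr <= k%:R ^+ 2,
  (0 < k)%N -> k.-1%:R ^+ 2 < goal_sqr &
  dt prepare m0 m (8 * T%:R + 31 * #|S|%:R + 2 * k%:R + 40)].
Proof.
pose m1 := write m0 10 0 G.
have e1 : dt (set_var 10 (input 2)) m0 m1 1.
  by apply: dt_set => //; rewrite /ceval /= !natrK.
have hd1 : items_done [::] m1.
  split=> //.
  - by apply: agree_write.
  - by rewrite /m1 write_same big_nil subr0.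
  exists 0%N; split=> //; first by rewrite big_nil addr0.
  by move=> h; rewrite /cell_sum big_ord0 big_nil.
have [m2 [ag d7 d10 d3 [l [d6 dl ds dP]]] e2] := dt_add_items_from hd1 (erefl (enum S)).
pose m3 := write m2 8 0 n.+1%:R.
have e3 : dt (set_var 8 (input 0)) m2 m3 1.
  by apply: dt_set => //; rewrite /ceval /= !natrK (ag 0%N isT).
have wE : m2 10%N 0%N = w by rewrite d10 big_enum.
pose m4 := write m3 9 0 w.
have e4 : dt (set_var 9 (var 10)) m3 m4 1.
  by apply: dt_set => //; rewrite eval_var /m3 /write /upd /= wE.
pose x := w * T%:R / G; pose m5 := write m4 9 0 x.
have e5 : dt weigh m4 m5 1.
  by apply: dt_set => //; rewrite /ceval /= !natrK /m4 /m3 /write /upd /= (ag 0%N isT).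
have w0 : 0 <= w by rewrite subr_ge0.
have x0 : 0 <= x by rewrite /x !mulr_ge0 ?invr_ge0 ?ler0n // ltW.
have m56 : m5 6%N 0%N = l%:R by rewrite /m5 /m4 /m3 /write /upd /= -d6.
have [m6 [l' [ag6 [m66 l'le] s6 P6 e6]]] :=
  dt_add_cells U EO E0 Phi0 m56 (write_same m4 9 0 x) (erefl (m5 8%N 0%N)) x0.
have m58 : m5 8%N 0%N = n.+1%:R by rewrite /m5 /m4 /m3 /write /upd /=.
rewrite m58 in s6 P6.
pose m7 := write m6 16 0 goal_sqr.
have e7 : dt target m6 m7 (1 + 1).
  apply: det_if => //; first exact: sqnorm_ket0.
  rewrite /ceval /= !natrK (ag6 10%N isT) (ag6 0%N isT).
  rewrite /m5 /m4 /m3 /write /upd /= wE (ag 0%N isT) /= -/M.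
  rewrite pnatr_eq0 eqb0 negbK /m7 /goal_sqr; case: ifP => _;
    apply: dt_set => //; rewrite /ceval /= !natrK (ag6 0%N isT) ?(ag6 10%N isT);
    by rewrite /m5 /m4 /m3 /write /upd /= (ag 0%N isT) /= ?wE.
have m7E a : a \notin [:: 4; 5; 6; 8; 9; 16]%N -> m7 a = m2 a.
  rewrite !inE !negb_or.
  case/andP=> h4 /andP[h5 /andP[h6 /andP[h8 /andP[h9 h16]]]].
  rewrite /m7 /write /upd (negbTE h16) ag6 ?inE ?negb_or ?h4 ?h5 ?h6 ?h9 //.
  by rewrite /m5 /m4 /m3 /write /upd (negbTE h8) (negbTE h9).
have m711 : m7 11%N 0%N = 0 by rewrite m7E // (ag 11%N isT).
have [k [kX kmin e8]] := dt_root U EO E0 Phi0 m711 (write_same m6 16 0 goal_sqr).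
exists (write m7 11 0 k%:R), k, l'; split=> //; last first.
  apply: (dt_le E0 (c := 1 + 1 +
    (1 + (8 * (\sum_(i <- enum S) cells i) + 31 * (size (enum S))%:R + 1) +
    (1 + 1 + (1 + 1 + (1 + 1 + (1 + (8 * x + 9) + (1 + (1 + 1) + (2 * k%:R + 1)))))))));
    last by rewrite big_enum -cardE /=; have := sum_cells; rewrite /x; lra.
  by do 7!(apply: dt_seq => //; first by eassumption).
split.
- move=> a ha; have a7 : a != 11%N by apply: contraNneq ha => ->.
  have aE : m7 a = m2 a.
    by rewrite m7E //; apply: contra ha; rewrite !inE => /or4P[->|->|->|/or3P[->|->|->]];
      rewrite ?orbT.
  rewrite /write /upd (negbTE a7) aE ag //.
  by apply: contra ha; rewrite !inE => /or4P[->|->|->|/or4P[->|->|->|/or3P[->|->|->]]];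
    rewrite ?orbT.
- by move=> i; rewrite /write /upd /= m7E // d3 mem_enum.
- by rewrite write_same.
- by rewrite /m7 /write /upd /= m66.
- move: l'le dl; rewrite big_enum -cardE /=; have := sum_cells; rewrite /x; lra.
- move=> h; rewrite (_ : cell_sum (write _ _ _ _) l' h = cell_sum m6 l' h) // s6.
  rewrite [X in X + _](_ : _ = \sum_(i in S) cells i * h i%:R) // -big_enum /= -ds.
  by apply: eq_bigr => c _; rewrite /m5 /m4 /m3 /write /upd /=.
- move=> c cl; rewrite /write /upd /=; apply: P6 => //.
  by exists n.+1.
Qed.

End PreparedMemory.

(** * The sampling program and its search outside S *)

Section Sampling.
Local Notation r0 := (ord0 : 'I_1).

Definition emit : cmd 1 := Seq (Assign 1 2 (var 12) (var 8)) (incr 12).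

Definition search_loop : cmd 1 := While (Bin OLess (var 13) (Lit 1)) attempt.

(** If M = 0 no attempt could succeed and the search would run for ever. The answer 0 is then
    arbitrary: it has probability zero whenever the distribution is defined. *)
Definition choose_index : cmd 1 :=
  If (Bin OLess (var 8) (input 0)) (Skip 1)
    (If (input 3) (Seq (set_var 13 (Lit 0)) search_loop) (set_var 8 (Lit 0))).

Definition accept : cmd 1 := Seq (set_var 8 (Cell 4 (var 14))) (Seq choose_index emit).

Definition sample : cmd 1 :=
  Seq (Rand 1 14 (Lit 0) (Bin OSub (var 6) (Lit 1)))
  (Seq (Seq (Apply (Rot r0 (Cell 5 (var 14)))) (Measure (Bit r0) 13 (Lit 0)))
  (If (var 13) accept (Skip 1))).

Definition sampling : cmd 1 := While (Bin OLess (var 12) (input 1)) sample.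

Definition sampler : cmd 1 := Seq prepare sampling.

Context {R : realType} {V : valspace R} {n : nat}.
Context (U : operator R ('I_n.+1 * vtype V)%type) (EO : R).
Context (E : R) (Phi : memory R -> R).
Hypothesis (hU : unitary U) (E0 : 0 <= E) (Phi0 : forall m, 0 <= Phi m).
Local Notation I := 'I_n.+1.
Local Notation qst := (qstate V 1 n).
Local Notation vl := (val U EO E Phi).
Local Notation K0 := ([ffun s => (s == ket0 V 1 n)%:R] : qst).
Context (u : 'rV[R]_n.+1) (uv : I -> vtype V).
Hypothesis label_uv : forall i, label (uv i) = u ord0 i.
Hypothesis oracle_uv : forall i y, U y (i, vzero V) = (y == (i, uv i))%:R.
Context (T : nat) (G : R) (S : {set I}).
Hypotheses (T1 : (1 < T < n.+1)%N) (G0 : 0 < G) (lSG : l1 u S <= G).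
Implicit Types (m : memory R).

Local Notation M := (linf u (~: S)%SET).

Definition angle (i : I) : R := (1 - (i \in S)%:R) * `|u ord0 i| / (2 * M).

Lemma linf_ge0 (A : {set I}) : 0 <= linf u A.
Proof. exact: bigmax_ge_id. Qed.

Lemma le_linf (A : {set I}) i : i \in A -> `|u ord0 i| <= linf u A.
Proof. by move=> iA; rewrite /linf (bigmaxD1 i) // le_max lexx. Qed.

(** The bound 1/2, rather than 1, is what brings [good] within the range of [hit_ge]. *)
Lemma angle01 i : 0 <= angle i <= 1 / 2.
Proof.
rewrite /angle; case: (boolP (i \in S)) => iS; first by rewrite subrr !mul0r lexx /=; lra.
(* For M = 0 the quotient is 0, by the convention on the inverse of zero. *)
rewrite subr0 mul1r; have := linf_ge0 (~: S)%SET; rewrite le_eqVlt => /predU1P[<-|M0].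
  by rewrite mulr0 invr0 mulr0 lexx /=; lra.
have M20 : 0 < 2 * M by rewrite mulr_gt0.
apply/andP; split; first by rewrite divr_ge0 // ltW.
rewrite ler_pdivrMr //; by have : `|u ord0 i| <= M by [apply: le_linf; rewrite inE]; lra.
Qed.

Lemma angle_le1 i : 0 <= angle i <= 1.
Proof. by have /andP[-> ] := angle01 i; lra. Qed.

Lemma good_angle : good angle = l1 u (~: S)%SET / (2 * M * n.+1%:R).
Proof.
rewrite /good (eq_bigr (fun i => angle i / n.+1%:R)) => [|i _]; last first.
  by rewrite (amp1_sqr angle_le1).
rewrite /l1 mulr_suml [RHS]big_mkcond; apply: eq_bigr => i _.
rewrite inE /angle; case: (i \in S); first by rewrite /= subrr !mul0r.
by rewrite subr0 mul1r [in RHS]invfM mulrA.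
Qed.

Lemma sum_amp1_good : 0 < good angle -> \sum_i amp1 angle i ^+ 2 / good angle = 1.
Proof. by move=> g0; rewrite -mulr_suml divff // gt_eqF. Qed.

Lemma linf_gt0_l1 (A : {set I}) : linf u A != 0 -> 0 < l1 u A.
Proof.
move=> M0; rewrite lt_def sumr_ge0 ?andbT //; apply: contraNneq M0 => l0.
rewrite eq_le linf_ge0 andbT; apply/bigmax_leP; split=> // i iA.
by rewrite -l0 /l1 (bigD1 i) //= lerDl sumr_ge0.
Qed.

Lemma good_gt0 : M != 0 -> 0 < good angle.
Proof.
move=> M0; rewrite good_angle divr_gt0 ?linf_gt0_l1 //.
by rewrite !mulr_gt0 ?ltr0n // lt_def M0 linf_ge0.
Qed.

Lemma val_le j j' ks m (phi : qst) : (j <= j')%N -> vl j ks m phi <= vl j' ks m phi.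
Proof.
move/subnK <-; elim: (j' - j)%N => // d IH; rewrite addSn.
exact: (le_trans IH (val_mono _ _ _ _ _ _ _ _)).
Qed.

(** Expected length of a geometric sequence of attempts; 17 is the 15 of an attempt, the guard
    before it and the final guard. *)
Definition search_cost (k : nat) : R := (22 * k%:R + 17) / hit angle k.

(** The bound reproduces itself through one round, which fails with probability 1 - [hit] and
    otherwise draws the index from the final law; induction on the fuel concludes. *)
Lemma val_search j K m k (Y : I -> R) : marks u angle m -> m 11%N 0%N = k%:R ->
  M != 0 -> m 13%N 0%N = 0 -> (forall i, 0 <= Y i) ->
  (forall m' (i : I), agree [:: 8; 13; 15]%N m m' -> m' 8%N 0%N = i%:R ->
     vl j K m' K0 <= Y i) ->
  vl j (search_loop :: K) m K0 <=
  search_cost k * E + \sum_i amp1 angle i ^+ 2 / good angle * Y i.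
Proof.
move=> hm m11 M0 m13 Y0 hY; have g0 := good_gt0 M0.
have h0 := hit_gt0 k g0.
set A := \sum_i _; have A0 : 0 <= A.
  by apply: sumr_ge0 => i _; rewrite !mulr_ge0 ?sqr_ge0 ?invr_ge0 // ltW.
have sc0 : 0 <= search_cost k * E.
  by rewrite !mulr_ge0 ?invr_ge0 ?(ltW h0) // addr_ge0 ?mulr_ge0 ?ler0n.
have guard m' : ceval m' (Bin OLess (var 13) (Lit 1)) = (m' 13%N 0%N < 1)%R%:R.
  by rewrite /ceval /= natrK.
(* The continuation is bounded at fuel j only, so the induction runs over smaller fuels and [val_le]
   returns to j. *)
suff gen i m1 : (i <= j)%N -> agree [:: 8; 13; 15]%N m m1 -> m1 13%N 0%N = 0 ->
    vl i (search_loop :: K) m1 K0 <= search_cost k * E + A by exact: (gen j).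
elim: i m1 => [|i IH] m1 ij ag1 m113; first by rewrite /= addr_ge0.
rewrite val_whileS ?sqnorm_ket0 // guard m113 ltr01 oner_eq0 /=.
have hm1 : marks u angle m1 := marks_agree ag1 isT isT hm.
have m111 : m1 11%N 0%N = k%:R by rewrite (ag1 11%N isT).
have := @val_attempt _ _ _ U EO E Phi hU E0 Phi0 u uv label_uv oracle_uv angle angle_le1 i
  (search_loop :: K) m1 k (search_cost k * E + A) (fun i => E + Y i) hm1 m111 g0.
move=> /(_ _ _)/(le_trans (lexx _)) H.
apply: (le_trans (lerD (lexx E) (H _ _))).
- move=> m2 ag2 m213; apply: IH => //; first exact: ltnW.
  exact: agree_trans ag1 ag2.
- move=> m2 i2 ag2 m213 m28.
  apply: (le_trans (val_while U EO E0 Phi0 _ _ _ _ _ sqnorm_ket0)).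
  rewrite guard m213 ltxx eqxx /= lerD2l.
  apply: (le_trans (val_le _ _ _ (ltnW ij))); apply: hY => //.
  exact: agree_trans ag1 ag2.
under eq_bigr do rewrite mulrDr.
rewrite big_split /= -mulr_suml sum_amp1_good // mul1r -/A.
have hb : hit angle k * (search_cost k * E) = (22 * k%:R + 17) * E.
  by rewrite /search_cost; field; rewrite gt_eqF.
have h1 : hit angle k * E <= E.
  rewrite ler_piMl // /hit ler_pdivrMl ?ltr0n // mulr1.
  have -> : k.+1%:R = \sum_(r < k.+1) 1 :> R by rewrite sumr_const card_ord.
  apply: ler_sum => r _; have := iter_grover_norm angle r.
  move: (iter _ _ _) => x /= xn; have /andP[_ g1] := good01 angle_le1.
  have : 0 <= x.2 ^+ 2 * (1 - good angle) by rewrite mulr_ge0 ?sqr_ge0 ?subr_ge0.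
  by lra.
by move: hb; move: (hit _ _) (search_cost _ * E) h1 => h s hE hs; lra.
Qed.

End Sampling.

(** * Independent samples as an iterated expectation *)

Section Distribution.
Context {R : realType} {n : nat}.
Local Notation I := 'I_n.+1.

(* Expected value of [F] at the sequence obtained by appending [r] independent
   samples of [D] to [o]. *)
Fixpoint expect (D : I -> R) (F : seq I -> R) (r : nat) (o : seq I) : R :=
  if r is r'.+1 then \sum_i D i * expect D F r' (rcons o i) else F o.

Lemma expect_ge0 D F r o : (forall i, 0 <= D i) -> (forall o, 0 <= F o) ->
  0 <= expect D F r o.
Proof.
move=> D0 F0; elim: r o => //= r IH o; apply: sumr_ge0 => i _; exact: mulr_ge0.
Qed.

Lemma expect_compl D F r o : \sum_i D i = 1 ->
  expect D (fun o => 1 - F o) r o = 1 - expect D F r o.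
Proof.
move=> D1; elim: r o => //= r IH o.
under eq_bigr do rewrite IH mulrBr mulr1.
by rewrite sumrB D1.
Qed.

Lemma expect_indic D r (o p : seq I) : (size o + r)%N = size p ->
  expect D (fun s => (s == p)%:R) r o =
  (o == take (size o) p)%:R * \prod_(i <- drop (size o) p) D i.
Proof.
elim: r o => [|r IH] o /=.
  by rewrite addn0 => ->; rewrite take_size drop_size big_nil mulr1.
move=> hr; have lt : (size o < size p)%N by rewrite -hr addnS ltnS leq_addr.
rewrite (drop_nth ord0 lt) big_cons.
rewrite (sum_only (w0 := nth ord0 p (size o))) => [|i ne].
  rewrite IH size_rcons ?addSnnS // (take_nth ord0 lt) eqseq_rcons eqxx andbT.
  by rewrite mulrCA.
rewrite IH size_rcons ?addSnnS // (take_nth ord0 lt) eqseq_rcons (negbTE ne) andbF.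
by rewrite mul0r mulr0.
Qed.

End Distribution.

(** * Law of one sample, and bound on the sampling loop *)

Section Sampler.
Context {R : realType} {V : valspace R} {n : nat}.
Context (U : operator R ('I_n.+1 * vtype V)%type) (EO : R).
Context (E : R) (Phi : memory R -> R).
Hypothesis (hU : unitary U) (E0 : 0 <= E) (Phi0 : forall m, 0 <= Phi m).
Local Notation I := 'I_n.+1.
Local Notation qst := (qstate V 1 n).
Local Notation vl := (val U EO E Phi).
Local Notation K0 := ([ffun s => (s == ket0 V 1 n)%:R] : qst).
Local Notation dt p m m' c := (det U EO E Phi p m K0 m' K0 c).
Context (u : 'rV[R]_n.+1) (uv : I -> vtype V).
Hypothesis label_uv : forall i, label (uv i) = u ord0 i.
Hypothesis oracle_uv : forall i y, U y (i, vzero V) = (y == (i, uv i))%:R.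
Context (T : nat) (G : R) (S : {set I}).
Hypotheses (T1 : (1 < T < n.+1)%N) (G0 : 0 < G) (lSG : l1 u S <= G).
Implicit Types (m : memory R).

Local Notation M := (linf u (~: S)%SET).
Local Notation w := (G - l1 u S).
Local Notation m0 := (inputs T G S M).
Local Notation ang := (angle u S).

(** Law of the index produced when the dummy index comes out. *)
Definition tail (i : I) : R :=
  if M == 0 then (i == ord0)%:R else amp1 ang i ^+ 2 / good ang.

(** The law that the program really samples. It is a distribution even when D_u(G,S) is not defined,
    so that the time bound covers that case. *)
Definition law (i : I) : R := (i \in S)%:R * (`|u ord0 i| / G) + w / G * tail i.

Lemma tail_ge0 i : 0 <= tail i.
Proof.
rewrite /tail; case: ifP => // _; rewrite divr_ge0 ?sqr_ge0 //.
by have /andP[] := good01 (angle_le1 u S).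
Qed.

Lemma sum_tail : \sum_i tail i = 1.
Proof.
rewrite /tail; case: eqP => [_|/eqP M0]; last by rewrite sum_amp1_good // good_gt0.
by rewrite (sum_only (w0 := ord0)) ?eqxx // => i /negbTE ->.
Qed.

Lemma law_ge0 i : 0 <= law i.
Proof.
by rewrite /law addr_ge0 ?mulr_ge0 ?invr_ge0 ?ler0n ?tail_ge0 ?subr_ge0 // ltW.
Qed.

Lemma sum_law : \sum_i law i = 1.
Proof.
rewrite /law big_split /= -mulr_sumr sum_tail mulr1.
rewrite (_ : \sum_i _ = l1 u S / G); last first.
  rewrite /l1 mulr_suml [RHS]big_mkcond; apply: eq_bigr => i _.
  by case: (i \in S); rewrite ?mul1r ?mul0r.
by field; rewrite gt_eqF.
Qed.

Lemma law_cells (F : I -> R) :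
  T%:R * \sum_i law i * F i =
  \sum_(i in S) cells u T G i * F i + w * T%:R / G * \sum_i tail i * F i.
Proof.
rewrite !mulr_sumr [X in _ = X + _]big_mkcond -big_split /=; apply: eq_bigr => i _.
rewrite /law /cells; case: (i \in S); rewrite ?mul1r ?mul0r; by ring.
Qed.

Context (psi : seq I -> R).
Hypothesis psi0 : forall o, 0 <= psi o.
Hypothesis Phi_psi : forall m (o : seq I), size o = T ->
  (forall j, (j < T)%N -> m 2%N j = (nth ord0 o j)%:R) -> Phi m <= psi o.

Context (mp : memory R) (k l : nat).
Hypothesis prep : prepared u T G S k l mp.

Local Notation W := (expect law psi).

Lemma W_ge0 r o : 0 <= W r o.
Proof. exact: expect_ge0 law_ge0 psi0. Qed.

Definition sampled (o : seq I) m := [/\ agree [:: 2; 8; 12; 13; 14; 15]%N mp m,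
  m 12%N 0%N = (size o)%:R &
  forall j, (j < size o)%N -> m 2%N j = (nth ord0 o j)%:R].

Lemma sampled_agree o m m' : agree [:: 8; 13; 14; 15]%N m m' -> sampled o m -> sampled o m'.
Proof.
move=> ag [ag0 h12 h2]; split=> [||j jo].
- by apply: (agree_trans ag0); apply: agree_sub ag => a; rewrite !inE =>
    /or4P[->|->|->|->]; rewrite ?orbT.
- by rewrite (ag 12%N isT).
- by rewrite (ag 2%N isT) h2.
Qed.

Lemma input_mp m o j : sampled o m -> m 0%N j = m0 0%N j.
Proof. by case=> ag _ _; rewrite (ag 0%N isT) (prep_agree prep (a := 0%N) isT). Qed.

Lemma sampled_marks o m : sampled o m -> marks u ang m.
Proof.
move=> hs i; rewrite (input_mp _ hs) /= /angle; case: hs => ag _ _.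
by rewrite (ag 3%N isT) (prep_marks prep).
Qed.

Lemma dt_emit o (i : I) m : sampled o m -> m 8%N 0%N = i%:R ->
  exists2 m', sampled (rcons o i) m' & dt emit m m' 3.
Proof.
case=> ag h12 h2 h8.
exists (write (write m 2 (size o) i%:R) 12 0 (size o).+1%:R).
  split.
  - apply: agree_write; first by rewrite !inE.
    by apply: agree_write; first by rewrite !inE.
  - by rewrite write_same size_rcons.
  move=> j; rewrite size_rcons ltnS leq_eqVlt /write /upd /= nth_rcons => /predU1P[->|jo].
    by rewrite eqxx ltnn.
  by rewrite jo ltn_eqF // h2.
apply: (dt_le E0 (c := 1 + 1 + 1)); last by lra.
apply: (dt_seq E0 Phi0 (m1 := write m 2 (size o) i%:R)).
  by apply: dt_assign; rewrite // eval_var ?h12 ?h8 // natrK.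
by apply: dt_incr => //; rewrite /write /upd /= h12 natr1.
Qed.

Lemma val_dt j p K m m' c b : dt p m m' c -> vl j K m' K0 <= b ->
  vl j (p :: K) m K0 <= c * E + b.
Proof. by move=> [_ h] hb; apply: (le_trans (h j K)); rewrite lerD2l. Qed.

Lemma val_emit j K o (i : I) m b : sampled o m -> m 8%N 0%N = i%:R ->
  (forall m', sampled (rcons o i) m' -> vl j K m' K0 <= b) ->
  vl j (emit :: K) m K0 <= 3 * E + b.
Proof.
by move=> hs h8 hb; have [m' hs' d] := dt_emit hs h8; apply: (val_dt d); apply: hb.
Qed.

Definition miss_cost : R := if M == 0 then 0 else search_cost u S k.

Lemma val_choose j K o m (Y : I -> R) : sampled o m -> (forall i, 0 <= Y i) ->
  is_item (n := n) (m 8%N 0%N) ->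
  (forall m' (i : I), sampled o m' -> m' 8%N 0%N = i%:R -> vl j K m' K0 <= Y i) ->
  vl j (choose_index :: K) m K0 <=
  (if m 8%N 0%N == n.+1%:R then (5 + miss_cost) * E + \sum_i tail i * Y i
   else 5 * E + Y (inord (Num.truncn (m 8%N 0%N)))).
Proof.
move=> hs Y0 [y yn m8] hY.
rewrite /choose_index; apply: (le_trans (val_if U EO E0 Phi0 _ _ _ _ _ _ sqnorm_ket0)).
have -> : ceval m (Bin OLess (var 8) (input 0)) = (y < n.+1)%N%:R.
  by rewrite /ceval /= !natrK m8 (input_mp _ hs) /= ltr_nat.
rewrite pnatr_eq0 eqb0 negbK m8 natrK (eqr_nat R).
have [ylt|ylt] := ltnP y n.+1; last first.
  have yE : y = n.+1 by apply/eqP; rewrite eqn_leq yn.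
  rewrite yE eqxx /=.
  have := val_if U EO E0 Phi0 j (input 3) (Seq (set_var 13 (Lit 0)) search_loop)
    (set_var 8 (Lit 0)) K m sqnorm_ket0.
  rewrite /ceval /= !natrK (input_mp _ hs) /=.
  rewrite /miss_cost /tail; case: eqP => [_|/eqP M0] /= h1; apply: (le_trans (lerD (lexx E) h1)).
    have d : dt (set_var 8 (Lit 0)) m (write m 8 0 0) 1 by apply: dt_set.
    rewrite (sum_only (w0 := ord0)) => [|i /negbTE ->]; last by rewrite mul0r.
    have hb : vl j K (write m 8 0 0) K0 <= Y ord0.
      by apply: hY => //; apply: sampled_agree hs; apply: agree_write.
    by rewrite eqxx mul1r addr0; have := val_dt d hb; have := E0; lra.
  pose m1 := write m 13 0 0.
  have ag1 : agree [:: 8; 13; 14; 15]%N m m1 by apply: agree_write.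
  have hs1 := sampled_agree ag1 hs.
  have d : dt (set_var 13 (Lit 0)) m m1 1 by apply: dt_set.
  have m111 : m1 11%N 0%N = k%:R.
    by case: hs1 => ag _ _; rewrite (ag 11%N isT) (prep_root prep).
  have H := @val_search _ _ _ U EO E Phi hU E0 Phi0 u uv label_uv oracle_uv S
    j K m1 k Y (sampled_marks hs1) m111 M0 (write_same m 13 0 0) Y0.
  apply: (le_trans (lerD (lexx E) (lerD (lexx E) (val_seq U EO E0 Phi0 _ _ _ _ _ sqnorm_ket0)))).
  have /(val_dt d) : vl j (search_loop :: K) m1 K0 <=
      search_cost u S k * E + \sum_i amp1 ang i ^+ 2 / good ang * Y i.
    apply: H => m' i ag' m'8; apply: hY => //; apply: sampled_agree hs1.
    by apply: agree_sub ag' => a; rewrite !inE => /or3P[->|->|->]; rewrite ?orbT.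
  by have := E0; lra.
rewrite (ltn_eqF ylt) /=.
have := val_dt (det_skip U EO E0 Phi0 m sqnorm_ket0) (hY m (inord y) hs _).
by rewrite inordK // => /(_ m8); have := E0; lra.
Qed.

(** A function of the label alone, so that its average over the table is an instance of
    [cell_sum]. *)
Definition accept_bound (b : I -> R) (y : R) : R :=
  if y == n.+1%:R then (11 + miss_cost) * E + \sum_i tail i * b i
  else 11 * E + b (inord (Num.truncn y)).

Lemma val_accept j K o m (c : nat) (b : I -> R) : sampled o m ->
  m 14%N 0%N = c%:R -> (c < l)%N -> (forall i, 0 <= b i) ->
  (forall m' (i : I), sampled (rcons o i) m' -> vl j K m' K0 <= b i) ->
  vl j (accept :: K) m K0 <= accept_bound b (mp 4%N c).
Proof.
move=> hs m14 cl b0 hb; pose m1 := write m 8 0 (mp 4%N c).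
have m4 : m 4%N = mp 4%N by case: hs => ag _ _; rewrite (ag 4%N isT).
have d1 : dt (set_var 8 (Cell 4 (var 14))) m m1 1.
  by apply: dt_set => //; rewrite /ceval /= natrK m14 natrK m4.
have hs1 : sampled o m1 by apply: sampled_agree hs; apply: agree_write.
have b3 i : 0 <= 3 * E + b i by rewrite addr_ge0 ?mulr_ge0.
have it : is_item (n := n) (m1 8%N 0%N) by rewrite /m1 write_same; apply: (prep_item prep).
have h := @val_choose j (emit :: K) o m1 (fun i => 3 * E + b i) hs1 b3 it
  (fun m' i hs' h8 => val_emit hs' h8 (fun m'' => hb m'' i)).
rewrite /m1 write_same -/m1 in h.
apply: (le_trans (val_seq U EO E0 Phi0 _ _ _ _ _ sqnorm_ket0)).
have h' := le_trans (val_seq U EO E0 Phi0 _ _ _ _ _ sqnorm_ket0) (lerD (lexx E) h).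
have := val_dt d1 h'; rewrite /accept_bound; case: ifP => _.
  under eq_bigr do rewrite mulrDr.
  by rewrite big_split /= -mulr_suml sum_tail; have := E0; lra.
by have := E0; lra.
Qed.

Lemma cell_sum1 : cell_sum mp l (fun=> 1) = T%:R.
Proof.
rewrite (prep_sum prep) -[RHS](sum_cells u T S G0) mulr1; congr (_ + _).
by apply: eq_bigr => i _; rewrite mulr1.
Qed.

Lemma le_cell_count : (T <= l)%N.
Proof.
rewrite -(ler_nat R) -cell_sum1 (_ : l%:R = \sum_(c < l) 1); last by rewrite sumr_const card_ord.
by apply: ler_sum => c _; rewrite mulr1; have /andP[] := clamp01 (mp 5%N c).
Qed.

Lemma T_pos : 0 < T%:R :> R.
Proof. by rewrite ltr0n; case/andP: T1 => h _; apply: ltn_trans h. Qed.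

Lemma cell_count_pos : 0 < l%:R :> R.
Proof. by apply: (lt_le_trans T_pos); rewrite ler_nat le_cell_count. Qed.

Lemma cell_sum_accept b : cell_sum mp l (accept_bound b) =
  T%:R * (11 * E) + w * T%:R / G * (miss_cost * E) + T%:R * \sum_i law i * b i.
Proof.
rewrite (prep_sum prep) /accept_bound eqxx law_cells.
rewrite (eq_bigr (fun i => cells u T G i * (11 * E) + cells u T G i * b i)); last first.
  move=> i _; rewrite natrK (eqr_nat R) (ltn_eqF (ltn_ord i)) inord_val; ring.
rewrite big_split /= -mulr_suml.
have -> : \sum_(i in S) cells u T G i = T%:R - w * T%:R / G.
  by rewrite -[X in X - _](sum_cells u T S G0) addrK.
by ring.
Qed.

(** Rejection: the acceptance probabilities of the l cells sum to T, so a weight l - T out of l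
    returns to the same prefix, where [B] is the bound. *)
Lemma val_sample j K o m (b : I -> R) (B : R) : sampled o m -> (forall i, 0 <= b i) ->
  (forall m' (i : I), sampled (rcons o i) m' -> vl j K m' K0 <= b i) ->
  (forall m', sampled o m' -> vl j K m' K0 <= B) -> 0 <= B ->
  vl j (sample :: K) m K0 <= 8 * E + l%:R^-1 * (T%:R * (11 * E) +
    w * T%:R / G * (miss_cost * E) + T%:R * (\sum_i law i * b i) + (l%:R - T%:R) * B).
Proof.
move=> hs b0 hb hB B0.
have lE : l.-1.+1 = l by rewrite prednK // -(ltr_nat R) cell_count_pos.
apply: (le_trans (val_seq U EO E0 Phi0 _ _ _ _ _ sqnorm_ket0)).
set K1 := _ :: K.
have he2 : Num.truncn (ceval m (Bin OSub (var 6) (Lit 1))) = l.-1.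
  rewrite /ceval /= !natrK; case: hs => ag _ _; rewrite (ag 6%N isT) (prep_count prep).
  by rewrite -{1}lE -natr1 addrK natrK.
have := val_rand U EO E0 Phi0 j 14 (Lit 0) K1 he2.
rewrite [Num.truncn _]natrK lE => h14.
rewrite -cell_sum_accept.
have main (c : 'I_l) : vl j K1 (write m 14 0 c%:R) K0 <=
    6 * E + (clamp (mp 5%N c) * accept_bound b (mp 4%N c) + (1 - clamp (mp 5%N c)) * B).
  set m1 := write m 14 0 c%:R.
  have ag1 : agree [:: 8; 13; 14; 15]%N m m1 by apply: agree_write.
  have hs1 : sampled o m1 := sampled_agree ag1 hs.
  have hq : qeval m1 (bs ord0 (vzero V) false : basis V 1 n) (Cell 5 (var 14)) = mp 5%N c.
    by rewrite /qeval /= natrK {2}/m1 write_same natrK; case: hs1 => ag _ _; rewrite (ag 5%N isT).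
  have h1 := val_flip U EO E0 Phi0 j 13 (If (var 13) accept (Skip 1) :: K) hq.
  have h2 := val_if U EO E0 Phi0 j (var 13) accept (Skip 1) K (write m1 13 0 1) sqnorm_ket0.
  have h3 := val_if U EO E0 Phi0 j (var 13) accept (Skip 1) K (write m1 13 0 0) sqnorm_ket0.
  rewrite !eval_var !write_same eqxx oner_eq0 /= in h2 h3.
  have hw t : sampled o (write m1 13 0 t) by apply: sampled_agree hs1; apply: agree_write.
  have h4 := val_accept (hw 1) (c := c) (erefl _) (ltn_ord c) b0 hb.
  have h5 := val_dt (det_skip U EO E0 Phi0 (write m1 13 0 0) sqnorm_ket0) (hB _ (hw 0)).
  have /andP[c0 c1] := clamp01 (mp 5%N c).
  apply: (le_trans (val_seq U EO E0 Phi0 _ _ _ _ _ sqnorm_ket0)).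
  move: (clamp _) c0 c1 h1 => a a0 a1 h1.
  have h6 := ler_wpM2l a0 (le_trans h2 (lerD (lexx E) h4)).
  have a10 : 0 <= 1 - a by rewrite subr_ge0.
  have h7 := ler_wpM2l a10 (le_trans h3 (lerD (lexx E) h5)).
  have : 0 <= a * E by rewrite mulr_ge0.
  by have := le_trans h1 (lerD (lexx _) (lerD h6 h7)); lra.
have sumE : \sum_(c < l) (6 * E + (clamp (mp 5%N c) * accept_bound b (mp 4%N c) +
    (1 - clamp (mp 5%N c)) * B)) =
  l%:R * (6 * E) + (cell_sum mp l (accept_bound b) + (l%:R - T%:R) * B).
  have s3 : \sum_(c < l) (1 - clamp (mp 5%N c)) * B = (l%:R - T%:R) * B.
    rewrite -mulr_suml sumrB sumr_const card_ord; congr ((_ - _) * _).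
    by rewrite -cell_sum1; apply: eq_bigr => c _; rewrite mulr1.
  by rewrite !big_split /= s3 sumr_const card_ord -[_ *+ l]mulr_natl.
have hsum : \sum_(c < l) vl j K1 (write m 14 0 c%:R) K0 <= l%:R * (6 * E) +
    (cell_sum mp l (accept_bound b) + (l%:R - T%:R) * B).
  by rewrite -sumE; apply: ler_sum => c _; apply: main.
have li : 0 <= (l%:R : R)^-1 by rewrite invr_ge0 ler0n.
have := ler_wpM2l li hsum.
rewrite mulrDr (mulrA _ _ (6 * E)) mulVf ?gt_eqF ?cell_count_pos // mul1r => hs2.
by have := le_trans h14 (lerD (lexx E) hs2); lra.
Qed.

(** On average l/T rounds of 8 steps and a guard, one acceptance, and a search with probability
    w/G. *)
Definition sample_cost : R := 9 * l%:R / T%:R + 11 + w / G * miss_cost.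

Lemma miss_cost_ge0 : 0 <= miss_cost.
Proof.
rewrite /miss_cost; case: eqP => // /eqP M0.
apply: divr_ge0; first by rewrite addr_ge0 ?mulr_ge0 ?ler0n.
by apply/ltW/hit_gt0/good_gt0.
Qed.

Lemma sample_cost_ge0 : 0 <= sample_cost.
Proof.
have := miss_cost_ge0 => h; rewrite /sample_cost !addr_ge0 ?mulr_ge0 ?invr_ge0 ?ler0n ?subr_ge0 //.
exact: ltW.
Qed.

(** By induction on the fuel, the only thing that a rejected round uses up. *)
Lemma val_sampling j o m : sampled o m -> (size o <= T)%N ->
  vl j [:: sampling] m K0 <=
  ((T - size o)%:R * sample_cost + 1) * E + W (T - size o)%N o.
Proof.
elim: j o m => [|j IH] o m hs sT.
  by rewrite /= addr_ge0 ?W_ge0 // mulr_ge0 ?addr_ge0 ?mulr_ge0 ?ler0n ?sample_cost_ge0.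
have guard : ceval m (Bin OLess (var 12) (input 1)) = (size o < T)%N%:R.
  rewrite /ceval /= !natrK (input_mp _ hs); case: hs => _ -> _.
  by rewrite /= ltr_nat.
rewrite /sampling val_whileS ?sqnorm_ket0 // guard pnatr_eq0 eqb0 negbK.
have [lt|ge] := ltnP (size o) T; last first.
  have sE : size o = T by apply/eqP; rewrite eqn_leq sT.
  have -> : vl j [::] m K0 = Phi m by case: j {IH} => [|j]; rewrite /= sqnorm_ket0 mulr1.
  rewrite sE subnn mul0r add0r mul1r lerD2l; apply: Phi_psi => //.
  by case: hs => _ _; rewrite sE.
have rE : (T - size o = (T - (size o).+1).+1)%N by rewrite subnSK.
set r := (T - (size o).+1)%N in rE.
have := sample_cost_ge0; set be := sample_cost => be0.
rewrite -/sampling rE.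
have h := @val_sample j [:: sampling] o m (fun i => (r%:R * be + 1) * E + W r (rcons o i))
  ((r.+1%:R * be + 1) * E + W r.+1 o) hs.
apply: (le_trans (lerD (lexx E) (h _ _ _ _))).
- by move=> i; rewrite addr_ge0 ?W_ge0 // mulr_ge0 ?addr_ge0 ?mulr_ge0 ?ler0n.
- by move=> m' i hs'; have := IH _ _ hs'; rewrite size_rcons -/r -/be; apply.
- by move=> m' hs'; rewrite -rE; apply: IH.
- by rewrite addr_ge0 ?W_ge0 // mulr_ge0 ?addr_ge0 ?mulr_ge0 ?ler0n.
under eq_bigr do rewrite mulrDr.
rewrite big_split /= -mulr_suml sum_law mul1r.
set X := \sum_i _.
have hbe : T%:R * be = 9 * l%:R + 11 * T%:R + w * T%:R / G * miss_cost.
  by rewrite /be /sample_cost; field; rewrite !gt_eqF ?T_pos.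
rewrite -[r.+1%:R]natr1; set V0 := ((r%:R + 1) * be + 1) * E + X.
have hbeE : T%:R * be * E = (9 * l%:R + 11 * T%:R + w * T%:R / G * miss_cost) * E by rewrite hbe.
(* [V0], the bound for the prefix [o], reproduces itself through a rejection; [sample_cost] is
   chosen so that exactly 9 E remain for the guard and the 8 steps of the round. *)
rewrite (_ : _ + (l%:R - T%:R) * V0 = l%:R * (V0 - 9 * E)); last first.
  rewrite /V0; move: hbeE; move: (w * T%:R / G) => x; lra.
by rewrite mulKf ?gt_eqF ?cell_count_pos //; lra.
Qed.

Lemma val_sampler_prepared j :
  vl j [:: sampling] mp K0 <= (T%:R * sample_cost + 1) * E + W T [::].
Proof.
have := @val_sampling j [::] mp; rewrite /= subn0; apply=> //; split=> //.
by rewrite (prep_agree prep (a := 12%N) isT).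
Qed.

End Sampler.

(** * Cost in the regime of the time bound *)

Section Regime.
Context {R : realType} {n : nat} (u : 'rV[R]_n.+1) (T : nat) (G : R) (S : {set 'I_n.+1}).
Hypotheses (T1 : (1 < T < n.+1)%N) (G0 : 0 < G) (lSG : l1 u S <= G).
Local Notation M := (linf u (~: S)%SET).
Local Notation w := (G - l1 u S).
Local Notation lam := (l1 u (~: S)%SET).
Local Notation L := (l1 u [set: 'I_n.+1]%SET).
Local Notation st := (Num.sqrt (T%:R : R)).
Local Notation sn := (Num.sqrt (n.+1%:R : R)).

Lemma l1_split : L = l1 u S + lam.
Proof.
rewrite /l1 (bigID (mem S)) /=; congr (_ + _); apply: eq_bigl => i; by rewrite !inE.
Qed.

Lemma linf_le_l1 (A : {set 'I_n.+1}) : linf u A <= l1 u A.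
Proof.
apply/bigmax_leP; split=> [|i iA]; first by apply: sumr_ge0.
by rewrite /l1 (bigD1 i) //= lerDl sumr_ge0.
Qed.

Hypothesis GL : `|G - L| <= L / st.
Hypothesis SE : S = [set i : 'I_n.+1 | G / T%:R <= `|u ord0 i|]%SET.

Lemma T_gt0 : 0 < T%:R :> R.
Proof. by rewrite ltr0n; case/andP: T1 => h _; apply: ltn_trans h. Qed.

(** Entries of size at least G/T with a sum of at most G cannot be more than T. *)
Lemma card_heavy : #|S|%:R <= T%:R :> R.
Proof.
have h : #|S|%:R * (G / T%:R) <= l1 u S.
  rewrite /l1 mulr_natl -sumr_const; apply: ler_sum => i.
  by rewrite {1}SE inE.
have := le_trans h lSG; rewrite mulrA ler_pdivrMr ?T_gt0 // mulrC.
by rewrite ler_pM2l.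
Qed.

Lemma linf_light : M <= G / T%:R.
Proof.
apply/bigmax_leP; split=> [|i]; first by rewrite divr_ge0 // ltW.
by rewrite SE !inE -ltNge => /ltW.
Qed.

Lemma st_sqr : st ^+ 2 = T%:R. Proof. by rewrite sqr_sqrtr ?ler0n. Qed.
Lemma sn_sqr : sn ^+ 2 = n.+1%:R. Proof. by rewrite sqr_sqrtr ?ler0n. Qed.

(** A rational lower bound of sqrt 2, as T >= 2. *)
Lemma st_ge : 7 / 5 <= st.
Proof.
rewrite -(@ler_pXn2r _ 2) ?nnegrE ?sqrtr_ge0 ?divr_ge0 // st_sqr.
by have : (2 : R) <= T%:R; [rewrite ler_nat; case/andP: T1|lra].
Qed.

Lemma st_le_sn : st <= sn.
Proof. by rewrite ler_sqrt ?ltr0n // ler_nat; case/andP: T1 => _ /ltnW. Qed.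

Lemma st_gt0 : 0 < st. Proof. by have := st_ge; lra. Qed.

(** The error on the norm is at most 5/7 of it, hence G >= 2L/7. *)
Lemma L_over_st : L / st <= 7 / 2 * G / st.
Proof.
rewrite ler_pM2r ?invr_gt0 ?st_gt0 //.
have L0 : 0 <= L by apply: sumr_ge0.
have : L / st <= 5 / 7 * L.
  by rewrite ler_pdivrMr ?st_gt0 //; have := st_ge; nra.
by move: GL; rewrite ler_norml => /andP[h1 h2]; lra.
Qed.

Lemma w_le : 0 <= w <= G.
Proof.
have : 0 <= l1 u S by apply: sumr_ge0.
by rewrite subr_ge0 lSG /=; lra.
Qed.

(* Away from the first case of [goal_sqr] the excess [w] dominates the error on the norm,
   hence estimates the light mass up to a factor two. *)
Lemma w_large : ~~ (w * w * T%:R < 49 * (G * G)) -> 7 * G <= w * st /\ w <= 2 * lam.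
Proof.
rewrite -leNgt => h.
have h1 : 7 * G <= w * st.
  rewrite -(@ler_pXn2r _ 2) ?nnegrE ?mulr_ge0 ?sqrtr_ge0 ?(ltW G0) //; last first.
    by case/andP: w_le.
  by rewrite !exprMn st_sqr !expr2; lra.
(* The constant 7 is twice the 7/2 of [L_over_st]: the error on the norm is at most w/2, so at least
   w/2 of light mass is left. *)
split=> //; have h2 : 7 / 2 * G / st <= w / 2.
  by rewrite ler_pdivrMr ?st_gt0 //; lra.
have := L_over_st; move: GL; rewrite ler_norml l1_split => /andP[h3 h4] h5; lra.
Qed.

(** In dimension N the condition of [hit_ge] reads M N <= lam (k+1)^2. It follows from M <= lam when
    k^2 >= N, and from w <= 2 lam when k^2 >= 2NM/w. *)
Lemma hit_quarter k : M != 0 -> goal_sqr u T G S <= k%:R ^+ 2 -> 1 / 4 <= hit (angle u S) k.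
Proof.
move=> M0 hk; have M1 : 0 < M by rewrite lt_def M0 linf_ge0.
have lam0 : 0 < lam by apply: linf_gt0_l1.
have g0 := good_gt0 M0.
have N0 : 0 < n.+1%:R :> R by rewrite ltr0n.
apply: hit_ge => //.
  rewrite /good; apply: (@le_trans _ _ (\sum_(i < n.+1) 1 / 2 / n.+1%:R)).
    apply: ler_sum => i _; rewrite (amp1_sqr (angle_le1 u S)).
    by rewrite ler_pM2r ?invr_gt0 //; case/andP: (angle01 u S i).
  by rewrite sumr_const card_ord -[_ *+ _]mulr_natl mulrCA divff ?mulr1 ?gt_eqF //; lra.
rewrite good_angle (_ : 2 * _ * _ = lam * k.+1%:R ^+ 2 / (M * n.+1%:R)); last first.
  by field; rewrite M0 gt_eqF.
rewrite ler_pdivlMr ?mulr_gt0 // mul1r.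
have k1 : k%:R ^+ 2 <= k.+1%:R ^+ 2 :> R by rewrite lerXn2r ?nnegrE ?ler0n // ler_nat.
have {}hk := le_trans hk k1.
have : 0 <= k.+1%:R ^+ 2 :> R by rewrite sqr_ge0.
move: (k.+1%:R ^+ 2) hk => K + K0.
rewrite /goal_sqr; case: ifPn => [_ hk|/w_large[h1 h2]].
  by apply: ler_pM; rewrite ?linf_ge0 ?ler0n // linf_le_l1.
have w0 : 0 < w by have := st_gt0; have := G0; have /andP[] := w_le; nra.
rewrite ler_pdivrMr // => hk.
by have := ler_wpM2l K0 h2; lra.
Qed.

Lemma root_le (X y : R) (k : nat) : 0 <= y -> X <= y ^+ 2 ->
  ((0 < k)%N -> k.-1%:R ^+ 2 < X) -> k%:R <= y + 1.
Proof.
move=> y0 hX; case: k => [_|k /(_ isT) /= hk]; first by lra.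
rewrite -natr1 lerD2r -(@ler_pXn2r _ 2) ?nnegrE ?ler0n //.
by rewrite ltW // (lt_le_trans hk).
Qed.

(** In the second case M <= G/T and w >= 7G/sqrt T give 2M <= w. *)
Lemma goal_sqr_le : goal_sqr u T G S <= n.+1%:R.
Proof.
rewrite /goal_sqr; case: ifPn => // /w_large[h1 _].
have w0 : 0 < w by have := st_gt0; have := G0; have /andP[] := w_le; nra.
rewrite ler_pdivrMr // -mulrA mulrCA ler_pM2l ?ltr0n //.
have h2 : M * T%:R <= G by rewrite -ler_pdivlMr ?T_gt0 // linf_light.
have : M * st <= M * T%:R.
  apply: ler_wpM2l; first exact: linf_ge0.
  rewrite -[X in _ <= X]st_sqr expr2 ler_peMl ?sqrtr_ge0 //.
  by have := st_ge; lra.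
have := st_gt0; have := G0; have := linf_ge0 u (~: S)%SET; nra.
Qed.

(** Tw/G is the expected number of searches. In dimension N it is at most 7 sqrt T in the first
    case, where k <= 2 sqrt N, whence 14. In the second case k <= y + 1 with y^2 = 2NG/(Tw), as M <=
    G/T, and (Tw/G) y = sqrt(2TNw/G) with w <= G. *)
Lemma search_total (k : nat) : ((0 < k)%N -> k.-1%:R ^+ 2 < goal_sqr u T G S) ->
  T%:R * (w / G) * k%:R <= 14 * (st * sn).
Proof.
move=> hk; have /andP[w0 wG] := w_le.
have k1 := root_le (sqrtr_ge0 _) (_ : goal_sqr u T G S <= sn ^+ 2) hk.
have st0 := st_gt0; have sn1 : 1 <= sn by have := st_le_sn; have := st_ge; lra.
have wG0 : 0 <= w / G by rewrite divr_ge0 // ltW.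
have [h|h] := boolP (w * w * T%:R < 49 * (G * G)).
  have hw : T%:R * (w / G) <= 7 * st.
    have hws : w * st <= 7 * G.
      rewrite -(@ler_pXn2r _ 2) ?nnegrE ?mulr_ge0 ?(ltW st0) ?(ltW G0) //.
      by rewrite !exprMn st_sqr !expr2; lra.
    rewrite mulrA ler_pdivrMr // (_ : T%:R * w = st * (w * st)).
      by have := ler_wpM2l (ltW st0) hws; lra.
    by rewrite mulrCA -expr2 st_sqr mulrC.
  have {}k1 : k%:R <= 2 * sn by have := k1 _; rewrite sn_sqr goal_sqr_le => /(_ isT); lra.
  have := ler_pM (mulr_ge0 (ler0n _ _) wG0) (ler0n R k) hw k1; lra.
have [h1 _] := w_large h.
have wp : 0 < w by have := G0; nra.
pose y := sn * Num.sqrt (2 * (G / (T%:R * w))).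
have y0 : 0 <= y by rewrite mulr_ge0 ?sqrtr_ge0.
have y2 : y ^+ 2 = n.+1%:R * (2 * (G / (T%:R * w))).
  rewrite exprMn sn_sqr sqr_sqrtr // mulr_ge0 ?divr_ge0 ?(ltW G0) //.
  by rewrite mulr_ge0 ?ler0n.
have hX : goal_sqr u T G S <= y ^+ 2.
  rewrite /goal_sqr (negbTE h) y2 (_ : n.+1%:R * _ = 2 * n.+1%:R * (G / T%:R) / w).
    by rewrite ler_pM2r ?invr_gt0 // ler_pM2l ?mulr_gt0 ?ltr0n // linf_light.
  by field; rewrite !gt_eqF ?T_gt0.
have k2 := root_le y0 hX hk.
have TwG : 0 <= T%:R * (w / G) by rewrite mulr_ge0.
have b1 : T%:R * (w / G) <= st * sn.
  apply: (@le_trans _ _ T%:R); first by rewrite ler_piMr ?ler0n // ler_pdivrMr // mul1r.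
  by rewrite -[X in X <= _]st_sqr expr2 ler_pM2l // st_le_sn.
have b2 : T%:R * (w / G) * y <= 2 * (st * sn).
  rewrite -(@ler_pXn2r _ 2) ?nnegrE ?mulr_ge0 ?invr_ge0 ?(ltW st0) ?(ltW G0) ?sqrtr_ge0 //.
  rewrite exprMn y2 !exprMn st_sqr sn_sqr.
  rewrite [X in X <= _](_ : _ = 2 * (w / G) * (T%:R * n.+1%:R)); last first.
    by field; rewrite !gt_eqF ?T_gt0.
  have : w / G <= 1 by rewrite ler_pdivrMr // mul1r.
  have : 0 <= T%:R * n.+1%:R :> R by rewrite mulr_ge0 ?ler0n.
  by move: (w / G) (T%:R * n.+1%:R) => a b; nra.
have := ler_wpM2l TwG k2; rewrite mulrDr mulr1.
have : 0 <= st * sn by rewrite mulr_ge0 ?sqrtr_ge0.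
by lra.
Qed.

(** The searches dominate with 4 * 22 * 14 = 1232, the 4 being the inverse of the success
    probability; 2000 leaves room for the terms linear in T, and T <= sqrt(TN) in dimension N. *)
Lemma total_cost (k l : nat) : goal_sqr u T G S <= k%:R ^+ 2 ->
  ((0 < k)%N -> k.-1%:R ^+ 2 < goal_sqr u T G S) ->
  l%:R <= #|S|%:R + T%:R + 1 :> R ->
  8 * T%:R + 31 * #|S|%:R + 2 * k%:R + 42 + T%:R * sample_cost u T G S k l <=
  2000 * (st * sn).
Proof.
move=> hk1 hk2 hl; have /andP[w0 wG] := w_le.
have st0 := st_gt0; have s1 := st_ge; have s2 := st_le_sn.
have sn1 : sn <= st * sn by rewrite ler_peMl ?sqrtr_ge0 //; lra.
have k1 : k%:R <= sn + 1.
  by apply: root_le hk2; rewrite ?sqrtr_ge0 // sn_sqr goal_sqr_le.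
have T2 : T%:R <= st * sn by rewrite -[X in X <= _]st_sqr expr2 ler_pM2l.
have cS := card_heavy.
have wG0 : 0 <= w / G by rewrite divr_ge0 // ltW.
have wG1 : w / G <= 1 by rewrite ler_pdivrMr // mul1r.
have miss : miss_cost u S k <= 4 * (22 * k%:R + 17).
  rewrite /miss_cost; case: eqP => [_|/eqP M0].
    by rewrite !mulr_ge0 ?addr_ge0 ?mulr_ge0 ?ler0n.
  rewrite /search_cost ler_pdivrMr ?hit_gt0 ?good_gt0 //.
  have := hit_quarter M0 hk1; have : 0 <= 22 * k%:R + 17 :> R by rewrite addr_ge0 ?mulr_ge0 ?ler0n.
  by nra.
have -> : T%:R * sample_cost u T G S k l =
    9 * l%:R + 11 * T%:R + T%:R * (w / G) * miss_cost u S k.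
  by rewrite /sample_cost; field; rewrite !gt_eqF ?T_gt0.
have TwG : 0 <= T%:R * (w / G) by rewrite mulr_ge0.
have TwG1 : T%:R * (w / G) <= T%:R by rewrite ler_piMr ?ler0n.
have := ler_wpM2l TwG miss; have := search_total hk2.
by move: (T%:R * (w / G)) TwG1 => a; lra.
Qed.

End Regime.

(** * Output distribution and expected run-time of the sampler *)

Section Conclusion.
Context {R : realType} {V : valspace R} {n : nat}.
Context (U : operator R ('I_n.+1 * vtype V)%type) (EO : R).
Hypothesis hU : unitary U.
Local Notation I := 'I_n.+1.
Local Notation qst := (qstate V 1 n).
Local Notation K0 := ([ffun s => (s == ket0 V 1 n)%:R] : qst).
Context (u : 'rV[R]_n.+1) (uv : I -> vtype V).
Hypothesis label_uv : forall i, label (uv i) = u ord0 i.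
Hypothesis oracle_uv : forall i y, U y (i, vzero V) = (y == (i, uv i))%:R.
Context (T : nat) (G : R) (S : {set I}).
Hypotheses (T1 : (1 < T < n.+1)%N) (G0 : 0 < G) (lSG : l1 u S <= G).

Local Notation M := (linf u (~: S)%SET).
Local Notation start := (inputs T G S M).

(** If M = 0 the light mass vanishes, so [D_defined] forces w = 0 and the arbitrary answer 0 gets no
    weight. Otherwise the factors 2M and the dimension cancel between [amp1] and [good]. *)
Lemma law_Dprob i : D_defined u G S -> law u G S i = Dprob u G S i.
Proof.
move=> hD; rewrite /law /Dprob /tail.
case: eqP => [M0|/eqP M0].
  have l0 : l1 u (~: S)%SET = 0.
    rewrite /l1 big1 // => j jS; apply/eqP; rewrite eq_le normr_ge0 andbT -M0.
    exact: le_linf.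
  have GE : G = l1 u S by case: hD => //; rewrite l0 eqxx.
  rewrite -GE subrr !mul0r addr0; case: (i \in S); rewrite ?mul1r ?mul0r //.
  by rewrite divff ?subrr ?mul0r // gt_eqF.
have lam0 := linf_gt0_l1 M0.
rewrite (amp1_sqr (angle_le1 u S)) good_angle /angle.
case: (i \in S); first by rewrite subrr !mul0r mulr0 addr0 mul1r.
by rewrite subr0 mul0r add0r mul1r; field; rewrite M0 !gt_eqF.
Qed.

Lemma val_sampler (E : R) (Phi : memory R -> R) (psi : seq I -> R) :
  0 <= E -> (forall m, 0 <= Phi m) -> (forall o, 0 <= psi o) ->
  (forall m (o : seq I), size o = T ->
    (forall j, (j < T)%N -> m 2%N j = (nth ord0 o j)%:R) -> Phi m <= psi o) ->
  exists k l : nat, [/\ goal_sqr u T G S <= k%:R ^+ 2,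
    (0 < k)%N -> k.-1%:R ^+ 2 < goal_sqr u T G S,
    l%:R <= #|S|%:R + T%:R + 1 :> R &
    forall j, val U EO E Phi j [:: sampler] start K0 <=
      (8 * T%:R + 31 * #|S|%:R + 2 * k%:R + 42 + T%:R * sample_cost u T G S k l) * E +
      expect (law u G S) psi T [::]].
Proof.
move=> E0 Phi0 psi0 hpsi.
have [m [k [l [hp h1 h2 [_ d]]]]] :=
  dt_prepare EO hU E0 Phi0 label_uv oracle_uv T G0 lSG.
exists k, l; split=> //; first exact: (prep_bound hp).
move=> j; apply: (le_trans (val_seq U EO E0 Phi0 _ _ _ _ _ sqnorm_ket0)).
have h3 := val_sampler_prepared EO hU E0 Phi0 label_uv oracle_uv T1 G0 lSG psi0 hpsi hp j.
have := le_trans (d j [:: sampling]) (lerD (lexx _) h3).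
by have := E0; lra.
Qed.

Lemma runtime_bound : 1 <= EO ->
  `|G - l1 u [set: I]%SET| <= l1 u [set: I]%SET / Num.sqrt T%:R ->
  S = [set i : I | G / T%:R <= `|u ord0 i|]%SET ->
  (expected_runtime (run U EO sampler start) <=
    (2000 * (Num.sqrt (T * n.+1)%:R * EO))%:E)%E.
Proof.
move=> EO1 GL SE; apply: ge_ereal_sup => _ [j _ <-]; rewrite lee_fin.
have EO0 : 0 <= EO by lra.
have [k [l [h1 h2 h3 h4]]] := @val_sampler EO (fun=> 0) (fun=> 0) EO0
  (fun=> lexx 0) (fun=> lexx 0) (fun _ _ _ _ => lexx 0).
have := time_reach j (Config [:: sampler] start K0 0) hU EO1.
rewrite [time (Config _ _ _ _)]/= mul0r add0r => h5.
apply: (le_trans h5); apply: (le_trans (h4 j)).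
have -> : expect (law u G S) (fun=> 0) T [::] = 0.
  elim: T [::] => [//|t IH] o /=; rewrite big1 // => i _; by rewrite IH mulr0.
rewrite addr0 mulrA ler_wpM2r // natrM sqrtrM ?ler0n //.
exact: total_cost.
Qed.

Lemma output_cvg (o : T.-tuple I) : D_defined u G S ->
  output_prob (run U EO sampler start) o @ \oo --> \prod_(j < T) Dprob u G S (tnth o j).
Proof.
move=> hD.
pose p (m : memory R) := [forall j : 'I_T, m 2%N j == (tnth o j)%:R].
pose c0 := Config [:: sampler] start K0 0.
set P := \prod_(j < T) _.
have PE : expect (law u G S) (fun s => (s == o)%:R) T [::] = P.
  rewrite expect_indic ?size_tuple // take0 drop0 eqxx mul1r big_tuple.
  by apply: eq_bigr => j _; rewrite law_Dprob.
have pE m (s : seq I) : size s = T ->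
    (forall j, (j < T)%N -> m 2%N j = (nth ord0 s j)%:R) -> p m = (s == o).
  move=> sT hs; apply/forallP/eqP => [h|so j]; last first.
    by rewrite hs // so (tnth_nth ord0).
  apply: (@eq_from_nth _ ord0); rewrite ?size_tuple // sT => j jT.
  have := h (Ordinal jT); rewrite /= hs // (tnth_nth ord0) eqr_nat => /eqP e.
  exact: val_inj.
have outE j : output_prob (run U EO sampler start) o j =
    val U EO 0 (fun m => (p m)%:R) j [:: sampler] start K0.
  exact: (out_reach U EO p j c0).
(* With E = 0 the cost term disappears and the bound on [val] is the target probability itself. *)
have up j : output_prob (run U EO sampler start) o j <= P.
  have [|k [l [_ _ _ h]]] := @val_sampler 0 (fun m => (p m)%:R) (fun s => (s == o)%:R)
    (lexx 0) (fun m => ler0n _ _) (fun s => ler0n _ _).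
    by move=> m s sT hs; rewrite (pE m s).
  by rewrite outE; have := h j; rewrite mulr0 add0r PE.
have dn j : \sum_(c <- reach U EO j c0 | halted c && ~~ p (store c)) sqnorm (psi c) <= 1 - P.
  have b01 (b : bool) : 0 <= 1 - b%:R :> R by case: b; rewrite ?subrr ?subr0.
  have [|k [l [_ _ _ h]]] := @val_sampler 0 (fun m => (~~ p m)%:R) (fun s => 1 - (s == o)%:R)
    (lexx 0) (fun m => ler0n _ _) (fun s => b01 _).
    by move=> m s sT hs; rewrite (pE m s) //; case: (s == o); rewrite ?subrr ?subr0.
  rewrite (out_reach U EO (fun m => ~~ p m)); have := h j.
  by rewrite mulr0 add0r expect_compl ?sum_law // PE.
have [k [l [_ _ _ hB]]] := @val_sampler 1 (fun=> 0) (fun=> 0) ler01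
  (fun=> lexx 0) (fun=> lexx 0) (fun _ _ _ _ => lexx 0).
move: hB; set B := _ * 1 + _ => hB.
pose h j := \sum_(c <- reach U EO j c0 | ~~ halted c) sqnorm (psi c).
have hun j : j%:R * h j <= B := le_trans (unhalted_reach EO j c0 hU) (hB j).
have total j : output_prob (run U EO sampler start) o j +
    \sum_(c <- reach U EO j c0 | halted c && ~~ p (store c)) sqnorm (psi c) + h j = 1.
  have := sqnorm_reach EO j c0 hU; rewrite [RHS]sqnorm_ket0 => <-.
  rewrite [RHS](bigID (@halted R V 1 n)) /=; congr (_ + _).
  by rewrite [RHS](bigID (fun c => p (store c))).
have h1 j : h j <= 1.
  rewrite -(sqnorm_ket0 (R := R) (V := V) (n := n)) -(sqnorm_reach EO j c0 hU) /h.
  by rewrite big_mkcond; apply: ler_sum => c _; case: ifP => // _; apply: sqnorm_ge0.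
have low j : P - (B + 1) * harmonic j <= output_prob (run U EO sampler start) o j.
  (* [harmonic j] is 1/(j+1), and (j+1) h(j) is the sum of j h(j) <= B and h(j) <= 1. *)
  have : h j <= (B + 1) * harmonic j.
    rewrite /harmonic /= ler_pdivlMr ?ltr0n // mulrC -natr1 mulrDl mul1r.
    exact: lerD (hun j) (h1 j).
  by have := total j; have := dn j; lra.
apply: (@squeeze_cvgr _ _ _ _ (fun j => P - (B + 1) * harmonic j) (fun=> P)).
- by apply: nearW => j; rewrite low up.
- rewrite -[X in _ --> X]subr0; apply: cvgB; first exact: cvg_cst.
  by rewrite -[X in _ --> X](mulr0 (B + 1)); apply: cvgMr; exact: cvg_harmonic.
- exact: cvg_cst.
Qed.

End Conclusion.

Theorem theorem3p4 (R : realType) :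
  exists (A : algorithm) (C : R), forall (n T : nat) (u : 'rV[R]_n.+1) (G : R)
    (S : {set 'I_n.+1}) (V : valspace R)
    (U : operator R ('I_n.+1 * vtype V)%type) (EO : R),
  u != 0 -> (1 < T < n.+1)%N -> 0 < G -> l1 u S <= G ->
  eval_oracle u U -> 1 <= EO ->
  let M := linf u (~: S)%SET in
  let cs := run U EO (program A) (inputs T G S M) in
  (D_defined u G S -> forall o : T.-tuple 'I_n.+1,
     output_prob cs o @ \oo --> \prod_(j < T) Dprob u G S (tnth o j)) /\
  (`|G - l1 u [set: 'I_n.+1]%SET| <= l1 u [set: 'I_n.+1]%SET / Num.sqrt T%:R ->
   S = [set i : 'I_n.+1 | G / T%:R <= `|u ord0 i|]%SET ->
   (expected_runtime cs <= (C * (Num.sqrt (T * n.+1)%:R * EO))%:E)%E).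
Proof.
exists (Algorithm sampler), 2000 => n T u G S V U EO _ T1 G0 lSG [hU hO] EO1 M cs.
have /choice[uv huv] : forall i : 'I_n.+1, exists v : vtype V, label v = u ord0 i /\
    forall y, U y (i, vzero V) = (y == (i, v))%:R.
  by move=> i; have [v h1 h2] := hO i; exists v.
have label_uv i := (huv i).1; have oracle_uv i := (huv i).2.
split=> [hD o|hG hS].
  exact: (output_cvg EO hU label_uv oracle_uv T1 G0 lSG hD).
exact: (runtime_bound hU label_uv oracle_uv T1 G0 lSG EO1 hG hS).
Qed.
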